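(* Let $\Omega\subset\mathbb{C}^2$ be a bounded domain with smooth boundary $M=\partial\Omega$, and let $(M,J,\theta)$ be $M$ with the induced CR structure $J$ and a compatible contact form $\theta$. Let $\mathbf{U}\subset\overline\Omega$ be simply connected with $M\subset\mathbf{U}$, let $u:\mathbf{U}\to\mathbb{R}$ be a pluriharmonic function ($\partial\overline\partial u=0$), and put $f:=u|_M$. If $(M^3,J,\theta,f,\mu)$ is a closed CR Yamabe soliton and $f$ vanishes nowhere on $M$, then $(M,J,\theta)$ is a closed pseudohermitian $3$-manifold of constant Tanaka-Webster scalar curvature $\mu$ and vanishing pseudohermitian torsion.
   Context: A pseudohermitian $3$-manifold $(M^3,J,\theta)$ is a smooth $3$-manifold with a global contact form $\theta$, oriented contact structure $\xi=\ker\theta$, and a smooth endomorphism $J:\xi\to\xi$ with $J^2=-\mathrm{Id}$. The Reeb field $\mathbf{T}$ is defined by $\theta(\mathbf{T})=1$, $d\theta(\mathbf{T},\cdot)=0$. Let $T_{1,0},T_{0,1}$ be the $\pm i$-eigenbundles of $J$ on $\mathbb{C}\otimes\xi$. Take a local frame $\{\mathbf{T},Z_1,Z_{\bar1}\}$ with $Z_1\in T_{1,0}$, $Z_{\bar1}=\overline{Z_1}$, dual coframe $\{\theta,\theta^1,\theta^{\bar1}\}$, normalized so that $d\theta=i\theta^1\wedge\theta^{\bar1}$. There is a unique purely imaginary $1$-form $\theta_1{}^1$ with $d\theta^1=\theta^1\wedge\theta_1{}^1+\theta\wedge A^1{}_{\bar1}\theta^{\bar1}$; the pseudohermitian torsion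 components are $A_{\bar1\bar1}=A^1{}_{\bar1}$ and $A_{11}=\overline{A_{\bar1\bar1}}$, and the torsion vanishes if $A_{11}=0$ on $M$. The pseudohermitian connection is given by $\nabla Z_1=\theta_1{}^1\otimes Z_1$, $\nabla Z_{\bar1}=\overline{\theta_1{}^1}\otimes Z_{\bar1}$, $\nabla\mathbf{T}=0$. The Tanaka-Webster scalar curvature $W$ is the real function defined by $d\theta_1{}^1=W\theta^1\wedge\theta^{\bar1}+2i\,\mathrm{Im}(A_{11,\bar1}\theta^1\wedge\theta)$. Indices $0,1,\bar1$ on functions and tensor components denote covariant derivatives along $\mathbf{T},Z_1,Z_{\bar1}$ (e.g. $f_0=\mathbf{T}f$, $f_1=Z_1f$, $f_{11}=Z_1Z_1f-\theta_1{}^1(Z_1)Z_1f$). A CR Yamabe soliton $(M^3,J,\theta,f,\mu)$ is a pseudohermitian $3$-manifold with a smooth real function $f$ and a constant $\mu\in\mathbb{R}$ such that $W+\frac12 f_0=\mu$ and $f_{11}+iA_{11}f=0$. It is closed if $M$ is compact without boundary. The function $u$ is understood to be smooth up to $M$. *)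

(* Defs.v *)
From mathcomp Require Import all_boot all_order all_algebra.
From mathcomp Require Import complex.
From mathcomp Require Import all_classical all_reals all_analysis.

Set Implicit Arguments.
Unset Strict Implicit.
Unset Printing Implicit Defensive.

Import Order.TTheory GRing.Theory Num.Theory.
Import numFieldNormedType.Exports.

Local Open Scope classical_set_scope.
Local Open Scope complex_scope.
Local Open Scope ring_scope.

(* Conventions.
   C^2 is the real normed space 'M[R]_2 : row j holds the real coordinates
   (x_j, y_j) of z_j = x_j + i y_j.  Tangent vectors to C^2 are elements of
   'M[R]_2, vectors of the complexification elements of 'M[R[i]]_2, and a
   covector is the matrix of its coefficients on dx_j, dy_j.  Forms on a
   hypersurface M are sections along M of the cotangent bundle of C^2; only
   their values on tangent vectors of M are ever used.
   2-forms follow (a /\ b)(v, w) = a(v) b(w) - a(w) b(v) and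
   dx_j /\ dx_k (v, w) = v_j w_k - w_j v_k, so that
   d(a dx) (v, w) = (v a) w_x - (w a) v_x. *)

Section Smoothness.
Context {R : realType}.
Local Notation E := 'M[R]_2.

Fixpoint iter_derive (vs : seq E) (f : E -> R) : E -> R :=
  if vs is v :: vs' then iter_derive vs' (fun p => 'D_v f p) else f.

(* C^infinity on V; meant for open V *)
Definition smooth_on (V : set E) (f : E -> R) : Prop :=
  forall (vs : seq E) (p : E), V p -> differentiable (iter_derive vs f) p.

(* smoothness of a function of which only the values on the arbitrary set S
   matter: it extends smoothly to a neighbourhood of each point of S *)
Definition smooth_along (S : set E) (f : E -> R) : Prop :=
  forall p, S p -> exists (V : set E) (g : E -> R),
    [/\ open_nbhs p V, smooth_on V g & forall q, V q -> S q -> g q = f q].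

Definition csmooth_along (S : set E) (F : E -> R[i]) : Prop :=
  smooth_along S (fun p => complex.Re (F p)) /\
  smooth_along S (fun p => complex.Im (F p)).

Definition smooth_field (S : set E) (X : E -> 'M[R]_2) : Prop :=
  forall j k, smooth_along S (fun p => X p j k).

Definition csmooth_field (S : set E) (X : E -> 'M[R[i]]_2) : Prop :=
  forall j k, csmooth_along S (fun p => X p j k).

(* the Wirtinger operators, on complex valued functions *)
Definition cderive (F : E -> R[i]) (p v : E) : R[i] :=
  'D_v (fun q => complex.Re (F q)) p +i* 'D_v (fun q => complex.Im (F q)) p.

Definition dz (j : 'I_2) (F : E -> R[i]) (p : E) : R[i] :=
  2^-1 * (cderive F p (delta_mx j 0) - 'i * cderive F p (delta_mx j 1)).

Definition dzbar (j : 'I_2) (F : E -> R[i]) (p : E) : R[i] :=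
  2^-1 * (cderive F p (delta_mx j 0) + 'i * cderive F p (delta_mx j 1)).

(* u is smooth up to the part of the boundary contained in U, and
   d dbar u = 0 inside *)
Definition pluriharmonic (U : set E) (u : E -> R) : Prop :=
  smooth_along U u /\
  forall p, interior U p -> forall j k : 'I_2,
    dz j (dzbar k (fun q => (u q)%:C)) p = 0.

End Smoothness.

Section Topology.
Context {R : realType}.
Local Notation E := 'M[R]_2.
Local Notation I := (`[0, 1]%classic : set R).

Definition simply_connected (U : set E) : Prop :=
  [/\ U !=set0,
      (forall p q, U p -> U q -> exists c : R -> E,
         [/\ {within I, continuous c}, forall t, I t -> U (c t),
             c 0 = p & c 1 = q])
    & (forall c : R -> E,
         {within I, continuous c} -> (forall t, I t -> U (c t)) -> c 0 = c 1 ->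
         exists H : R * R -> E,
         [/\ {within I `*` I, continuous H},
             forall x, (I `*` I) x -> U (H x),
             forall t, I t -> H (0, t) = c t,
             forall t, I t -> H (1, t) = c 0
           & forall s, I s -> H (s, 0) = c 0 /\ H (s, 1) = c 0])].

Definition bounded_domain (Omega : set E) : Prop :=
  [/\ Omega !=set0, open Omega, connected Omega & bounded_set Omega].

Definition boundary (A : set E) : set E := closure A `\` interior A.

Definition smooth_boundary (Omega : set E) : Prop :=
  forall p, boundary Omega p -> exists (V : set E) (rho : E -> R),
    [/\ open_nbhs p V, smooth_on V rho,
        forall q, V q -> exists v, 'D_v rho q != 0
      & forall q, V q -> (Omega q <-> rho q < 0)].

Definition smooth_hypersurface (M : set E) : Prop :=
  forall p, M p -> exists (V : set E) (rho : E -> R),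
    [/\ open_nbhs p V, smooth_on V rho,
        forall q, V q -> exists v, 'D_v rho q != 0
      & forall q, V q -> (M q <-> rho q = 0)].

End Topology.

Section LinearAlgebra.

Definition pairing (K : nzRingType) (a v : 'M[K]_2) : K :=
  \sum_j \sum_k a j k * v j k.

(* the complex structure of C^2: d/dx_j |-> d/dy_j, d/dy_j |-> - d/dx_j *)
Definition Jst (K : nzRingType) (v : 'M[K]_2) : 'M[K]_2 :=
  \matrix_(j, k) (if k == 0 then - v j 1 else v j 0).

Context {R : realType}.

Definition cmx (v : 'M[R]_2) : 'M[R[i]]_2 := map_mx (fun x : R => x%:C) v.
Definition remx (v : 'M[R[i]]_2) : 'M[R]_2 := map_mx (fun z => complex.Re z) v.
Definition immx (v : 'M[R[i]]_2) : 'M[R]_2 := map_mx (fun z => complex.Im z) v.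
Definition conj_coef (v : 'M[R[i]]_2) : 'M[R[i]]_2 := map_mx (fun z => z^*) v.

(* a /\ b on two real tangent vectors *)
Definition wedge (a b : 'M[R[i]]_2) (v w : 'M[R]_2) : R[i] :=
  pairing a (cmx v) * pairing b (cmx w) - pairing a (cmx w) * pairing b (cmx v).

End LinearAlgebra.

Section Hypersurface.
Context {R : realType}.
Local Notation E := 'M[R]_2.
Implicit Types (M : set E) (p v w : E).

(* v is killed by every smooth function vanishing on M near p *)
Definition tangent M p v : Prop :=
  forall (V : set E) (g : E -> R), open_nbhs p V -> smooth_on V g ->
    (forall q, V q -> M q -> g q = 0) -> 'D_v g p = 0.

(* xi_p = T_p M /\ J (T_p M) *)
Definition contact_plane M p v : Prop := tangent M p v /\ tangent M p (Jst v).

(* a smooth function near p with the same values as f on M near p *)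
Definition local_ext M (f : E -> R) p : E -> R :=
  xget f [set g | exists V : set E,
    [/\ open_nbhs p V, smooth_on V g & forall q, V q -> M q -> g q = f q]].

(* v f at p, for v tangent to M at p and f a function on M; for such v the
   choice of the extension is irrelevant *)
Definition tder M (f : E -> R) p v : R := 'D_v (local_ext M f p) p.

Definition ctder M (F : E -> R[i]) p v : R[i] :=
  tder M (fun q => complex.Re (F q)) p v +i*
  tder M (fun q => complex.Im (F q)) p v.

(* X F, for a complex tangent vector field X along M *)
Definition vder M (X : E -> 'M[R[i]]_2) (F : E -> R[i]) p : R[i] :=
  ctder M F p (remx (X p)) + 'i * ctder M F p (immx (X p)).

(* (d a)(v, w) at p, for v, w tangent to M *)
Definition ext_d M (a : E -> 'M[R]_2) p v w : R :=
  \sum_j \sum_k (tder M (fun q => a q j k) p v * w j k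
               - tder M (fun q => a q j k) p w * v j k).

Definition cext_d M (a : E -> 'M[R[i]]_2) p v w : R[i] :=
  ext_d M (fun q => remx (a q)) p v w +i* ext_d M (fun q => immx (a q)) p v w.

End Hypersurface.

Section Pseudohermitian.
Context {R : realType}.
Local Notation E := 'M[R]_2.
Implicit Types (M : set E) (theta : E -> 'M[R]_2).

(* theta /\ d theta vanishes nowhere on M *)
Definition contact_form M theta : Prop :=
  smooth_field M theta /\
  forall p, M p -> exists v1 v2 v3 : E,
    [/\ tangent M p v1, tangent M p v2, tangent M p v3
      & pairing (theta p) v1 * ext_d M theta p v2 v3
      + pairing (theta p) v2 * ext_d M theta p v3 v1
      + pairing (theta p) v3 * ext_d M theta p v1 v2 != 0].

(* The CR structure is the one induced by C^2.  Positivity of d theta (v, J v)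
   is what makes the normalization d theta = i theta^1 /\ theta^1bar
   possible. *)
Definition pseudohermitian M theta : Prop :=
  [/\ smooth_hypersurface M, contact_form M theta,
      forall p, M p -> forall v, tangent M p v ->
        (pairing (theta p) v = 0 <-> contact_plane M p v)
    & forall p, M p -> forall v, contact_plane M p v -> v != 0 ->
        0 < ext_d M theta p v (Jst v)].

(* a local frame with its dual coframe, connection form and torsion; Z_1bar
   and theta^1bar are the conjugates of fr_Z and fr_th *)
Record frame := Frame {
  fr_dom : set E;
  fr_T : E -> 'M[R]_2;           (* Reeb field *)
  fr_Z : E -> 'M[R[i]]_2;        (* Z_1 *)
  fr_th : E -> 'M[R[i]]_2;       (* theta^1 *)
  fr_om : E -> 'M[R[i]]_2;       (* theta_1^1 *)
  fr_tor : E -> R[i]             (* A^1_1bar = A_1bar1bar *)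
}.

Definition fr_Zbar (F : frame) : E -> 'M[R[i]]_2 := fun p => conj_coef (fr_Z F p).
Definition fr_thbar (F : frame) : E -> 'M[R[i]]_2 :=
  fun p => conj_coef (fr_th F p).

Record adapted_frame M theta (F : frame) : Prop := AdaptedFrame {
  af_open : open (fr_dom F);
  af_smooth_T : smooth_field (M `&` fr_dom F) (fr_T F);
  af_smooth_Z : csmooth_field (M `&` fr_dom F) (fr_Z F);
  af_smooth_th : csmooth_field (M `&` fr_dom F) (fr_th F);
  af_smooth_om : csmooth_field (M `&` fr_dom F) (fr_om F);
  af_smooth_tor : csmooth_along (M `&` fr_dom F) (fr_tor F);
  af_reeb : forall p, M p -> fr_dom F p ->
    [/\ tangent M p (fr_T F p), pairing (theta p) (fr_T F p) = 1
      & forall v, tangent M p v -> ext_d M theta p (fr_T F p) v = 0];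
  (* Z_1 is a section of T_{1,0} *)
  af_type10 : forall p, M p -> fr_dom F p ->
    [/\ contact_plane M p (remx (fr_Z F p)),
        contact_plane M p (immx (fr_Z F p))
      & Jst (fr_Z F p) = 'i *: fr_Z F p];
  af_dual : forall p, M p -> fr_dom F p ->
    [/\ pairing (fr_th F p) (fr_Z F p) = 1,
        pairing (fr_th F p) (fr_Zbar F p) = 0
      & pairing (fr_th F p) (cmx (fr_T F p)) = 0];
  (* d theta = i theta^1 /\ theta^1bar *)
  af_normalized : forall p, M p -> fr_dom F p ->
    forall v w, tangent M p v -> tangent M p w ->
    (ext_d M theta p v w)%:C = 'i * wedge (fr_th F p) (fr_thbar F p) v w;
  (* theta_1^1 is purely imaginary *)
  af_imaginary : forall p, M p -> fr_dom F p -> forall v, tangent M p v ->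
    complex.Re (pairing (fr_om F p) (cmx v)) = 0;
  (* d theta^1 = theta^1 /\ theta_1^1 + theta /\ A^1_1bar theta^1bar *)
  af_structure : forall p, M p -> fr_dom F p ->
    forall v w, tangent M p v -> tangent M p w ->
    cext_d M (fr_th F) p v w =
      wedge (fr_th F p) (fr_om F p) v w
      + fr_tor F p * wedge (cmx (theta p)) (fr_thbar F p) v w
}.

Definition A11 (F : frame) : E -> R[i] := fun p => (fr_tor F p)^*.

(* A_{11,1bar} *)
Definition A11_1bar M (F : frame) (p : E) : R[i] :=
  vder M (fr_Zbar F) (A11 F) p
  - 2 * pairing (fr_om F p) (fr_Zbar F p) * A11 F p.

(* f_0 *)
Definition cov_0 M (F : frame) (f : E -> R) (p : E) : R :=
  tder M f p (fr_T F p).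

(* f_1 *)
Definition cov_1 M (F : frame) (f : E -> R) (p : E) : R[i] :=
  vder M (fr_Z F) (fun q => (f q)%:C) p.

(* f_11 *)
Definition cov_11 M (F : frame) (f : E -> R) (p : E) : R[i] :=
  vder M (fr_Z F) (cov_1 M F f) p
  - pairing (fr_om F p) (fr_Z F p) * cov_1 M F f p.

(* W is the function such that, in the adapted frames (which exist around
   every point of M),
   d theta_1^1 = W theta^1 /\ theta^1bar + 2i Im (A_{11,1bar} theta^1 /\ theta) *)
Definition is_webster_curvature M theta (W : E -> R) : Prop :=
  forall p, M p ->
    (exists2 F : frame, adapted_frame M theta F & fr_dom F p) /\
    (forall F : frame, adapted_frame M theta F -> fr_dom F p ->
     forall v w, tangent M p v -> tangent M p w ->
     cext_d M (fr_om F) p v w =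
       (W p)%:C * wedge (fr_th F p) (fr_thbar F p) v w
       + 2 * 'i * (complex.Im (A11_1bar M F p
                    * wedge (fr_th F p) (cmx (theta p)) v w))%:C).

Definition vanishing_torsion M theta : Prop :=
  forall F : frame, adapted_frame M theta F ->
  forall p, M p -> fr_dom F p -> A11 F p = 0.

Definition closed_pseudohermitian M theta : Prop :=
  compact M /\ pseudohermitian M theta.

(* W + f_0 / 2 = mu and f_11 + i A_11 f = 0 *)
Definition CR_Yamabe_soliton M theta (f : E -> R) (mu : R) : Prop :=
  [/\ pseudohermitian M theta, smooth_along M f
    & exists2 W : E -> R, is_webster_curvature M theta W &
      forall F : frame, adapted_frame M theta F ->
      forall p, M p -> fr_dom F p ->
        W p + 2^-1 * cov_0 M F f p = mu /\
        cov_11 M F f p + 'i * A11 F p * (f p)%:C = 0].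

Definition closed_CR_Yamabe_soliton M theta (f : E -> R) (mu : R) : Prop :=
  compact M /\ CR_Yamabe_soliton M theta f mu.

End Pseudohermitian.

(* Main.v *)
Require Import Defs.
From mathcomp Require Import all_boot all_order all_algebra.
From mathcomp Require Import complex.
From mathcomp Require Import all_classical all_reals all_analysis.
From mathcomp Require Import finmap ring lra.
Import Order.TTheory GRing.Theory Num.Theory.
Import numFieldNormedType.Exports.
Local Open Scope classical_set_scope.
Local Open Scope ring_scope.
Set Implicit Arguments.
Unset Strict Implicit.
Unset Printing Implicit Defensive.

(** Write Z_1 = X + i Y, theta^1 = a1 + i a2, theta_1^1 = i o2 on M and
    A_11 = t1 - i t2, with f_1 = Xf + i Yf. The proof applies Stokes' theorem on
    the compact hypersurface M to three 2-forms. Each of them has for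
    differential a nonnegative multiple h of the volume form
    theta /\ d theta, so that h vanishes identically.

    The first one is f (d o2 + mu d theta) - 2 (P a2 + Q a1) /\ theta with
    P + i Q = (Xf - i Yf) (t1 - i t2). It is the same in all frames: a rotation
    of the frame adds a closed form to o2 and multiplies P + i Q and theta^1 by
    conjugate factors of modulus one. Webster's equation and the two soliton
    equations give h = f_0^2 / 2 (soliton_curvature). Hence f_0 = 0, and
    W = mu.

    Pluriharmonicity provides the form alpha(v) = - (J v) u, which is closed
    inside Omega, hence along M by continuity (dc_closed). It is given on the
    contact plane by alpha(X) = Yf and alpha(Y) = - Xf; put tau = alpha(T).
    When f_0 = 0, the identities d df = 0 and d alpha = 0 on M, together with
    the equation f_11 + i A_11 f = 0, determine all second derivatives of f
    along the contact plane, and imply that C = f tau + 2 |f_1|^2 is annihilated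
    by X and Y (Cfun_derive). For the form - (C / f) alpha /\ theta one finds
    h = (C / f)^2 (Cfun_eq0), so that C = 0. Once C = 0, the form
    f alpha /\ theta has h = 4 |f_1|^2 (levi_eq0). Thus f_1 = 0, and the soliton
    equation reduces to A_11 f = 0, where f has no zero.

    Stokes' theorem itself (stokes) is proved in the ambient R^4. A partition of
    unity produces a global defining function rho of Omega and a global 2-form
    B; the vector field dual to dB is divergence free, and its flux density
    through M is a positive multiple of h. Integration by parts over the layers
    -e < rho < 0 shows that a nonnegative flux density must vanish (tube). An
    averaging functional that kills the partial derivatives of compactly
    supported functions and is positive is all the integration theory that this
    argument asks for; it is the ultralimit of averages over lattices
    (exists_mean). *)

(** * Functions of class Ck *)

Section Calculus.
Context {R : realType} {E : normedModType R}.
Implicit Types (f g : E -> R) (p v w : E) (V W : set E).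

Lemma diffD f g p : differentiable f p -> differentiable g p ->
  differentiable (fun x => f x + g x) p.
Proof. exact: differentiableD. Qed.

Lemma diffN f p : differentiable f p -> differentiable (fun x => - f x) p.
Proof. exact: differentiableN. Qed.

Lemma diffM f g p : differentiable f p -> differentiable g p ->
  differentiable (fun x => f x * g x) p.
Proof. exact: differentiableM. Qed.

Lemma diffC (c : R) p : differentiable (fun _ : E => c) p.
Proof. exact: differentiable_cst. Qed.

Lemma dD f g p v : differentiable f p -> differentiable g p ->
  'D_v (fun x => f x + g x) p = 'D_v f p + 'D_v g p.
Proof. by move=> df dg; apply: (@deriveD R E R f g); apply: diff_derivable. Qed.

Lemma dN f p v : differentiable f p -> 'D_v (fun x => - f x) p = - 'D_v f p.
Proof. by move=> df; apply: (@deriveN R E R f); apply: diff_derivable. Qed.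

Lemma dB f g p v : differentiable f p -> differentiable g p ->
  'D_v (fun x => f x - g x) p = 'D_v f p - 'D_v g p.
Proof. by move=> df dg; apply: (@deriveB R E R f g); apply: diff_derivable. Qed.

Lemma dM f g p v : differentiable f p -> differentiable g p ->
  'D_v (fun x => f x * g x) p = 'D_v f p * g p + f p * 'D_v g p.
Proof.
move=> df dg; rewrite (@deriveM R E f g); try exact: diff_derivable.
by rewrite addrC mulrC.
Qed.

Lemma dV f p v : differentiable f p -> f p != 0 ->
  'D_v (fun x => (f x)^-1) p = - (f p) ^- 2 * 'D_v f p.
Proof. by move=> df f0; rewrite deriveV//; apply: diff_derivable. Qed.

Lemma dC (c : R) p v : 'D_v (fun _ => c) p = 0.
Proof. exact: derive_cst. Qed.

Lemma dsum (I : Type) (r : seq I) (F : I -> E -> R) p v :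
  (forall i, differentiable (F i) p) ->
  differentiable (fun x => \sum_(i <- r) F i x) p /\
  'D_v (fun x => \sum_(i <- r) F i x) p = \sum_(i <- r) 'D_v (F i) p.
Proof.
move=> dF; elim: r => [|i r [IH1 IH2]].
  rewrite big_nil; under eq_fun do rewrite big_nil.
  by split; [exact: differentiable_cst|exact: dC].
under eq_fun do rewrite big_cons.
split; first exact: (@differentiableD R E R (F i)).
by rewrite dD// IH2 big_cons.
Qed.

Lemma dlinD f p v w : differentiable f p ->
  'D_(v + w) f p = 'D_v f p + 'D_w f p.
Proof. by move=> df; rewrite !deriveE// linearD. Qed.

Lemma dlinZ f p (a : R) v : differentiable f p ->
  'D_(a *: v) f p = a * 'D_v f p.
Proof. by move=> df; rewrite !deriveE// linearZ. Qed.

Lemma dlinN f p v : differentiable f p ->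
  'D_(- v) f p = - 'D_v f p.
Proof. by move=> df; rewrite !deriveE// linearN. Qed.

Lemma dlin_sum (I : Type) (r : seq I) (F : I -> E) f p : differentiable f p ->
  'D_(\sum_(i <- r) F i) f p = \sum_(i <- r) 'D_(F i) f p.
Proof.
by move=> df; rewrite deriveE// linear_sum; apply: eq_bigr => i _; rewrite deriveE.
Qed.

Lemma near_eq_differentiable f g p : (\forall x \near p, f x = g x) ->
  differentiable f p -> differentiable g p.
Proof.
move=> fg df.
have fgp : f p = g p by apply: (nbhs_singleton fg).
apply/diff_locallyP; have /diff_locallyP[dc de] := df.
have H : g \o shift p = cst (g p) + 'd f p +o_ 0 id.
  apply/eqaddoP => e e0.
  have /eqaddoP /(_ e e0) := de.
  have fg0 : \forall h \near (0:E), f (h + p) = g (h + p).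
    by move: fg; rewrite (near_shift 0) subr0; apply: filterS.
  rewrite !near_simpl => H0; near=> h.
  have fgh : f (h + p) = g (h + p) by near: h.
  have : `|(f \o shift p - (cst (f p) + 'd f p)) h| <= e * `|h| by near: h.
  by rewrite !fctE /= /shift /= fgh fgp.
have -> : 'd g p = 'd f p :> (E -> R) by apply: diff_unique.
by split.
Unshelve. all: by end_near. Qed.

Lemma open_near V p : open V -> V p -> \forall x \near p, V x.
Proof. by move=> oV Vp; apply: open_nbhs_nbhs. Qed.

Lemma eq_on_derive V f g p v : open V -> V p -> (forall x, V x -> f x = g x) ->
  'D_v f p = 'D_v g p.
Proof.
move=> oV Vp fg; have [->|v0] := eqVneq v 0; first by rewrite !derive0.
apply: near_eq_derive => //.
by apply: filterS (open_near oV Vp) => x /fg.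
Qed.

(** Ck k means k + 1 times differentiable. *)
Fixpoint Ck (k : nat) (V : set E) (f : E -> R) : Prop :=
  (forall p, V p -> differentiable f p) /\
  if k is k'.+1 then forall v, Ck k' V (fun p => 'D_v f p) else True.

Lemma Ck_diff k V f p : Ck k V f -> V p -> differentiable f p.
Proof. by case: k => [|k] [+ _]; apply. Qed.

Lemma Ck_cont k V f p : Ck k V f -> V p -> {for p, continuous f}.
Proof. by move=> c Vp; apply/differentiable_continuous/(Ck_diff c). Qed.

Lemma CkD1 k V f v : Ck k.+1 V f -> Ck k V (fun p => 'D_v f p).
Proof. by case=> _; apply. Qed.

Lemma Ck_S k V f : Ck k.+1 V f -> Ck k V f.
Proof.
elim: k f => [|k IH] f; first by case.
move=> [df d2]; split=> // v; apply: IH; exact: d2.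
Qed.

Lemma Ck_sub k V W f : W `<=` V -> Ck k V f -> Ck k W f.
Proof.
move=> WV; elim: k f => [|k IH] f /= [d1 d2]; split=> //; try by move=> p /WV /d1.
by move=> v; apply: IH.
Qed.

Lemma Ck_ext k V f g : open V -> (forall x, V x -> f x = g x) ->
  Ck k V f -> Ck k V g.
Proof.
move=> oV; elim: k f g => [|k IH] f g fg [d1 d2]; (split=> [p Vp|]).
- apply: near_eq_differentiable (d1 p Vp).
  by apply: filterS (open_near oV Vp) => x /fg.
- by [].
- apply: near_eq_differentiable (d1 p Vp).
  by apply: filterS (open_near oV Vp) => x /fg.
- move=> v; apply: IH (d2 v) => x Vx; exact: eq_on_derive fg.
Qed.

Lemma Ck_local k V f :
  (forall p, V p -> exists W, [/\ open W, W p & Ck k W f]) -> Ck k V f.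
Proof.
elim: k f => [|k IH] f H; split=> //.
- by move=> p /H[W [_ Wp [c _]]]; apply: c.
- by move=> p /H[W [_ Wp [c _]]]; apply: c.
- by move=> v; apply: IH => p /H[W [oW Wp [_ c]]]; exists W; split=> //; apply: c.
Qed.

Lemma Ck_cst k V (c : R) : Ck k V (fun _ => c).
Proof.
elim: k c => [|k IH] c; split=> //; try by move=> p _; apply: differentiable_cst.
by move=> v; under eq_fun do rewrite dC; apply: IH.
Qed.

Lemma CkD k V f g : open V -> Ck k V f -> Ck k V g -> Ck k V (fun x => f x + g x).
Proof.
move=> oV; elim: k f g => [|k IH] f g [f1 f2] [g1 g2]; split=> //.
- by move=> p Vp; apply: (@differentiableD R E R f g); [apply: f1|apply: g1].
- by move=> p Vp; apply: (@differentiableD R E R f g); [apply: f1|apply: g1].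
- move=> v; apply: Ck_ext (IH _ _ (f2 v) (g2 v)) => // x Vx.
  by rewrite dD//; [apply: f1|apply: g1].
Qed.

Lemma CkN k V f : open V -> Ck k V f -> Ck k V (fun x => - f x).
Proof.
move=> oV; elim: k f => [|k IH] f [f1 f2]; split=> //.
- by move=> p Vp; apply: (@differentiableN R E R f); apply: f1.
- by move=> p Vp; apply: (@differentiableN R E R f); apply: f1.
- move=> v; apply: Ck_ext (IH _ (f2 v)) => // x Vx.
  by rewrite dN//; apply: f1.
Qed.

Lemma CkB k V f g : open V -> Ck k V f -> Ck k V g -> Ck k V (fun x => f x - g x).
Proof. by move=> oV cf cg; apply: CkD => //; apply: CkN. Qed.

Lemma CkM k V f g : open V -> Ck k V f -> Ck k V g -> Ck k V (fun x => f x * g x).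
Proof.
move=> oV; elim: k f g => [|k IH] f g cf cg; split=> //.
- by move=> p Vp; apply: (@differentiableM R E f g); [apply: cf.1|apply: cg.1].
- by move=> p Vp; apply: (@differentiableM R E f g); [apply: cf.1|apply: cg.1].
- move=> v; have H : Ck k V (fun x => 'D_v f x * g x + f x * 'D_v g x).
    by apply: CkD => //; apply: IH => //; [apply: CkD1|apply: Ck_S|apply: Ck_S|apply: CkD1].
  apply: Ck_ext H => // x Vx.
  by rewrite dM//; [apply: cf.1|apply: cg.1].
Qed.

Lemma Ck_sum k V (I : Type) (r : seq I) (F : I -> E -> R) : open V ->
  (forall i, Ck k V (F i)) -> Ck k V (fun x => \sum_(i <- r) F i x).
Proof.
move=> oV cF; elim: r => [|i r IH].
  by under eq_fun do rewrite big_nil; apply: Ck_cst.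
by under eq_fun do rewrite big_cons; apply: CkD.
Qed.

Lemma CkV k V f : open V -> (forall p, V p -> f p != 0) ->
  Ck k V f -> Ck k V (fun x => (f x)^-1).
Proof.
move=> oV f0; elim: k => [|k IH] cf; split=> //.
- by move=> p Vp; apply: differentiableV; [apply: cf.1|apply: f0].
- by move=> p Vp; apply: differentiableV; [apply: cf.1|apply: f0].
- move=> v; have H : Ck k V (fun x => - ((f x)^-1 * (f x)^-1) * 'D_v f x).
    have cf' := IH (Ck_S cf).
    by apply: CkM => //; [apply: CkN => //; exact: CkM|exact: CkD1].
  apply: Ck_ext H => // x Vx; rewrite dV//; [|by apply: cf.1|by apply: f0].
  by rewrite -exprVn expr2.
Qed.

Lemma CkX k V f n : open V -> Ck k V f -> Ck k V (fun x => f x ^+ n).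
Proof.
move=> oV cf; elim: n => [|n IH].
  by under eq_fun do rewrite expr0; apply: Ck_cst.
by under eq_fun do rewrite exprS; apply: CkM.
Qed.

Lemma dX f p v n : differentiable f p ->
  'D_v (fun x => f x ^+ n) p = n%:R * f p ^+ n.-1 * 'D_v f p.
Proof.
move=> df; rewrite -[RHS]/((n%:R * f p ^+ n.-1) *: 'D_v f p).
have dv : derivable f p v by exact: diff_derivable.
have <- := @deriveX R E f n p v dv.
by congr ('D_v _ p); apply/funext => x; rewrite exprfctE.
Qed.

(** The cut-off functions below are built from truncated powers. *)
Definition pospart (n : nat) (x : R) : R := Num.max x 0 ^+ n.

Lemma pospart_ge0 n x : 0 <= pospart n x.
Proof. by rewrite exprn_ge0// le_max lexx orbT. Qed.

Lemma pospart_eq0 n x : x <= 0 -> pospart n.+1 x = 0.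
Proof. by move=> x0; rewrite /pospart max_r// expr0n. Qed.

Lemma pospart_gt0 n x : 0 < x -> 0 < pospart n x.
Proof. by move=> x0; rewrite /pospart max_l ?exprn_gt0 ?ltW. Qed.

Lemma derive1_pospart n x : is_derive x (1 : R) (pospart n.+2) (n.+2%:R * pospart n.+1 x).
Proof.
have [x0|x0|->] := ltgtP x 0.
- have := @is_derive_cst R R R 0 x 1; rewrite pospart_eq0 ?mulr0; last exact: ltW.
  apply: near_eq_is_derive.
  near=> y; rewrite /cst pospart_eq0// ltW//; near: y; exact: lt_nbhsl.
- have := @is_deriveX R R id n.+2 x 1 1 (is_derive_id _ _).
  have -> : n.+2%:R * pospart n.+1 x = (n.+2%:R * id x ^+ n.+2.-1) *: 1.
    by rewrite /pospart max_l ?ltW// scaler1.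
  apply: near_eq_is_derive.
  near=> y; rewrite exprfctE /pospart max_l// ltW//; near: y; exact: lt_nbhsr.
- rewrite pospart_eq0// mulr0.
  have H : (fun h : R => h^-1 *: ((pospart n.+2 \o shift 0) (h *: 1) - pospart n.+2 0)) @ 0^' --> (0:R).
    rewrite pospart_eq0//.
    apply/cvgrPdist_le => e e0; near=> h.
    have h0 : h != 0 by near: h; exact: nbhs_dnbhs_neq.
    rewrite sub0r normrN /= /shift /= addr0 subr0 /= [h *: 1]mulr1.
    have hs : `|h| <= Num.min e 1.
      near: h; apply: (@dnbhs0_le _ R ( Num.min e 1)); first by rewrite lt_min e0 ltr01.
    move: hs; rewrite le_min => /andP[he h1].
    rewrite /pospart; have [hle|hgt] := leP h 0; first by rewrite expr0n /= scaler0 normr0 ltW.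
    rewrite exprS -[_ *: _]/(_ * _) mulKf// normrX.
    apply: le_trans he; rewrite -[leRHS]expr1; exact: ler_wiXn2l.
  split; first by apply/cvg_ex; exists 0.
  exact: cvg_lim H.
Unshelve. all: by end_near. Qed.

Lemma diff_pospart n x : differentiable (pospart n.+2) x.
Proof. by apply/derivable1_diffP; case: (derive1_pospart n x). Qed.

Lemma dpospart n f p v : differentiable f p ->
  differentiable (fun x => pospart n.+2 (f x)) p /\
  'D_v (fun x => pospart n.+2 (f x)) p = n.+2%:R * pospart n.+1 (f p) * 'D_v f p.
Proof.
move=> df.
have dd : differentiable (fun x => pospart n.+2 (f x)) p.
  by apply: (differentiable_comp df); apply: diff_pospart.
split=> //.
rewrite deriveE// (diff_comp df (diff_pospart n (f p))) /=.
rewrite diff1E; last exact: diff_pospart.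
rewrite derive1E; have [_ ->] := derive1_pospart n (f p).
by rewrite (deriveE v df) -[LHS]/(_ * _) mulrC.
Qed.

(** After k derivatives the square of the positive part is left, which is
    differentiable at 0 as well. *)
Lemma Ck_pospart k V f : open V -> Ck k V f -> Ck k V (fun x => pospart k.+2 (f x)).
Proof.
move=> oV cf.
suff H n : (k <= n)%N -> Ck k V (fun x => pospart n.+2 (f x)) by exact: H.
elim: k n cf => [|k IH] n cf kn; split=> //.
- by move=> p Vp; apply: (dpospart n 0 (cf.1 p Vp)).1.
- by move=> p Vp; apply: (dpospart n 0 (cf.1 p Vp)).1.
case: n kn => [//|n kn] v.
apply: (@Ck_ext _ _ (fun x => n.+3%:R * pospart n.+2 (f x) * 'D_v f x)) => //.
  by move=> x Vx; rewrite (dpospart n.+1 v (cf.1 x Vx)).2.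
apply: CkM => //; last exact: CkD1.
apply: CkM => //; first exact: Ck_cst.
apply: IH => //; exact: Ck_S.
Qed.

Lemma line_derive f p v (t : R) : differentiable f (p + t *: v) ->
  is_derive t (1:R) (fun s : R => f (p + s *: v)) ('D_v f (p + t *: v)).
Proof.
move=> df; have dv : derivable f (p + t *: v) v by exact: diff_derivable.
have E1 : (fun h : R => h^-1 *: (((fun s : R => f (p + s *: v)) \o shift t) (h *: 1) - f (p + t *: v)))
  = (fun h : R => h^-1 *: ((f \o shift (p + t *: v)) (h *: v) - f (p + t *: v))).
  apply/funext => h /=; rewrite /shift /= [h *: 1]mulr1.
  by rewrite scalerDl addrCA.
split; first by rewrite /derivable E1.
by rewrite /derive E1.
Qed.

Lemma MVT_line f p v (a b : R) : a <= b ->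
  (forall t, a <= t <= b -> differentiable f (p + t *: v)) ->
  exists2 t, a <= t <= b &
    f (p + b *: v) - f (p + a *: v) = 'D_v f (p + t *: v) * (b - a).
Proof.
move=> ab df.
have [t|c|c] := @MVT_segment R (fun s => f (p + s *: v)) (fun t => 'D_v f (p + t *: v)) a b ab.
- rewrite in_itv /= => /andP[/ltW at_ /ltW tb].
  by apply: line_derive; apply: df; rewrite at_ tb.
- apply: derivable_within_continuous => t; rewrite in_itv /= => tab.
  by have [] := line_derive (df t tab).
- by rewrite in_itv /= => cab ->; exists c.
Qed.

End Calculus.

Section Schwarz.
Context {R : realType} {E : normedModType R}.
Implicit Types (f g : E -> R) (p v w : E) (V W : set E).

(** Two applications of the mean value theorem. *)
Lemma second_difference V W f p v w (h : R) : Ck 1 V f -> 0 <= h -> W `<=` V ->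
  (forall s t, 0 <= s <= h -> 0 <= t <= h -> W (p + s *: v + t *: w)) ->
  exists2 q, W q &
    f (p + h *: v + h *: w) - f (p + h *: v) - (f (p + h *: w) - f p)
    = 'D_w (fun q => 'D_v f q) q * (h * h).
Proof.
move=> cf h0 WV HW.
have HV s t : 0 <= s <= h -> 0 <= t <= h -> V (p + s *: v + t *: w).
  by move=> s0 t0; apply/WV/HW.
have hh : 0 <= h <= h by rewrite h0 lexx.
have oo : (0:R) <= 0 <= h by rewrite h0 lexx.
pose g (s : R) := f (p + h *: w + s *: v) - f (p + s *: v).
pose dg (s : R) := 'D_v f (p + h *: w + s *: v) - 'D_v f (p + s *: v).
have der (s : R) : 0 <= s <= h -> is_derive s (1:R) g (dg s).
  move=> sh; apply: (@is_deriveB R R R (fun s => f (p + h *: w + s *: v)) (fun s => f (p + s *: v))).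
    by apply: line_derive; rewrite addrAC; apply: (Ck_diff cf); apply: HV.
  apply: line_derive; have := HV s 0 sh oo; rewrite scale0r addr0 => Vs.
  exact: (Ck_diff cf).
have [s|s|s] := @MVT_segment R g dg 0 h h0.
- by rewrite in_itv /= => /andP[/ltW a /ltW b]; apply: der; rewrite a b.
- apply: derivable_within_continuous => t; rewrite in_itv /= => /der.
  by case.
rewrite in_itv /= => sh; rewrite /g /dg scale0r !addr0 subr0 => E1.
have [t|t th E2] := @MVT_line R E (fun q => 'D_v f q) (p + s *: v) w 0 h h0.
  by move=> th; apply: (Ck_diff (CkD1 v cf)); apply: HV.
exists (p + s *: v + t *: w); first exact: HW.
rewrite scale0r addr0 subr0 in E2.
by rewrite mulrA -E2 (addrAC p (s *: v)) -E1 (addrAC p (h *: v)).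
Qed.

Lemma cont_ball f p (e : R) : {for p, continuous f} -> 0 < e ->
  exists2 r : R, 0 < r & forall q, ball p r q -> `|f p - f q| < e.
Proof.
by move=> /cvgrPdist_lt/(_ _) + e0 => /(_ _ e0)/nbhs_ballP[r /= r0 H]; exists r.
Qed.

Lemma open_ball V p : open V -> V p ->
  exists2 r : R, 0 < r & forall q, ball p r q -> V q.
Proof.
by move=> oV Vp; have /nbhs_ballP[r r0 H] := open_near oV Vp; exists r.
Qed.

(** Both mixed derivatives are limits of the same second difference. *)
Lemma derive_comm V f p v w : open V -> V p -> Ck 2 V f ->
  'D_v (fun q => 'D_w f q) p = 'D_w (fun q => 'D_v f q) p.
Proof.
move=> oV Vp cf; apply/eqP; rewrite -subr_eq0 -normr_le0.
apply/ler_addgt0Pl => e e0; rewrite addr0.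
have e2 : 0 < e / 2 by rewrite divr_gt0.
have c1 := Ck_cont (CkD1 w (CkD1 v cf)) Vp.
have c2 := Ck_cont (CkD1 v (CkD1 w cf)) Vp.
have [r1 r10 H1] := cont_ball c1 e2.
have [r2 r20 H2] := cont_ball c2 e2.
have [r3 r30 H3] := open_ball oV Vp.
pose r := Num.min (Num.min r1 r2) r3.
have r0 : 0 < r by rewrite !lt_min r10 r20.
have H q : ball p r q -> [/\ V q,
   `|'D_w (fun q => 'D_v f q) p - 'D_w (fun q => 'D_v f q) q| < e / 2 &
   `|'D_v (fun q => 'D_w f q) p - 'D_v (fun q => 'D_w f q) q| < e / 2].
  move=> pq; split.
  - by apply: H3; apply: le_ball pq; rewrite ge_min lexx orbT.
  - by apply: H1; apply: le_ball pq; rewrite !ge_min lexx.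
  - by apply: H2; apply: le_ball pq; rewrite !ge_min lexx orbT.
pose h := r / (2 * (`|v| + `|w| + 1)).
have d0 : 0 < `|v| + `|w| + 1 by rewrite ltr_wpDl// addr_ge0.
have h0 : 0 < h by rewrite divr_gt0// mulr_gt0.
have Hb s t : 0 <= s <= h -> 0 <= t <= h -> ball p r (p + s *: v + t *: w).
  move=> /andP[s0 sh] /andP[t0 th].
  rewrite -ball_normE /= -addrA opprD addNKr normrN.
  apply: (@le_lt_trans _ _ (h * (`|v| + `|w| + 1))).
    apply: le_trans (ler_normD _ _) _; rewrite !normrZ !ger0_norm// !mulrDr mulr1.
    by rewrite ler_wpDr ?(ltW h0)// lerD// ler_wpM2r.
  rewrite /h invfM mulrA -mulrA mulVf ?gt_eqF// mulr1 ltr_pdivrMr//; lra.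
have cf1 := Ck_S cf.
have WV : ball p r `<=` V by move=> q /H[].
have [q1 Wq1 E1] := second_difference cf1 (ltW h0) WV Hb.
have Hb' s t : 0 <= s <= h -> 0 <= t <= h -> ball p r (p + s *: w + t *: v).
  by move=> s0 t0; rewrite addrAC; apply: Hb.
have [q2 Wq2 E2] := second_difference cf1 (ltW h0) WV Hb'.
have [_ A1 _] := H _ Wq1.
have [_ _ A2] := H _ Wq2.
have E3 : 'D_w (fun q => 'D_v f q) q1 = 'D_v (fun q => 'D_w f q) q2.
  have hn : h * h != 0 by rewrite mulf_neq0// gt_eqF.
  have E0 : p + h *: w + h *: v = p + h *: v + h *: w by rewrite addrAC.
  rewrite E0 in E2; move: E1 E2.
  move: ('D_w _ q1) ('D_v _ q2) (f _) (f _) (f _) (f _) => X Y a b c d E1 E2.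
  have : X * (h * h) = Y * (h * h) by rewrite -E1 -E2; ring.
  by move/(mulIf hn).
rewrite -E3 in A2.
move: ('D_v _ p) ('D_w _ p) ('D_w _ q1) A1 A2 => X Y Z A1 A2.
have -> : X - Y = (X - Z) - (Y - Z) by ring.
apply: le_trans (ler_normB _ _) _.
rewrite (splitr e); apply: lerD; [exact: ltW A2|exact: ltW A1].
Qed.

Lemma contV f p : f p != 0 -> {for p, continuous f} ->
  {for p, continuous (fun x => (f x)^-1)}.
Proof. by move=> f0 cf; apply: cvgV. Qed.

Lemma cont_norm f p : {for p, continuous f} -> {for p, continuous (fun x => `|f x|)}.
Proof. by move=> cf; apply: cvg_norm. Qed.

Lemma contD f g p : {for p, continuous f} -> {for p, continuous g} ->
  {for p, continuous (fun x => f x + g x)}.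
Proof. by move=> cf cg; apply: cvgD. Qed.

Lemma contM f g p : {for p, continuous f} -> {for p, continuous g} ->
  {for p, continuous (fun x => f x * g x)}.
Proof. by move=> cf cg; apply: cvgM. Qed.

Lemma contZ (a : R) f p : {for p, continuous f} -> {for p, continuous (fun x => a * f x)}.
Proof. by move=> cf; apply: contM => //; apply: cvg_cst. Qed.

End Schwarz.

Section Smooth.
Context {R : realType}.
Local Notation E := 'M[R]_2.
Implicit Types (f g : E -> R) (V W : set E).

Lemma smooth_onP V f : smooth_on V f <-> forall k, Ck k V f.
Proof.
split=> [|H] .
  move=> + k; elim: k f => [|k IH] f sf; split=> //.
  - by move=> p; apply: (sf [::]).
  - by move=> p; apply: (sf [::]).
  - by move=> v; apply: IH => vs; apply: (sf (v :: vs)).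
move=> vs; elim: vs f H => [|v vs IH] f H p Vp /=; first exact: (Ck_diff (H 0%N)).
by apply: IH => // k; apply: CkD1.
Qed.

End Smooth.

Global Opaque Ck.

(** * An averaging functional on a cube of R^4 *)

Section Box.
Context {R : realType}.
Local Notation E := 'M[R]_2.

Definition box (L : R) : set E := [set x | forall j k, `|x j k| <= L].

Lemma entry_ball (x y : E) (e : R) : 0 < e ->
  ball x e y <-> forall j k, `|x j k - y j k| < e.
Proof. by move=> e0; split=> [[_ H] j k|H]; [exact: H|split=> // i j; exact: H]. Qed.

Lemma continuous_vec_mx (m n : nat) : continuous (@vec_mx R m n).
Proof.
move=> v A /nbhs_ballP[e /= e0 eA]; apply/nbhs_ballP; exists e => // w [_ vw].
by apply: eA; split=> // i j; rewrite !mxE; exact: vw.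
Qed.

Lemma compact_box (L : R) : compact (box L).
Proof.
have -> : box L = vec_mx @` [set v : 'rV[R]_(2 * 2) | forall i, `[- L, L]%classic (v ord0 i)].
  apply/seteqP; split=> [x xL|_ /= [v vL <-] j k].
    exists (mxvec x); last by rewrite mxvecK.
    move=> i /=; case/mxvec_indexP: i => j k; rewrite mxvecE in_itv /=.
    by rewrite -ler_norml.
  have := vL (mxvec_index j k); rewrite /= in_itv /= -ler_norml.
  by rewrite mxE.
apply: continuous_compact.
  by apply: continuous_subspaceT => v; apply: continuous_vec_mx.
apply: (@rV_compact R _ (fun=> `[- L, L]%classic)) => _; exact: segment_compact.
Qed.

Lemma continuous_bounded_box (L : R) (g : E -> R) : {in box L, continuous g} ->
  exists2 C, 0 < C & forall x, box L x -> `|g x| <= C.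
Proof.
move=> cg.
have cgb : {within box L, continuous g}.
  by apply: continuous_in_subspaceT.
have : compact (g @` box L) by apply: continuous_compact => //; exact: compact_box.
move=> /compact_bounded[M [Mr HM]].
exists (Num.max (M + 1) 1); first by rewrite lt_max ltr01 orbT.
move=> x xL; apply: (le_trans (HM (M + 1) _ _ _)).
- by rewrite ltrDl ltr01.
- by exists x.
- by rewrite le_max lexx.
Qed.

End Box.

Section Mean.
Context {R : realType}.
Local Notation E := 'M[R]_2.
Variable L : R.
Hypothesis L0 : 0 < L.
Implicit Types (g : E -> R) (N : nat).

Definition mesh N : R := 2 * L / N.+1%:R.
Definition lat N (m : 'M['I_N.+1]_2) : E := \matrix_(j, k) (- L + mesh N * (m j k)%:R).
Definition rsum N g : R := (\sum_m g (lat (m : 'M['I_N.+1]_2))) / (N.+1 ^ 4)%:R.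

Lemma mesh_gt0 N : 0 < mesh N.
Proof. by rewrite divr_gt0// mulr_gt0. Qed.

Lemma lat_lt N (m : 'M['I_N.+1]_2) j k : - L <= lat m j k < L.
Proof.
rewrite mxE lerDl (mulr_ge0 (ltW (mesh_gt0 N)))//=.
have E2 : L + L = 2 * L by ring.
rewrite addrC ltrBlDr E2 /mesh mulrAC ltr_pdivrMr//.
by rewrite ltr_pM2l ?mulr_gt0// ltr_nat.
Qed.

Lemma lat_box N (m : 'M['I_N.+1]_2) : box L (lat m).
Proof. by move=> j k; have /andP[a b] := lat_lt m j k; rewrite ler_norml a ltW. Qed.

Lemma card_lat N : #|{: 'M['I_N.+1]_2}| = (N.+1 ^ 4)%N.
Proof. by rewrite card_mx card_ord. Qed.

Lemma rsumD N f g : rsum N (fun x => f x + g x) = rsum N f + rsum N g.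
Proof. by rewrite /rsum big_split mulrDl. Qed.

Lemma rsumZ N (a : R) g : rsum N (fun x => a * g x) = a * rsum N g.
Proof. by rewrite /rsum -mulr_sumr mulrA. Qed.

Lemma rsum_le N f g : (forall x, box L x -> f x <= g x) -> rsum N f <= rsum N g.
Proof.
move=> fg; rewrite /rsum ler_wpM2r ?invr_ge0 ?ler0n//.
by apply: ler_sum => m _; apply/fg/lat_box.
Qed.

Lemma rsum_cst N (c : R) : rsum N (fun=> c) = c.
Proof.
by rewrite /rsum sumr_const card_lat -[c *+ _]mulr_natr mulfK.
Qed.

Lemma rsum_bound N g C : (forall x, box L x -> `|g x| <= C) -> `|rsum N g| <= C.
Proof.
move=> gC; rewrite ler_norml -(rsum_cst N (- C)) -[X in _ && (_ <= X)](rsum_cst N C).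
by apply/andP; split; apply: rsum_le => x /gC; rewrite ler_norml => /andP[].
Qed.

(** A shift by one mesh permutes the lattice points of the torus; the points
    that wrap around lie outside of the support of g. *)
Lemma rsum_shift N g (L' : R) j k : L' + mesh N < L -> (0 < N)%N ->
  (forall x, ~ box L' x -> g x = 0) ->
  rsum N (fun x => g (x + mesh N *: delta_mx j k)) = rsum N g.
Proof.
move=> LN N0 g0; rewrite /rsum; congr (_ / _).
have one : (1 < N.+1)%N by [].
pose s : 'M['I_N.+1]_2 := \matrix_(a, b) (if (a == j) && (b == k) then inZp 1 else 0).
rewrite [RHS](reindex_inj (addIr s)); apply: eq_bigr => m _.
have va (i : 'I_N.+1) : (i + inZp 1 : 'I_N.+1) = (i.+1 %% N.+1)%N :> nat.
  by rewrite /= modnDmr addn1.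
have [lt|ge] := ltnP (m j k).+1 N.+1.
  congr g; apply/matrixP => a b; rewrite !mxE.
  case: andP => [[/eqP -> /eqP ->]|_]; last by rewrite mulr0 addr0 addr0.
  rewrite mulr1 -addrA; congr (_ + _).
  by rewrite va modn_small// -[in RHS]addn1 natrD mulrDr mulr1.
have mN : m j k = N :> nat by apply/eqP; rewrite eqn_leq -ltnS ltn_ord -ltnS.
rewrite !g0//.
  move=> /(_ j k); rewrite !mxE !eqxx va mN modnn mulr0 addr0 normrN.
  by apply/negP; rewrite -ltNge gtr0_norm// (lt_trans _ LN)// ltrDl mesh_gt0.
move=> /(_ j k); rewrite !mxE !eqxx mN mulr1 -addrA -[X in _ + (_ + X)]mulr1 -mulrDr.
have E2 : - L + 2 * L = L by ring.
rewrite natr1 /mesh divfK ?pnatr_eq0// E2.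
by apply/negP; rewrite -ltNge gtr0_norm// (lt_trans _ LN)// ltrDl mesh_gt0.
Qed.

Lemma mesh_cvg : mesh N @[N --> \oo] --> (0 : R).
Proof.
rewrite /mesh -(mulr0 (2 * L)); apply: cvgM; first exact: cvg_cst.
exact: (@cvg_harmonic R).
Qed.

(** The difference quotient with step the mesh has lattice sum 0 by
    rsum_shift, and it is O(mesh) close to the derivative. *)
Lemma rsum_derive g (L' : R) j k : L' < L -> Ck 2 setT g ->
  (forall x, ~ box L' x -> g x = 0) ->
  rsum N (fun x => 'D_(delta_mx j k) g x) @[N --> \oo] --> (0 : R).
Proof.
move=> LL cg g0.
set e := delta_mx j k : E.
have [C C0 HC] : exists2 C, 0 < C & forall x, box (L + 1) x ->
    `|'D_e (fun x => 'D_e g x) x| <= C.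
  apply: continuous_bounded_box => x _.
  exact: (Ck_cont (CkD1 e (CkD1 e cg))).
have Hstep (h : R) x : 0 < h -> h <= 1 -> box L x ->
    `|(g (x + h *: e) - g x) - h * 'D_e g x| <= C * h * h.
  move=> h0 h1 xL.
  have hb t : 0 <= t <= h -> box (L + 1) (x + t *: e).
    move=> /andP[t0 th] a b; rewrite !mxE; apply: (le_trans (ler_normD _ _)).
    apply: lerD; first exact: xL.
    rewrite normrM (ger0_norm t0) -[leRHS]mulr1; apply: ler_pM => //.
      exact: le_trans h1.
    by case: (_ && _); rewrite ?normr1 ?normr0.
  have [t|t tI Et] := @MVT_line R E g x e 0 h (ltW h0).
    by move=> _; apply: (Ck_diff cg).
  rewrite scale0r addr0 subr0 in Et; rewrite Et.
  have /andP[t0 th] := tI.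
  have [s|s /andP[s0 st] Es] := @MVT_line R E (fun x => 'D_e g x) x e 0 t t0.
    by move=> _; apply: (Ck_diff (CkD1 e cg)).
  rewrite scale0r addr0 subr0 in Es.
  rewrite [h * _]mulrC -mulrBl Es !normrM (ger0_norm t0) (ger0_norm (ltW h0)).
  apply: ler_pM => //; [by rewrite mulr_ge0|exact: ltW|].
  by apply: ler_pM => //; apply: HC; apply: hb; rewrite s0 (le_trans st).
have key N : (0 < N)%N -> mesh N <= 1 -> L' + mesh N < L ->
    `|rsum N (fun x => 'D_e g x)| <= C * mesh N.
  move=> N0 N1 NL; have h0 := mesh_gt0 N.
  have E1 : rsum N (fun x => mesh N * 'D_e g x) =
     - rsum N (fun x => (g (x + mesh N *: e) - g x) - mesh N * 'D_e g x).
    have -> : rsum N (fun x => (g (x + mesh N *: e) - g x) - mesh N * 'D_e g x) =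
       rsum N (fun x => g (x + mesh N *: e)) - rsum N g
        - rsum N (fun x => mesh N * 'D_e g x).
      by rewrite /rsum !big_split /= !sumrN !mulrDl !mulNr.
    by rewrite (rsum_shift j k NL N0 g0) subrr sub0r opprK.
  rewrite -(ler_pM2l h0) -{1}(ger0_norm (ltW h0)) -normrM -rsumZ E1 normrN.
  apply: rsum_bound => x xL; rewrite [leRHS]mulrC; exact: Hstep.
apply/cvgrPdist_le => d d0.
have m1 : \forall N \near \oo, mesh N <= 1.
  by apply: (cvgr_le (0:R) mesh_cvg); exact: ltr01.
have m2 : \forall N \near \oo, mesh N < L - L'.
  by apply: (cvgr_lt (0:R) mesh_cvg); rewrite subr_gt0.
have m3 : \forall N \near \oo, mesh N <= d / C.
  by apply: (cvgr_le (0:R) mesh_cvg); rewrite divr_gt0.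
near=> N; rewrite sub0r normrN.
have N1 : mesh N <= 1 by near: N; exact: m1.
have N2 : mesh N < L - L' by near: N; exact: m2.
have N3 : mesh N <= d / C by near: N; exact: m3.
have N0 : (0 < N)%N by near: N; exact: nbhs_infty_gt.
apply: le_trans (key N N0 N1 _) _; first by rewrite addrC -ltrBrDr.
by rewrite mulrC -ler_pdivlMr.
Unshelve. all: by end_near. Qed.

End Mean.

Section MeanPos.
Context {R : realType}.
Local Notation E := 'M[R]_2.
Variable L : R.
Hypothesis L0 : 0 < L.
Implicit Types (g : E -> R) (N : nat).
Local Notation lat := (@lat R L).
Local Notation rsum := (@rsum R L).
Local Notation mesh := (@mesh R L).

(** For a small mesh, the lattice points of a cube of half-width r are at
    least a proportion (r / 4L)^4 of all of them. *)
Lemma rsum_pos g (y : E) (r c : R) N : 0 < r -> 0 < c -> mesh N <= r / 2 ->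
  (forall j k, `|y j k| + r <= L) ->
  (forall x, box L x -> 0 <= g x) ->
  (forall x : E, (forall j k, `|x j k - y j k| < r) -> c <= g x) ->
  c * (r / (4 * L)) ^+ 4 <= rsum N g.
Proof.
move=> r0 c0 hr yL g0 gc; have h0 : 0 < mesh N by exact: mesh_gt0.
set h := mesh N in hr h0.
pose a := Num.truncn (r / h).
pose t j k := (y j k - r + L) / h.
pose i0 j k := (Num.truncn (t j k)).+1.
have t0 j k : 0 <= t j k.
  apply: divr_ge0; last exact: ltW.
  have := yL j k; have := ler_norm (- y j k); rewrite normrN; lra.
have ia : a%:R <= r / h < a.+1%:R by apply: truncn_itv; rewrite divr_ge0 ?ltW.
have [ah1 ah2] : a%:R * h <= r /\ r < (a%:R + 1) * h.
  by move/andP: ia => []; rewrite ler_pdivlMr// ltr_pdivrMr// -natr1.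
have it j k : - L + h * (i0 j k)%:R <= y j k - r + h /\ y j k - r < - L + h * (i0 j k)%:R.
  have /andP[A B] := truncn_itv (t0 j k).
  have i0E : (i0 j k)%:R = (Num.truncn (t j k))%:R + 1 :> R by rewrite natr1.
  rewrite i0E; move: A B; rewrite -natr1 ler_pdivlMr// ltr_pdivrMr//.
  move: (Num.truncn (t j k))%:R => u; rewrite mulrDl mulrDr mul1r mulr1 [u * h]mulrC.
  by clear -h; split; lra.
have pos (j k : 'I_2) (b : 'I_a) : `|- L + h * (i0 j k + b)%:R - y j k| < r.
  have [u v] := it j k.
  have b1 : b%:R + 1 <= a%:R :> R by rewrite natr1 ler_nat.
  have b0 : 0 <= b%:R :> R by [].
  have bh1 : (b%:R + 1) * h <= a%:R * h by rewrite ler_pM2r.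
  have bh0 : 0 <= h * b%:R by rewrite mulr_ge0// ltW.
  rewrite natrD mulrDr ltr_norml; apply/andP; split; lra.
have bnd (j k : 'I_2) (b : 'I_a) : (i0 j k + b < N.+1)%N.
  rewrite -(ltr_nat R) -(ltr_pM2l h0).
  have -> : h * N.+1%:R = 2 * L by rewrite /h /mesh divfK.
  have := pos j k b; rewrite ltr_norml => /andP[_ +].
  have := yL j k; have := ler_norm (y j k); lra.
pose phi (m : 'M['I_a]_2) : 'M['I_N.+1]_2 := \matrix_(j, k) Ordinal (bnd j k (m j k)).
have phiI : injective phi.
  move=> m m' /matrixP H; apply/matrixP => j k; have := H j k.
  by rewrite !mxE => -[] /addnI /val_inj.
have L1 : c * (a ^ 4)%:R <= \sum_(m : 'M['I_N.+1]_2) g (lat m).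
  rewrite (bigID (fun m => m \in (phi @: [set: 'M['I_a]_2])%SET)) /=.
  apply: ler_wpDr; first by apply: sumr_ge0 => m _; apply/g0/lat_box.
  have <- : #|(phi @: [set: 'M['I_a]_2])%SET| = (a ^ 4)%N.
    by rewrite card_imset// cardsT card_mx card_ord.
  rewrite mulr_natr -sumr_const; apply: ler_sum => _ /imsetP[m _ ->].
  by apply: gc => j k; rewrite !mxE /=; apply: pos.
have a2 : r / (4 * L) <= a%:R / N.+1%:R.
  rewrite ler_pdivlMr// mulrAC ler_pdivrMr ?mulr_gt0//.
  have hN : h * N.+1%:R = 2 * L by rewrite /h /mesh divfK.
  have -> : a%:R * (4 * L) = (2 * (a%:R * h)) * N.+1%:R by transitivity (a%:R * 2 * (2 * L)); [ring|rewrite -hN; ring].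
  rewrite ler_pM2r//; move: ah2; rewrite mulrDl mul1r; lra.
rewrite /rsum ler_pdivlMr//; apply: le_trans L1.
rewrite -mulrA ler_pM2l// !natrX -ler_pdivlMr ?exprn_gt0// -expr_div_n.
by apply: lerXn2r a2; rewrite nnegrE divr_ge0// ?mulr_ge0 ?(ltW r0) ?(ltW L0).
Qed.

End MeanPos.

Section UltraMean.
Context {R : realType}.
Local Notation E := 'M[R]_2.
Variable L : R.
Hypothesis L0 : 0 < L.
Implicit Types (g : E -> R) (N : nat).

Lemma ultra_bounded_cvg (U : set_system nat) (a : nat -> R) C : UltraFilter U ->
  (forall N, `|a N| <= C) -> exists l : R, a N @[N --> U] --> l.
Proof.
move=> UU aC; have PU := @ultra_proper _ _ UU.
have HU : U (a @^-1` `[- C, C]).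
  have -> : a @^-1` `[- C, C] = setT; last exact: filterT.
  by apply/seteqP; split=> N //= _; rewrite in_itv /= -ler_norml.
have [l [_ cl]] := @segment_compact R (- C) C (a N @[N --> U]) _ HU.
exists l => A Al /=.
have [//|UA] := in_ultra_setVsetC (a @^-1` A) UU.
by have [x [nAx Ax]] := cl (~` A) A UA Al.
Qed.

Definition bounded_on_box g := exists C, forall x, box L x -> `|g x| <= C.

(** The ultralimit of the averages over finer and finer lattices stands in for
    the integral over a cube of R^4. *)
Lemma exists_mean : exists I : (E -> R) -> R,
  [/\ forall f g, bounded_on_box f -> bounded_on_box g ->
        I (fun x => f x + g x) = I f + I g,
      forall a g, bounded_on_box g -> I (fun x => a * g x) = a * I g,
      forall f g, bounded_on_box f -> bounded_on_box g ->
        (forall x, box L x -> f x <= g x) -> I f <= I g,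
      forall (L' : R) j k g, L' < L -> Ck 2 setT g ->
        (forall x, ~ box L' x -> g x = 0) ->
        I (fun x => 'D_(delta_mx j k) g x) = 0
    & forall g (y : E) (r c : R), 0 < r -> 0 < c -> bounded_on_box g ->
        (forall j k, `|y j k| + r <= L) ->
        (forall x, box L x -> 0 <= g x) ->
        (forall x : E, (forall j k, `|x j k - y j k| < r) -> c <= g x) ->
        0 < I g].
Proof.
have [U [UU oU]] := @ultraFilterLemma nat \oo _.
have PU := @ultra_proper _ _ UU.
pose I g := lim (rsum L N g @[N --> U]).
have cI g : bounded_on_box g -> rsum L N g @[N --> U] --> I g.
  move=> [C HC]; have [|l Hl] := @ultra_bounded_cvg U (rsum L ^~ g) C UU.
    by move=> N; apply: rsum_bound.
  by apply: cvgP Hl.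
exists I; split.
- move=> f g bf bg; apply/cvg_lim => //.
  under eq_fun do rewrite rsumD.
  by apply: cvgD; exact: cI.
- move=> a g bg; apply/cvg_lim => //.
  under eq_fun do rewrite rsumZ.
  by apply: cvgM; [exact: cvg_cst|exact: cI].
- move=> f g bf bg fg; apply: (@ler_cvg_to _ U PU R _ _ _ _ (cI f bf) (cI g bg)).
  by apply: filterS filterT => N _; exact: rsum_le.
- move=> L' j k g LL cg g0; apply/cvg_lim => //.
  have := rsum_derive L0 j k LL cg g0; apply: cvg_trans.
  by move=> A /=; apply: oU.
- move=> g y r c r0 c0 bg yL g0 gc.
  have p0 : 0 < c * (r / (4 * L)) ^+ 4.
    by rewrite mulr_gt0// exprn_gt0// divr_gt0// mulr_gt0.
  apply: (lt_le_trans p0).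
  apply: (@limr_ge _ U PU R); first by apply/cvg_ex; exists (I g); exact: cI.
  have : \forall N \near \oo, mesh L N <= r / 2.
    by apply: (cvgr_le (0:R) (mesh_cvg L)); rewrite divr_gt0.
  move/oU; apply: filterS => N hN; exact: (rsum_pos L0 r0 c0 hN yL g0 gc).
Qed.

End UltraMean.

(** * Euclidean geometry of R^4 and layers along a level set *)

Section Euclidean.
Context {R : realType}.
Local Notation E := 'M[R]_2.
Implicit Types (f g rho : E -> R) (p x v : E).

Lemma compact_pos_min (A : set E) f : compact A ->
  (forall x, A x -> {for x, continuous f}) -> (forall x, A x -> 0 < f x) ->
  exists2 c : R, 0 < c & forall x, A x -> c <= f x.
Proof.
move=> cA cf f0.
have cV : {within A, continuous (fun x => (f x)^-1)}.
  apply: continuous_in_subspaceT => x /set_mem Ax.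
  by apply: contV; [apply: lt0r_neq0; exact: f0|exact: cf].
have [M [Mr HM]] := compact_bounded (continuous_compact cV cA).
pose m := Num.max (M + 1) 1.
have m0 : 0 < m by rewrite lt_max ltr01 orbT.
exists m^-1; first by rewrite invr_gt0.
move=> x Ax; rewrite -[leRHS]invrK lef_pV2 ?posrE ?invr_gt0 ?f0//.
have Mm : M < m by rewrite lt_max ltrDl ltr01.
have : `|(f x)^-1| <= m by apply: (HM m Mm); exists x.
by rewrite gtr0_norm// invr_gt0 f0.
Qed.

(** By compactness, positivity on a level set persists on a layer around it. *)
Lemma near_zero_set (L : R) f rho :
  (forall x, {for x, continuous f}) -> (forall x, {for x, continuous rho}) ->
  (forall x, box L x -> rho x = 0 -> 0 < f x) ->
  exists2 e : R, 0 < e & forall x, box L x -> `|rho x| < e -> 0 < f x.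
Proof.
move=> cf crho H.
pose K := box L `&` (f @^-1` [set y | y <= 0]).
have cK : compact K.
  apply: compact_closedI; first exact: compact_box.
  by apply: preimage_closed; [move=> x _; exact: cf|exact: closed_le].
have crn x : {for x, continuous (fun x => `|rho x|)}.
  by apply: cont_norm; exact: crho.
have [|e e0 He] := compact_pos_min cK (fun x _ => crn x).
  move=> x [xL /= fx]; rewrite normr_gt0; apply/eqP => /(H _ xL).
  by rewrite ltNge fx.
exists e => // x xL xe; rewrite ltNge; apply/negP => fx.
have Kx : K x by split.
by have := He x Kx; rewrite leNgt xe.
Qed.

Lemma derive_sign f p v : differentiable f p -> 'D_v f p < 0 ->
  exists2 d : R, 0 < d & forall t, 0 < t < d -> f (p + t *: v) < f p.
Proof.
move=> df dneg.
have dv : derivable f p v by exact: diff_derivable.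
have : (fun h : R => h^-1 *: ((f \o shift p) (h *: v) - f p)) @ 0^' --> 'D_v f p by exact: dv.
move/(cvgr_lt ('D_v f p))/(_ _ dneg) => /nbhs_ballP[d /= d0 H].
exists d => // t /andP[t0 td].
have := H t; rewrite /= /ball /= sub0r normrN gtr0_norm// => /(_ td (lt0r_neq0 t0)).
by rewrite -[_ *: _]/(_ * _) pmulr_rlt0 ?invr_gt0// subr_lt0 /shift /= addrC.
Qed.

Lemma first_order f p (e : R) : differentiable f p -> 0 < e ->
  exists2 d : R, 0 < d & forall h, `|h| < d -> `|f (p + h) - f p - 'D_h f p| <= e * `|h|.
Proof.
move=> df e0; have /diff_locallyP[_ /eqaddoP/(_ e e0)] := df.
move=> /nbhs_ballP[d /= d0 H]; exists d => // h hd.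
have := H h; rewrite -ball_normE /= sub0r normrN => /(_ hd).
by rewrite !fctE /= /shift /= deriveE// opprD addrA [h + p]addrC.
Qed.

Lemma sum_I2 (F : 'I_2 -> R) : \sum_j F j = F 0 + F 1.
Proof.
rewrite !big_ord_recl big_ord0 addr0; congr (F _ + F _); exact: val_inj.
Qed.

Definition ip (x y : E) : R := \sum_j \sum_k x j k * y j k.

Lemma ipE x y : ip x y = x 0 0 * y 0 0 + x 0 1 * y 0 1 + x 1 0 * y 1 0 + x 1 1 * y 1 1.
Proof. by rewrite /ip !sum_I2 addrA. Qed.

Lemma ipC x y : ip x y = ip y x.
Proof. by apply: eq_bigr => j _; apply: eq_bigr => k _; rewrite mulrC. Qed.

Lemma ipDl x y z : ip (x + y) z = ip x z + ip y z.
Proof.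
rewrite /ip -big_split; apply: eq_bigr => j _; rewrite -big_split.
by apply: eq_bigr => k _; rewrite mxE mulrDl.
Qed.

Lemma ipZl (a : R) x y : ip (a *: x) y = a * ip x y.
Proof.
rewrite /ip mulr_sumr; apply: eq_bigr => j _; rewrite mulr_sumr.
by apply: eq_bigr => k _; rewrite mxE mulrA.
Qed.

Lemma ip_entry x j k : x j k ^+ 2 <= ip x x.
Proof.
rewrite /ip (bigD1 j)//= (bigD1 k)//= -expr2 -addrA lerDl addr_ge0//.
  by apply: sumr_ge0 => i _; rewrite -expr2 sqr_ge0.
by apply: sumr_ge0 => i _; apply: sumr_ge0 => l _; rewrite -expr2 sqr_ge0.
Qed.

Lemma ip_ge0 x : 0 <= ip x x.
Proof. by apply: le_trans (ip_entry x 0 0); rewrite sqr_ge0. Qed.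

Lemma ip_eq0 x y : ip x x = 0 -> ip x y = 0.
Proof.
move=> x0; have z j k : x j k = 0.
  by apply/eqP; rewrite -sqrf_eq0 eq_le sqr_ge0 andbT -x0 ip_entry.
by rewrite /ip big1// => j _; rewrite big1// => k _; rewrite z mul0r.
Qed.

Lemma ip_neq0 x y : ip x y != 0 -> 0 < ip x x.
Proof.
by move=> h; rewrite lt_neqAle ip_ge0 andbT eq_sym; apply: contra h => /eqP/ip_eq0 ->.
Qed.

Lemma entry_norm x (r : R) : 0 < r -> (`|x| < r) <-> (forall j k, `|x j k| < r).
Proof.
move=> r0; have -> : `|x| < r <-> ball (0 : E) r x.
  by rewrite -ball_normE /= sub0r normrN.
by rewrite entry_ball//; split=> H j k; have := H j k; rewrite mxE sub0r normrN.
Qed.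

Lemma ip_lt_norm x (r : R) : 0 < r -> ip x x < r ^+ 2 -> `|x| < r.
Proof.
move=> r0 xr; apply/(entry_norm x r0) => j k.
have [//|h] := ltP `|x j k| r.
have : r ^+ 2 <= x j k ^+ 2.
  by rewrite -(real_normK (num_real (x j k))) lerXn2r// nnegrE ltW.
by rewrite leNgt (le_lt_trans (ip_entry x j k) xr).
Qed.

Lemma mx_basis (v : E) : v = \sum_j \sum_k v j k *: delta_mx j k.
Proof. exact: matrix_sum_delta. Qed.

Lemma derive_coord f p v : differentiable f p ->
  'D_v f p = \sum_j \sum_k v j k * 'D_(delta_mx j k) f p.
Proof.
move=> df; rewrite [in LHS](mx_basis v) dlin_sum//; apply: eq_bigr => j _.
by rewrite dlin_sum//; apply: eq_bigr => k _; rewrite dlinZ.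
Qed.

Lemma coord_diff j k p v : differentiable (fun x : E => x j k) p /\
  'D_v (fun x : E => x j k) p = v j k.
Proof.
have d : differentiable (fun x : E => x j k) p by exact: differentiable_coord.
split=> //; rewrite /derive.
have -> : (fun h : R => h^-1 *: (((fun x : E => x j k) \o shift p) (h *: v) - p j k)) =
          (fun h : R => h^-1 * (h * v j k)).
  by apply/funext => h; rewrite /= /shift /= !mxE addrK.
apply/cvg_lim => //; apply: cvg_near_cst.
near=> h; rewrite mulKf//; near: h; exact: nbhs_dnbhs_neq.
Unshelve. all: by end_near. Qed.

Lemma Ck_coord n V j k : Ck n V (fun x : E => x j k).
Proof.
case: n => [|n]; split=> //; try by move=> p _; apply: (coord_diff j k p 0).1.
move=> v; have -> : (fun p => 'D_v (fun x : E => x j k) p) = (fun=> v j k).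
  by apply/funext => p; apply: (coord_diff j k p v).2.
exact: Ck_cst.
Qed.

Lemma continuousT_bounded L f : (forall x, {for x, continuous f}) -> bounded_on_box L f.
Proof. by move=> cf; have [|C _ HC] := @continuous_bounded_box R L f; [move=> x _; exact: cf|exists C]. Qed.

End Euclidean.

Section Layer.
Context {R : realType}.
Local Notation E := 'M[R]_2.
Implicit Types (rho : E -> R) (x v : E) (e : R).

Definition layer_den rho e x := pospart 5 (- rho x) + pospart 5 (rho x + e).
(** A regularised indicator function: it descends from 1 to 0 while rho runs
    from - e to 0. *)
Definition layer rho e x := pospart 5 (- rho x) / layer_den rho e x.
(** Minus the derivative of the layer function with respect to rho. *)
Definition weight rho e x :=
  5 * (pospart 4 (- rho x) * pospart 5 (rho x + e)
       + pospart 5 (- rho x) * pospart 4 (rho x + e)) / layer_den rho e x ^+ 2.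

Lemma layer_den_gt0 rho e x : 0 < e -> 0 < layer_den rho e x.
Proof.
move=> e0; rewrite /layer_den; have [r0|r0] := ltP (rho x) 0.
  by rewrite ltr_pwDl ?pospart_ge0// pospart_gt0// oppr_gt0.
by rewrite ltr_wpDl ?pospart_ge0// pospart_gt0// ltr_wpDl.
Qed.

Lemma layer_ge0 rho e x : 0 < e -> 0 <= layer rho e x <= 1.
Proof.
move=> e0; have d0 := layer_den_gt0 rho x e0.
rewrite /layer divr_ge0 ?pospart_ge0 ?(ltW d0)//= ler_pdivrMr// mul1r.
by rewrite /layer_den lerDl pospart_ge0.
Qed.

Lemma layer_eq0 rho e x : 0 <= rho x -> layer rho e x = 0.
Proof. by move=> r0; rewrite /layer pospart_eq0 ?mul0r// oppr_le0. Qed.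

Lemma layer_eq1 rho e x : 0 < e -> rho x <= - e -> layer rho e x = 1.
Proof.
move=> e0 re; have d0 := layer_den_gt0 rho x e0.
have E0 : pospart 5 (rho x + e) = 0 by rewrite pospart_eq0// -lerBrDr sub0r.
by move: d0; rewrite /layer /layer_den E0 addr0 => d0; rewrite divff// gt_eqF.
Qed.

Lemma weight_ge0 rho e x : 0 < e -> 0 <= weight rho e x.
Proof.
move=> e0; have d0 := layer_den_gt0 rho x e0.
rewrite divr_ge0 ?exprn_ge0 ?(ltW d0)// mulr_ge0// addr_ge0// mulr_ge0// pospart_ge0//.
Qed.

Lemma weight_eq0 rho e x : 0 < e -> e <= `|rho x| -> weight rho e x = 0.
Proof.
move=> e0; rewrite ler_normr => /orP[r0|r0]; rewrite /weight.
  have r1 : - rho x <= 0 by rewrite oppr_le0 (le_trans _ r0)// ltW.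
  by rewrite !(pospart_eq0 _ r1) !mul0r addr0 mulr0 mul0r.
have r1 : rho x + e <= 0 by rewrite -lerBrDl sub0r.
by rewrite !(pospart_eq0 _ r1) !mulr0 addr0 mulr0 mul0r.
Qed.

Lemma Ck_layer rho e : 0 < e -> Ck 3 setT rho -> Ck 3 setT (layer rho e).
Proof.
move=> e0 cr.
have c1 : Ck 3 setT (fun x => pospart 5 (- rho x)) by exact: (Ck_pospart openT (CkN openT cr)).
have c2 : Ck 3 setT (fun x => pospart 5 (rho x + e)).
  exact: (Ck_pospart openT (CkD openT cr (Ck_cst 3 setT e))).
apply: (CkM openT c1); apply: (CkV openT); last exact: (CkD openT c1 c2).
by move=> p _; exact: lt0r_neq0 (layer_den_gt0 rho p e0).
Qed.

Lemma Ck_weight rho e : 0 < e -> Ck 3 setT rho -> Ck 2 setT (weight rho e).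
Proof.
move=> e0 /Ck_S cr.
have n1 := CkN openT cr.
have n2 : Ck 2 setT (fun x => rho x + e) by exact: (CkD openT cr (Ck_cst 2 setT e)).
have c1 : Ck 2 setT (fun x => pospart 4 (- rho x)) by exact: (Ck_pospart openT n1).
have c2 : Ck 2 setT (fun x => pospart 4 (rho x + e)) by exact: (Ck_pospart openT n2).
have H5 f : Ck 2 setT f -> Ck 2 setT (fun x : E => pospart 5 (f x)).
  move=> cf; have -> : (fun x : E => pospart 5 (f x)) = (fun x => pospart 4 (f x) * Num.max (f x) 0).
    by apply/funext => x; rewrite /pospart exprSr.
  have -> : (fun x : E => pospart 4 (f x) * Num.max (f x) 0) = (fun x : E => pospart 4 (f x) * f x).
    apply/funext => x; have [f0|f0] := leP (f x) 0; last by [].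
    by rewrite pospart_eq0// !mul0r.
  exact: (CkM openT (Ck_pospart openT cf) cf).
have c3 := H5 _ n1; have c4 := H5 _ n2.
apply: (CkM openT).
  apply: (CkM openT); first exact: Ck_cst.
  exact: (CkD openT (CkM openT c1 c4) (CkM openT c3 c2)).
apply: (CkV openT); last by apply: (CkX _ openT); exact: (CkD openT c3 c4).
by move=> p _; rewrite expf_neq0//; exact: lt0r_neq0 (layer_den_gt0 rho p e0).
Qed.

Lemma derive_layer rho e x v : 0 < e -> differentiable rho x ->
  'D_v (layer rho e) x = - weight rho e x * 'D_v rho x.
Proof.
move=> e0 dr; have d0 := layer_den_gt0 rho x e0.
have dn : differentiable (fun y => - rho y) x by exact: differentiableN.
have de : differentiable (fun y => rho y + e) x.
  by apply: (@differentiableD R E R rho (cst e)) => //; exact: differentiable_cst.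
have [d1 D1] := dpospart 3 v dn; have [d2 D2] := dpospart 3 v de.
have dd : differentiable (fun y => pospart 5 (- rho y) + pospart 5 (rho y + e)) x.
  exact: (@differentiableD R E R (fun y => pospart 5 (- rho y)) (fun y => pospart 5 (rho y + e))).
have n0 : pospart 5 (- rho x) + pospart 5 (rho x + e) != 0 by exact: lt0r_neq0 d0.
rewrite (dM v d1 (differentiableV dd n0)).
have dc : differentiable (fun _ : E => e) x by exact: differentiable_cst.
rewrite (dV v dd n0) (dD v d1 d2) D1 D2 (dN v dr) (dD v dr dc).
rewrite dC addr0 /weight /layer_den.
move: n0; move: (pospart 5 _) (pospart 5 _) (pospart 4 _) (pospart 4 _) ('D_v rho x).
by move=> a c a' c' D n0; field.
Qed.

End Layer.

(** * Divergence-free fields along a compact hypersurface *)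

Section IntegrationByParts.
Context {R : realType}.
Local Notation E := 'M[R]_2.
Implicit Types (rho : E -> R) (x v p : E) (e L : R) (V : 'I_2 -> 'I_2 -> E -> R).
Local Notation dd j k f := (fun x : E => 'D_(delta_mx j k) f x).

Definition divergence V x : R := \sum_j \sum_k 'D_(delta_mx j k) (V j k) x.
Definition flux rho V x : R := \sum_j \sum_k 'D_(delta_mx j k) rho x * V j k x.

Lemma sum_I2_fun (F : 'I_2 -> 'I_2 -> E -> R) x :
  \sum_j \sum_k F j k x = (F 0 0 x + F 0 1 x) + (F 1 0 x + F 1 1 x).
Proof. by rewrite !sum_I2. Qed.

Lemma Ck_sum2 n (F : 'I_2 -> 'I_2 -> E -> R) : (forall j k, Ck n setT (F j k)) ->
  Ck n setT (fun x => \sum_j \sum_k F j k x).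
Proof.
by move=> cF; apply: (Ck_sum _ openT) => j; apply: (Ck_sum _ openT).
Qed.

Lemma Ck_divergence n V : (forall j k, Ck n.+1 setT (V j k)) -> Ck n setT (divergence V).
Proof. by move=> cV; apply: Ck_sum2 => j k; exact: (CkD1 _ (cV j k)). Qed.

Lemma Ck_flux n rho V : Ck n.+1 setT rho -> (forall j k, Ck n setT (V j k)) ->
  Ck n setT (flux rho V).
Proof. by move=> cr cV; apply: Ck_sum2 => j k; exact: (CkM openT (CkD1 _ cr) (cV j k)). Qed.

Lemma Ck_bounded n L f : Ck n setT f -> bounded_on_box L f.
Proof. by move=> cf; apply: continuousT_bounded => x; exact: (Ck_cont cf). Qed.

Section WithMean.
Variables (L L' : R) (I : (E -> R) -> R).
Hypothesis ID : forall f g, bounded_on_box L f -> bounded_on_box L g ->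
        I (fun x => f x + g x) = I f + I g.
Hypothesis IZ : forall a g, bounded_on_box L g -> I (fun x => a * g x) = a * I g.
Hypothesis Ile : forall f g, bounded_on_box L f -> bounded_on_box L g ->
        (forall x, box L x -> f x <= g x) -> I f <= I g.
Hypothesis Ider : forall j k g, Ck 2 setT g ->
        (forall x, ~ box L' x -> g x = 0) ->
        I (fun x => 'D_(delta_mx j k) g x) = 0.

Lemma I_sum2 (F : 'I_2 -> 'I_2 -> E -> R) : (forall j k, bounded_on_box L (F j k)) ->
  I (fun x => \sum_j \sum_k F j k x) = \sum_j \sum_k I (F j k).
Proof.
move=> bF.
have bD f g : bounded_on_box L f -> bounded_on_box L g -> bounded_on_box L (fun x => f x + g x).
  move=> [C HC] [D HD]; exists (C + D) => x xL.
  by apply: (le_trans (ler_normD _ _)); apply: lerD; [exact: HC|exact: HD].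
under eq_fun do rewrite sum_I2_fun.
rewrite (ID (bD _ _ (bF 0 0) (bF 0 1)) (bD _ _ (bF 1 0) (bF 1 1))).
by rewrite (ID (bF 0 0) (bF 0 1)) (ID (bF 1 0) (bF 1 1)) !sum_I2.
Qed.

(** Integration by parts against the regularised indicator of rho < 0. *)
Lemma I_layer rho e V : 0 < e -> Ck 3 setT rho -> (forall j k, Ck 2 setT (V j k)) ->
  (forall j k x, ~ box L' x -> V j k x = 0) ->
  I (fun x => weight rho e x * flux rho V x) = I (fun x => layer rho e x * divergence V x).
Proof.
move=> e0 cr cV V0.
have cl := Ck_layer e0 cr.
have cHV j k : Ck 2 setT (fun x => layer rho e x * V j k x) := CkM openT (Ck_S cl) (cV j k).
have S0 : I (fun x => \sum_j \sum_k 'D_(delta_mx j k) (fun x => layer rho e x * V j k x) x) = 0.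
  rewrite (@I_sum2 (fun j k x => 'D_(delta_mx j k) (fun x => layer rho e x * V j k x) x)).
    rewrite big1// => j _; rewrite big1// => k _; apply: Ider; first exact: cHV.
    by move=> x xL; rewrite V0// mulr0.
  by move=> j k; exact: (Ck_bounded L (CkD1 _ (cHV j k))).
have cwf : Ck 2 setT (fun x => weight rho e x * flux rho V x).
  exact: (CkM openT (Ck_weight e0 cr) (Ck_flux cr cV)).
have cld : Ck 1 setT (fun x => layer rho e x * divergence V x).
  exact: (CkM openT (Ck_S (Ck_S cl)) (Ck_divergence cV)).
have E1 : (fun x => \sum_j \sum_k 'D_(delta_mx j k) (fun x => layer rho e x * V j k x) x)
   = (fun x => layer rho e x * divergence V x + (-1) * (weight rho e x * flux rho V x)).
  apply/funext => x; have dl := Ck_diff cl (Logic.I : setT x).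
  have dr := Ck_diff cr (Logic.I : setT x).
  under eq_bigr => j _ do under eq_bigr => k _ do
    rewrite (dM _ dl (Ck_diff (cV j k) (Logic.I : setT x))) (derive_layer _ e0 dr).
  rewrite /divergence /flux 3!mulr_sumr -big_split; apply: eq_bigr => j _.
  rewrite 3!mulr_sumr -big_split; apply: eq_bigr => k _ /=.
  by rewrite mulN1r !mulNr addrC !mulrA.
rewrite E1 in S0; rewrite ID in S0.
- rewrite IZ in S0; last exact: (Ck_bounded L cwf).
  by apply/eqP; rewrite eq_sym -subr_eq0 -mulN1r; apply/eqP.
- exact: (Ck_bounded L cld).
- exact: (Ck_bounded L (CkM openT (Ck_cst 2 setT (-1)) cwf)).
Qed.

End WithMean.
End IntegrationByParts.

Section Bump.
Context {R : realType}.
Local Notation E := 'M[R]_2.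
Implicit Types (x v p n : E) (s : R).

Definition sqd p x : R := ip (x - p) (x - p).
Definition bump p s x : R := pospart 5 (s - sqd p x).

Lemma Ck_sqd m V p : open V -> Ck m V (sqd p).
Proof.
move=> oV; have c j k : Ck m V (fun x : E => (x - p) j k).
  have -> : (fun x : E => (x - p) j k) = (fun x => x j k - p j k).
    by apply/funext => x; rewrite !mxE.
  exact: (CkB oV (Ck_coord _ _ _ _) (Ck_cst _ _ _)).
apply: (Ck_sum _ oV) => j; apply: (Ck_sum _ oV) => k; exact: (CkM oV (c j k) (c j k)).
Qed.

Lemma derive_sqd p x v : 'D_v (sqd p) x = 2 * ip (x - p) v.
Proof.
have d j k : differentiable (fun x : E => (x - p) j k) x /\
    'D_v (fun x : E => (x - p) j k) x = v j k.
  have -> : (fun x : E => (x - p) j k) = (fun x => x j k - p j k).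
    by apply/funext => y; rewrite !mxE.
  have [d1 D1] := coord_diff j k x v.
  have d2 : differentiable (fun _ : E => p j k) x by exact: differentiable_cst.
  split; first exact: (@differentiableB R E R (fun x : E => x j k) (fun _ => p j k)).
  by rewrite (dB v d1 d2) D1 dC subr0.
have ds j k : differentiable (fun x : E => (x - p) j k * (x - p) j k) x /\
    'D_v (fun x : E => (x - p) j k * (x - p) j k) x = 2 * ((x - p) j k * v j k).
  have [d1 D1] := d j k; split; first exact: (@differentiableM R E _ _ x d1 d1).
  by rewrite (dM v d1 d1) D1 mulr_natl mulr2n [v j k * _]mulrC.
have dr j := (dsum (index_enum 'I_2) v (fun k => (ds j k).1)).
have [_ ->] := dsum (index_enum 'I_2) v (fun j => (dr j).1).
rewrite /ip mulr_sumr; apply: eq_bigr => j _; rewrite (dr j).2 mulr_sumr.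
by apply: eq_bigr => k _; rewrite (ds j k).2.
Qed.

Lemma Ck_bump p s : Ck 3 setT (bump p s).
Proof. exact: (Ck_pospart openT (CkB openT (Ck_cst _ _ _) (Ck_sqd _ _ openT))). Qed.

Lemma bump_ge0 p s x : 0 <= bump p s x.
Proof. exact: pospart_ge0. Qed.

Lemma bump_eq0 p s x : s <= sqd p x -> bump p s x = 0.
Proof. by move=> h; rewrite /bump pospart_eq0// subr_le0. Qed.

Lemma bump_gt0 p s x : sqd p x < s -> 0 < bump p s x.
Proof. by move=> h; rewrite /bump pospart_gt0// subr_gt0. Qed.

Lemma derive_bump p s x v :
  'D_v (bump p s) x = - (10 * pospart 4 (s - sqd p x) * ip (x - p) v).
Proof.
have ds : differentiable (sqd p) x by exact: (Ck_diff (Ck_sqd 0 p openT) (Logic.I : setT x)).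
have dc : differentiable (fun _ : E => s) x by exact: differentiable_cst.
have d1 : differentiable (fun y => s - sqd p y) x.
  exact: (@differentiableB R E R (fun _ => s) (sqd p)).
have [_ D1] := dpospart 3 v d1.
by rewrite D1 (dB v dc ds) dC derive_sqd; ring.
Qed.

Lemma sqdD p n (k : R) x :
  sqd p x <= 2 * sqd (p + k *: n) x + 2 * (k ^+ 2 * ip n n).
Proof.
rewrite /sqd !ipE !mxE -subr_ge0.
move: (x _ _) (x _ _) (x _ _) (x _ _) (p _ _) (p _ _) (p _ _) (p _ _)
  (n _ _) (n _ _) (n _ _) (n _ _) => x1 x2 x3 x4 p1 p2 p3 p4 n1 n2 n3 n4.
rewrite [leRHS](_ : _ = (x1 - p1 - 2 * k * n1) ^+ 2 + (x2 - p2 - 2 * k * n2) ^+ 2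
  + (x3 - p3 - 2 * k * n3) ^+ 2 + (x4 - p4 - 2 * k * n4) ^+ 2); last by ring.
by rewrite !addr_ge0// sqr_ge0.
Qed.

End Bump.

Section InnerBump.
Context {R : realType}.
Local Notation E := 'M[R]_2.
Implicit Types (rho : E -> R) (x v p n : E).

Definition gradient rho x : E := \matrix_(j, k) 'D_(delta_mx j k) rho x.

Lemma derive_gradient rho x v : differentiable rho x -> 'D_v rho x = ip (gradient rho x) v.
Proof.
move=> dr; rewrite derive_coord//; apply: eq_bigr => j _; apply: eq_bigr => k _.
by rewrite mxE mulrC.
Qed.

Lemma flux_scaled rho (psi : E -> R) n x : differentiable rho x ->
  flux rho (fun j k y => psi y * n j k) x = psi x * 'D_n rho x.
Proof.
move=> dr; rewrite derive_coord// /flux mulr_sumr; apply: eq_bigr => j _.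
by rewrite mulr_sumr; apply: eq_bigr => k _; rewrite mulrCA [n j k * _]mulrC.
Qed.

Lemma divergence_scaled (psi : E -> R) n x : differentiable psi x ->
  divergence (fun j k y => psi y * n j k) x = 'D_n psi x.
Proof.
move=> dp; rewrite derive_coord// /divergence; apply: eq_bigr => j _.
apply: eq_bigr => k _; rewrite (dM _ dp (differentiable_cst _ _)) dC mulr0 addr0.
by rewrite mulrC.
Qed.

(** A bump centred just outside {rho < 0}: inside, it increases in the outward
    normal direction. *)
Lemma inner_bump rho p (m : R) : Ck 3 setT rho -> rho p = 0 -> 0 < m ->
  0 < ip (gradient rho p) (gradient rho p) ->
  exists (c : E) (s : R),
  [/\ forall x, bump c s x != 0 -> `|x - p| < m,
      forall x, rho x < 0 -> 0 <= 'D_(gradient rho p) (bump c s) x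
    & exists y, [/\ rho y < 0, `|y - p| < m & 0 < 'D_(gradient rho p) (bump c s) y]].
Proof.
move=> cr rp m0; set n := gradient rho p; set q := ip n n => q0.
have dr : differentiable rho p by exact: (Ck_diff cr (Logic.I : setT p)).
have Dr v : 'D_v rho p = ip n v by exact: derive_gradient.
pose e := q / (4 * (1 + q)).
have e0 : 0 < e by rewrite divr_gt0// mulr_gt0// addr_gt0.
have [d d0 Hd] := first_order dr e0.
pose m' := Num.min m d.
have m'0 : 0 < m' by rewrite lt_min m0.
pose k := m' / (4 * (1 + q)).
have k0 : 0 < k by rewrite divr_gt0// mulr_gt0// addr_gt0.
have q1 : 0 < 1 + q by rewrite addr_gt0.
have q2 : q < (1 + q) ^+ 2 by rewrite -subr_gt0; nra.
have kq : 16 * (k ^+ 2 * q) < m' ^+ 2.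
  rewrite /k expr_div_n mulrAC -mulrAC exprMn.
  have -> : 16 * (m' ^+ 2 / (4 ^+ 2 * (1 + q) ^+ 2) * q) = m' ^+ 2 * (q / (1 + q) ^+ 2).
    by field; rewrite gt_eqF.
  by rewrite gtr_pMr ?exprn_gt0// ltr_pdivrMr ?exprn_gt0// mul1r.
pose c := p + k *: n; pose s := 4 * (k ^+ 2 * q).
have kq0 : 0 < k ^+ 2 * q by rewrite mulr_gt0// exprn_gt0.
have ball x : sqd c x < s -> sqd p x < 10 * (k ^+ 2 * q).
  move=> xs; apply: (le_lt_trans (sqdD p n k x)).
  rewrite -/c -/q; move: xs; rewrite /s; move: (sqd c x) (k ^+ 2 * q) => A B; lra.
have small x : sqd c x < s -> `|x - p| < m'.
  move=> /ball xs; apply: ip_lt_norm => //; apply: lt_trans kq.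
  apply: (lt_le_trans xs); rewrite ler_pM2r// ler_nat//.
exists c, s; split.
- move=> x bx; have xs : sqd c x < s.
    by rewrite ltNge; apply/negP => /bump_eq0 b0; rewrite b0 eqxx in bx.
  by apply: (lt_le_trans (small x xs)); rewrite ge_min lexx.
- move=> x rx; rewrite derive_bump oppr_ge0.
  have [xs|xs] := leP s (sqd c x).
    by rewrite pospart_eq0 ?mulr0 ?mul0r// subr_le0.
  have w0 : 0 < 10 * pospart 4 (s - sqd c x).
    by rewrite pmulr_rgt0 ?ltr0n//; apply: pospart_gt0; rewrite subr_gt0.
  rewrite (pmulr_rle0 _ w0).
  rewrite leNgt; apply/negP => pos.
  have xm := small x xs.
  have xd : `|x - p| < d by apply: (lt_le_trans xm); rewrite ge_min lexx orbT.
  have Ex : p + (x - p) = x by rewrite addrC subrK.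
  have := Hd (x - p) xd; rewrite Ex rp subr0 Dr.
  have E1 : ip n (x - p) = ip (x - c) n + k * q.
    have -> : x - p = (x - c) + k *: n by rewrite /c opprD addrA subrK.
    by rewrite ipC ipDl ipZl.
  have L1 : e * `|x - p| < k * q.
    have : `|x - p| < 4 * (k * (1 + q)).
      by have <- : m' = 4 * (k * (1 + q)) by rewrite /k; field; rewrite gt_eqF.
    move=> L1; rewrite /e -ltr_pdivlMl ?divr_gt0 ?mulr_gt0//.
    apply: (lt_le_trans L1); rewrite le_eqVlt; apply/orP; left; apply/eqP.
    by field; rewrite !gt_eqF.
  rewrite E1 ler_norml => /andP[+ _]; apply/negP; rewrite -ltNge.
  move: pos rx L1; move: (ip _ _) (rho x) (e * _) (k * q) => a b c' d'; lra.
- have dn : 'D_(- n) rho p < 0.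
    have -> : 'D_(- n) rho p = - q by rewrite Dr ipC -scaleN1r ipZl mulN1r.
    by rewrite oppr_lt0.
  have [t0 t00 Ht] := derive_sign dr dn.
  pose t := Num.min t0 k / 2.
  have t1 : 0 < t by rewrite divr_gt0// lt_min t00.
  have tm : t < Num.min t0 k by rewrite /t ltr_pdivrMr// ltr_pMr ?lt_min ?t00// ltr1n.
  have tk : t < k by apply: (lt_le_trans tm); rewrite ge_min lexx orbT.
  have tt : t < t0 by apply: (lt_le_trans tm); rewrite ge_min lexx.
  pose y := p + t *: - n.
  have yc : y - c = - (t + k) *: n.
    by rewrite /y /c opprD addrACA subrr add0r scalerN scaleNr scalerDl opprD.
  have ys : sqd c y < s.
    have -> : sqd c y = (t + k) ^+ 2 * q by rewrite /sqd yc ipZl ipC ipZl mulrA mulrNN -expr2.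
    rewrite /s mulrA ltr_pM2r//; have -> : 4 * k ^+ 2 = (k + k) ^+ 2 by ring.
    by rewrite ltrXn2r// ?ltrD2r// addr_ge0// ltW.
  exists y; split.
  + by rewrite -rp; apply: Ht; rewrite t1.
  + by apply: (lt_le_trans (small y ys)); rewrite ge_min lexx.
  + have w0 : 0 < 10 * pospart 4 (s - sqd c y).
      by rewrite pmulr_rgt0 ?ltr0n//; apply: pospart_gt0; rewrite subr_gt0.
    rewrite derive_bump oppr_gt0 (pmulr_rlt0 _ w0).
    have -> : ip (y - c) n = - ((t + k) * q) by rewrite yc ipZl mulNr.
    by rewrite oppr_lt0 mulr_gt0// addr_gt0.
Qed.

End InnerBump.

Section Tube.
Context {R : realType}.
Local Notation E := 'M[R]_2.
Implicit Types (rho : E -> R) (x v p n : E).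

Lemma box_norm (L r : R) x p : box L p -> 0 < r -> `|x - p| < r -> box (L + r) x.
Proof.
move=> pL r0 /(entry_norm _ r0) H j k; have := H j k; rewrite !mxE => h.
rewrite -(subrK (p j k) (x j k)); apply: (le_trans (ler_normD _ _)).
by rewrite addrC; apply: lerD; [exact: pL|exact: ltW].
Qed.

Lemma gradient_flux rho x :
  flux rho (fun j k y => 'D_(delta_mx j k) rho y) x = ip (gradient rho x) (gradient rho x).
Proof. by rewrite /flux /ip; apply: eq_bigr => j _; apply: eq_bigr => k _; rewrite !mxE. Qed.

Lemma gradient_neq0 rho x v : differentiable rho x -> 'D_v rho x != 0 ->
  0 < ip (gradient rho x) (gradient rho x).
Proof.
by move=> dr; rewrite derive_gradient//; exact: ip_neq0.
Qed.

Lemma continuous_ball (f : E -> R) p (a : R) : {for p, continuous f} -> a < f p ->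
  exists2 r : R, 0 < r <= 1 & forall x, `|x - p| < r -> a < f x.
Proof.
move=> cf ap; have e0 : 0 < f p - a by rewrite subr_gt0.
have [r r0 H] := cont_ball cf e0; exists (Num.min r 1).
  by rewrite lt_min r0 ltr01 ge_min lexx orbT.
move=> x xr; have := H x; rewrite -ball_normE /= -normrN opprB => /(_ (lt_le_trans xr _)).
rewrite ge_min lexx => /(_ isT) /ltr_normlW; by rewrite ltrD2l ltrN2.
Qed.

(** A compactly supported divergence-free field that nowhere points inwards
    along the compact zero set of rho is tangent to it. Its flux through the layer
    -e < rho < 0 vanishes for every e, by I_layer. If the flux density were
    positive at p0, it would be on M at least a positive multiple of the density of
    psi n, where n is the gradient at p0 and psi the bump of inner_bump. The flux
    of psi n is the mean of layer * div (psi n), and stays away from 0 as e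
    decreases. On a thin layer the density of the given field can fall short of
    that multiple by a small constant only; the loss is small too, because the
    total weight of a layer is bounded by means of the flux of the gradient of
    rho. *)
Theorem tube (L' : R) rho (M : set E) (Y : 'I_2 -> 'I_2 -> E -> R) :
  0 < L' -> compact M -> M `<=` box L' -> Ck 3 setT rho ->
  (forall x, rho x = 0 <-> M x) ->
  (forall x, M x -> exists v, 'D_v rho x != 0) ->
  (forall x, ~ box L' x -> forall v, 'D_v rho x = 0) ->
  (forall j k, Ck 2 setT (Y j k)) ->
  (forall j k x, ~ box L' x -> Y j k x = 0) ->
  (forall x, divergence Y x = 0) ->
  (forall x, M x -> 0 <= flux rho Y x) ->
  forall x, M x -> flux rho Y x = 0.
Proof.
move=> L0 cM ML cr rM reg rout cY Yout divY Gge0 p0 Mp0.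
apply/eqP; rewrite eq_le Gge0// andbT leNgt; apply/negP => Gp0.
pose L := L' + 2.
have L20 : 0 < L by rewrite addr_gt0.
have [J [JD JZ Jle Jd Jpos]] := exists_mean L20.
pose L1 := L' + 1.
have L1L : L1 < L by rewrite ltrD2l ltr1n.
have Jder j k (g : E -> R) : Ck 2 setT g -> (forall x, ~ box L1 x -> g x = 0) ->
   J (fun x => 'D_(delta_mx j k) g x) = 0 by exact: Jd L1L.
have boxL1 x : ~ box L1 x -> ~ box L' x.
  by move=> h b; apply: h => j k; apply: (le_trans (b j k)); rewrite lerDl.
have dr x : differentiable rho x by exact: (Ck_diff cr (Logic.I : setT x)).
have layerI e V (e0 : 0 < e) := @I_layer R L L1 J JD JZ Jder rho e V e0 cr.
have rhoc x : {for x, continuous rho} by exact: (Ck_cont cr (Logic.I : setT x)).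
(* The flux of the gradient of rho bounds the total weight of all layers. *)
pose dd (j k : 'I_2) (x : E) : R := 'D_(delta_mx j k) rho x.
pose N2 := flux rho dd.
have cdd j k : Ck 2 setT (dd j k) := CkD1 _ cr.
have cN2 : Ck 2 setT N2 := Ck_flux cr cdd.
have N2c x : {for x, continuous N2} by exact: (Ck_cont cN2 (Logic.I : setT x)).
have N2pos x : M x -> 0 < N2 x.
  by move=> Mx; have [v Dv] := reg x Mx; rewrite /N2 gradient_flux; exact: gradient_neq0 (dr x) Dv.
have [c0 c00 Hc0] := compact_pos_min cM (fun x _ => N2c x) N2pos.
have [B1 HB1] := Ck_bounded L (Ck_divergence cdd).
pose K := J (fun=> B1).
have wN2 e : 0 < e -> J (fun x => weight rho e x * N2 x) <= K.
  move=> e0; rewrite (layerI e dd e0) //.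
    apply: Jle.
    - exact: (Ck_bounded L (CkM openT (Ck_S (Ck_S (Ck_layer e0 cr))) (Ck_divergence cdd))).
    - exact: (Ck_bounded L (Ck_cst 0 setT B1)).
    move=> x xL; have /andP[l0 l1] := layer_ge0 rho x e0.
    apply: (le_trans (ler_norm _)); rewrite normrM (ger0_norm l0).
    rewrite -[leRHS]mul1r; apply: ler_pM => //; exact: HB1.
  by move=> j k x xL; apply: rout; exact: boxL1.
(* Near p0 the density G of Y is larger than a constant a. *)
pose G := flux rho Y.
have cG : Ck 2 setT G := Ck_flux cr cY.
have Gc x : {for x, continuous G} by exact: (Ck_cont cG (Logic.I : setT x)).
pose a := G p0 / 2.
have a0 : 0 < a by rewrite divr_gt0.
have aG : a < G p0 by rewrite ltr_pdivrMr// ltr_pMr// ltr1n.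
have [m /andP[m0 m1] Hm] := continuous_ball (Gc p0) aG.
have rp0 : rho p0 = 0 by apply/rM.
have q0 : 0 < ip (gradient rho p0) (gradient rho p0).
  by rewrite -gradient_flux; exact: N2pos.
have [c [s [bsupp bmono [y0 [ry0 yp0 Dy0]]]]] := inner_bump cr rp0 m0 q0.
set n := gradient rho p0 in q0 bmono Dy0.
pose psi := bump c s.
have cpsi : Ck 3 setT psi := Ck_bump c s.
have dpsi x : differentiable psi x by exact: (Ck_diff cpsi (Logic.I : setT x)).
pose V (j k : 'I_2) (y : E) : R := psi y * n j k.
have cV j k : Ck 2 setT (V j k) := CkM openT (Ck_S cpsi) (Ck_cst 2 setT (n j k)).
have psi0 x : ~ box L1 x -> psi x = 0.
  move=> xL; apply/eqP; apply: contrapT => /negP h; apply: xL.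
  apply: (box_norm (ML p0 Mp0) ltr01); exact: lt_le_trans (bsupp x h) m1.
have cFV : Ck 2 setT (flux rho V) := Ck_flux cr cV.
have [B2 HB2] := Ck_bounded L cFV.
pose b2 := `|B2| + 1.
have b20 : 0 < b2 by rewrite ltr_wpDl.
pose dl := a / b2.
have dl0 : 0 < dl by rewrite divr_gt0.
pose g x := G x - dl * flux rho V x.
have gM x : M x -> 0 <= g x.
  move=> Mx; rewrite /g subr_ge0.
  have [p0x|p0x] := eqVneq (psi x) 0.
    by rewrite flux_scaled// p0x mul0r mulr0; exact: Gge0.
  have Gx := ltW (Hm x (bsupp x p0x)).
  apply: le_trans Gx; rewrite /dl mulrAC ler_pdivrMr// ler_pM2l//.
  have xL : box L x.
    by move=> j k; apply: (le_trans (ML x Mx j k)); rewrite lerDl.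
  apply: (le_trans (ler_norm _)); apply: (le_trans (HB2 x xL)).
  by apply: (le_trans (ler_norm _)); rewrite lerDl.
have cg : Ck 2 setT g := CkB openT cG (CkM openT (Ck_cst 2 setT dl) cFV).
have gc x : {for x, continuous g} by exact: (Ck_cont cg (Logic.I : setT x)).
(* The mean of g0 bounds the flux of V from below, for all small e. *)
have cdV : Ck 1 setT (divergence V) := Ck_divergence cV.
have dVc x : {for x, continuous (divergence V)} by exact: (Ck_cont cdV (Logic.I : setT x)).
have dVE x : divergence V x = 'D_n psi x by exact: divergence_scaled.
pose e0 := - rho y0 / 2.
have e00 : 0 < e0 by rewrite divr_gt0// oppr_gt0.
pose g0 x := if rho x <= - e0 then divergence V x else 0.
have [B3 HB3] := Ck_bounded L cdV.
have bg0 : bounded_on_box L g0.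
  exists `|B3| => x xL; rewrite /g0; case: ifP => _; last by rewrite normr0.
  exact: (le_trans (HB3 x xL) (ler_norm _)).
have g0le e x : 0 < e -> e <= e0 -> g0 x <= layer rho e x * divergence V x.
  move=> e1 ee; rewrite /g0; case: ifP => h.
    by rewrite (layer_eq1 e1) ?mul1r// (le_trans h)// lerN2.
  have [r0|r0] := ltP (rho x) 0; last by rewrite layer_eq0// mul0r.
  have /andP[l0 _] := layer_ge0 rho x e1.
  by apply: mulr_ge0 => //; rewrite dVE; exact: bmono.
have g0pos : 0 < J g0.
  have nrc : {for y0, continuous (fun x => - rho x)}.
    exact: (Ck_cont (CkN openT cr) (Logic.I : setT y0)).
  have ne0 : e0 < - rho y0.
    by rewrite /e0 ltr_pdivrMr// ltr_pMr ?ltr1n// oppr_gt0.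
  have [r1 /andP[r10 r11] Hr1] := continuous_ball nrc ne0.
  pose c1 := divergence V y0 / 2.
  have c10 : 0 < c1 by rewrite divr_gt0// dVE.
  have c1d : c1 < divergence V y0 by rewrite ltr_pdivrMr// ltr_pMr ?ltr1n// dVE.
  have [r2 /andP[r20 r21] Hr2] := continuous_ball (dVc y0) c1d.
  pose r := Num.min r1 r2.
  have r0 : 0 < r by rewrite lt_min r10.
  apply: (Jpos g0 y0 r c1 r0 c10 bg0).
  - move=> j k; have yL : box L1 y0.
      by apply: (box_norm (ML p0 Mp0) ltr01); exact: lt_le_trans yp0 m1.
    have -> : L = L1 + 1 by rewrite /L /L1 -addrA.
    by apply: lerD; [exact: yL|rewrite ge_min r11].
  - move=> x xL; rewrite /g0; case: ifP => // h.
    rewrite dVE; apply: bmono; apply: (le_lt_trans h); by rewrite oppr_lt0.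
  - move=> x xr; have xn : `|x - y0| < r.
      by apply/(entry_norm _ r0) => j k; have := xr j k; rewrite !mxE.
    have x1 : e0 < - rho x by apply: Hr1; apply: (lt_le_trans xn); rewrite ge_min lexx.
    have x2 : c1 < divergence V x by apply: Hr2; apply: (lt_le_trans xn); rewrite ge_min lexx orbT.
    have h : rho x <= - e0 by rewrite lerNr ltW.
    by rewrite /g0 h ltW.
(* The layer is so thin that G - dl * flux V > - e and that the squared length
   of the gradient exceeds c0 / 2 on it. *)
pose K1 := `|K| + 1.
have K10 : 0 < K1 by rewrite ltr_wpDl.
pose e := dl * J g0 * (c0 / 2) / (2 * K1).
have ee0 : 0 < e.
  by rewrite divr_gt0 ?(mulr_gt0 _ K10)// mulr_gt0 ?(divr_gt0 c00)// mulr_gt0.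
have [e1 e10 He1] : exists2 e1 : R, 0 < e1 & forall x, box L x -> `|rho x| < e1 -> 0 < g x + e.
  apply: near_zero_set => // x.
    exact: (Ck_cont (CkD openT cg (Ck_cst 2 setT e)) (Logic.I : setT x)).
  by move=> xL /rM Mx; rewrite ltr_wpDl// gM.
have [e2 e20 He2] : exists2 e2 : R, 0 < e2 & forall x, box L x -> `|rho x| < e2 -> 0 < N2 x - c0 / 2.
  apply: near_zero_set => // x.
    exact: (Ck_cont (CkB openT cN2 (Ck_cst 2 setT (c0 / 2))) (Logic.I : setT x)).
  move=> xL /rM Mx; rewrite subr_gt0; apply: lt_le_trans (Hc0 x Mx).
  by rewrite ltr_pdivrMr// ltr_pMr// ltr1n.
pose e3 := Num.min e0 (Num.min e1 e2).
have e30 : 0 < e3 by rewrite !lt_min e00 e10.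
have e3e0 : e3 <= e0 by rewrite ge_min lexx.
have e3e1 : e3 <= e1 by rewrite !ge_min lexx orbT.
have e3e2 : e3 <= e2 by rewrite !ge_min lexx !orbT.
have cw : Ck 2 setT (weight rho e3) := Ck_weight e30 cr.
have b1 : Ck 2 setT (fun x => weight rho e3 x * N2 x) := CkM openT cw cN2.
have b3 : Ck 2 setT (fun x => weight rho e3 x * flux rho V x) := CkM openT cw cFV.
have b4 : Ck 2 setT (fun x => weight rho e3 x * flux rho Y x) := CkM openT cw cG.
pose k1 := - (e / (c0 / 2)).
have pt x : box L x -> k1 * (weight rho e3 x * N2 x) + dl * (weight rho e3 x * flux rho V x)
   <= weight rho e3 x * flux rho Y x.
  move=> xL; have [h|h] := leP e3 `|rho x|.
    by rewrite (weight_eq0 e30 h) !mul0r !mulr0 addr0.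
  have w0 := weight_ge0 rho x e30.
  have g1 : 0 < g x + e by apply: He1 => //; exact: lt_le_trans h e3e1.
  have n1 : 0 < N2 x - c0 / 2 by apply: He2 => //; exact: lt_le_trans h e3e2.
  have E1 : e <= (e / (c0 / 2)) * N2 x.
    rewrite mulrAC ler_pdivlMr ?divr_gt0// ler_pM2l// ltW//.
    by rewrite -subr_gt0.
  have G1 : flux rho Y x = g x + dl * flux rho V x by rewrite /g subrK.
  rewrite G1 mulrDr mulrCA [dl * (_ * _)]mulrCA -mulrDr -mulrDr.
  apply: ler_wpM2l => //; rewrite lerD2r /k1 mulNr lerNl.
  apply: le_trans E1; rewrite lerNl; rewrite ltW// -subr_gt0 opprK//.
have := @Jle _ _ _ _ pt.
have bb1 := Ck_bounded L b1; have bb3 := Ck_bounded L b3; have bb4 := Ck_bounded L b4.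
have bb5 := Ck_bounded L (CkM openT (Ck_cst 2 setT k1) b1).
have bb6 := Ck_bounded L (CkM openT (Ck_cst 2 setT dl) b3).
have bb7 := Ck_bounded L (CkD openT (CkM openT (Ck_cst 2 setT k1) b1) (CkM openT (Ck_cst 2 setT dl) b3)).
move=> /(_ bb7 bb4).
rewrite (JD _ _ bb5 bb6) (JZ _ _ bb1) (JZ _ _ bb3).
have -> : J (fun x => weight rho e3 x * flux rho Y x) = 0.
  rewrite (layerI e3 Y e30 cY) //.
    have -> : (fun x => layer rho e3 x * divergence Y x) = (fun x => 0 * weight rho e3 x).
      by apply/funext => x; rewrite divY mulr0 mul0r.
    by rewrite (JZ _ _ (Ck_bounded L cw)) mul0r.
  by move=> j k x xL; apply: Yout; exact: boxL1.
rewrite (layerI e3 V e30 cV); last by move=> j k x xL; rewrite /V psi0// mul0r.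
have lowV : J g0 <= J (fun x => layer rho e3 x * divergence V x).
  apply: Jle => //.
    exact: (Ck_bounded L (CkM openT (Ck_S (Ck_S (Ck_layer e30 cr))) cdV)).
  by move=> x _; exact: g0le.
move=> fin.
have f1 : dl * J g0 <= dl * J (fun x => layer rho e3 x * divergence V x) by rewrite ler_pM2l.
have k0 : 0 < e / (c0 / 2) by rewrite divr_gt0// divr_gt0.
have f2 : (e / (c0 / 2)) * J (fun x => weight rho e3 x * N2 x) <= (e / (c0 / 2)) * K1.
  rewrite ler_pM2l//; apply: (le_trans (wN2 e3 e30)).
  by apply: (le_trans (ler_norm _)); rewrite lerDl.
have f3 : (e / (c0 / 2)) * K1 = dl * J g0 / 2.
  by rewrite /e; field; rewrite !gt_eqF.
have f4 : 0 < dl * J g0 by rewrite mulr_gt0.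
move: fin; rewrite /k1 mulNr.
move: f1 f2 f3 f4; move: (dl * J g0) (dl * J _) (e / _ * J _) (e / _ * K1) => A B C D.
clear; lra.
Qed.

End Tube.

(** * Alternating forms on R^4 *)

Section Forms.
Context {R : realType}.
Local Notation E := 'M[R]_2.
Implicit Types (x u v w n : E) (a : E -> R) (b : E -> E -> R) (c : E -> E -> E -> R).
Local Notation e0 := (delta_mx 0 0 : E).
Local Notation e1 := (delta_mx 0 1 : E).
Local Notation e2 := (delta_mx 1 0 : E).
Local Notation e3 := (delta_mx 1 1 : E).

Lemma ord2_neq0 (j : 'I_2) : j != 0 -> j = 1.
Proof. by case: j => [[|[|//]] Hj] // _; exact: val_inj. Qed.

(** Linearity and alternation are encoded by the expansion in coordinates,
    which is the form in which they are used. *)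
Definition lin1 a : Prop := forall v,
  a v = v 0 0 * a e0 + v 0 1 * a e1 + v 1 0 * a e2 + v 1 1 * a e3.

Definition alt2 b : Prop := forall v w,
  b v w = (v 0 0 * w 0 1 - v 0 1 * w 0 0) * b e0 e1
        + (v 0 0 * w 1 0 - v 1 0 * w 0 0) * b e0 e2
        + (v 0 0 * w 1 1 - v 1 1 * w 0 0) * b e0 e3
        + (v 0 1 * w 1 0 - v 1 0 * w 0 1) * b e1 e2
        + (v 0 1 * w 1 1 - v 1 1 * w 0 1) * b e1 e3
        + (v 1 0 * w 1 1 - v 1 1 * w 1 0) * b e2 e3.

Definition det3 (a1 a2 a3 b1 b2 b3 c1 c2 c3 : R) : R :=
  a1 * (b2 * c3 - b3 * c2) - a2 * (b1 * c3 - b3 * c1) + a3 * (b1 * c2 - b2 * c1).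

Definition mx4 (x0 x1 x2 x3 : R) : E :=
  \matrix_(j, k) (if j == 0 then if k == 0 then x0 else x1
                  else if k == 0 then x2 else x3).

(** The vector product of three vectors of R^4. *)
Definition cross u v w : E := mx4
  (det3 (u 0 1) (u 1 0) (u 1 1) (v 0 1) (v 1 0) (v 1 1) (w 0 1) (w 1 0) (w 1 1))
  (- det3 (u 0 0) (u 1 0) (u 1 1) (v 0 0) (v 1 0) (v 1 1) (w 0 0) (w 1 0) (w 1 1))
  (det3 (u 0 0) (u 0 1) (u 1 1) (v 0 0) (v 0 1) (v 1 1) (w 0 0) (w 0 1) (w 1 1))
  (- det3 (u 0 0) (u 0 1) (u 1 0) (v 0 0) (v 0 1) (v 1 0) (w 0 0) (w 0 1) (w 1 0)).

(** The vector field dual to a 3-form of R^4 (its Hodge star). *)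
Definition hodge c : E :=
  mx4 (c e1 e2 e3) (- c e0 e2 e3) (c e0 e1 e3) (- c e0 e1 e2).

Definition alt3 c : Prop := forall u v w, c u v w = ip (cross u v w) (hodge c).

Definition wedge12 a b u v w : R := a u * b v w + a v * b w u + a w * b u v.

Lemma mx4_eta x : x = mx4 (x 0 0) (x 0 1) (x 1 0) (x 1 1).
Proof.
apply/matrixP => j k; rewrite mxE.
by case: (altP (j =P 0)) => [->|/ord2_neq0 ->]; case: (altP (k =P 0)) => [->|/ord2_neq0 ->].
Qed.

Lemma mx4Z (k a0 a1 a2 a3 : R) :
  k *: mx4 a0 a1 a2 a3 = mx4 (k * a0) (k * a1) (k * a2) (k * a3).
Proof. by apply/matrixP => i j; rewrite !mxE; do 2 case: ifP => _. Qed.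

Lemma ip_mx4 (a0 a1 a2 a3 b0 b1 b2 b3 : R) :
  ip (mx4 a0 a1 a2 a3) (mx4 b0 b1 b2 b3) = a0 * b0 + a1 * b1 + a2 * b2 + a3 * b3.
Proof. by rewrite ipE !mxE. Qed.

Lemma alt2C b v w : alt2 b -> b v w = - b w v.
Proof.
move=> ab; rewrite (ab v w) (ab w v).
move: (b e0 e1) (b e0 e2) (b e0 e3) (b e1 e2) (b e1 e3) (b e2 e3).
move: (v _ _) (v _ _) (v _ _) (v _ _) (w _ _) (w _ _) (w _ _) (w _ _).
by clear=> *; ring.
Qed.

Lemma alt3_wedge a b : lin1 a -> alt2 b -> alt3 (wedge12 a b).
Proof.
move=> la ab u v w; rewrite /hodge /cross ip_mx4 /wedge12.
rewrite (alt2C e3 e1 ab) (alt2C e3 e0 ab) (alt2C e2 e0 ab).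
rewrite (la u) (la v) (la w) (ab u v) (ab v w) (ab w u) /det3.
move: (b e0 e1) (b e0 e2) (b e0 e3) (b e1 e2) (b e1 e3) (b e2 e3) (a e0) (a e1) (a e2) (a e3).
move: (u _ _) (u _ _) (u _ _) (u _ _) (v _ _) (v _ _) (v _ _) (v _ _) (w _ _) (w _ _) (w _ _) (w _ _).
by clear=> *; ring.
Qed.

Lemma hodgeD c1 c2 : hodge (fun u v w => c1 u v w + c2 u v w) = hodge c1 + hodge c2.
Proof.
by apply/matrixP => j k; rewrite !mxE; do 2 case: ifP => _; rewrite ?opprD.
Qed.

Lemma alt3D c1 c2 : alt3 c1 -> alt3 c2 -> alt3 (fun u v w => c1 u v w + c2 u v w).
Proof. by move=> a1 a2 u v w; rewrite hodgeD ipC ipDl !(ipC (hodge _)) -a1 -a2. Qed.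

(** A covector killing three vectors is a multiple of their vector product. *)
Lemma normal_parallel n u v w : ip n u = 0 -> ip n v = 0 -> ip n w = 0 ->
  ip (cross u v w) (cross u v w) *: n = ip n (cross u v w) *: cross u v w.
Proof.
move=> nu nv nw; rewrite !ipE in nu nv nw.
move: nu nv nw (mx4_eta n); rewrite /cross.
move: (n 0 0) (n 0 1) (n 1 0) (n 1 1) => n0 n1 n2 n3.
move: (u 0 0) (u 0 1) (u 1 0) (u 1 1) => u0 u1 u2 u3.
move: (v 0 0) (v 0 1) (v 1 0) (v 1 1) => v0 v1 v2 v3.
move: (w 0 0) (w 0 1) (w 1 0) (w 1 1) => w0 w1 w2 w3.
move=> nu nv nw ->; rewrite !ip_mx4 !mx4Z; clear u v w n.
pose S (i j k l m o : R) : R :=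
    (n0 * u0 + n1 * u1 + n2 * u2 + n3 * u3) * (k * o - l * m)
    - (n0 * v0 + n1 * v1 + n2 * v2 + n3 * v3) * (i * o - j * m)
    + (n0 * w0 + n1 * w1 + n2 * w2 + n3 * w3) * (i * l - j * k).
have S0 i j k l m o : S i j k l m o = 0.
  by rewrite /S nu nv nw !mul0r subrr addr0.
pose c0 := det3 u1 u2 u3 v1 v2 v3 w1 w2 w3; pose c1 := - det3 u0 u2 u3 v0 v2 v3 w0 w2 w3.
pose c2 := det3 u0 u1 u3 v0 v1 v3 w0 w1 w3; pose c3 := - det3 u0 u1 u2 v0 v1 v2 w0 w1 w2.
have p01 : n0 * c1 - n1 * c0 = - S u2 u3 v2 v3 w2 w3 by rewrite /c0 /c1 /det3 /S; clear; ring.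
have p02 : n0 * c2 - n2 * c0 = S u1 u3 v1 v3 w1 w3 by rewrite /c0 /c2 /det3 /S; clear; ring.
have p03 : n0 * c3 - n3 * c0 = - S u1 u2 v1 v2 w1 w2 by rewrite /c0 /c3 /det3 /S; clear; ring.
have p12 : n1 * c2 - n2 * c1 = - S u0 u3 v0 v3 w0 w3 by rewrite /c1 /c2 /det3 /S; clear; ring.
have p13 : n1 * c3 - n3 * c1 = S u0 u2 v0 v2 w0 w2 by rewrite /c1 /c3 /det3 /S; clear; ring.
have p23 : n2 * c3 - n3 * c2 = - S u0 u1 v0 v1 w0 w1 by rewrite /c2 /c3 /det3 /S; clear; ring.
rewrite !S0 ?oppr0 in p01 p02 p03 p12 p13 p23.
rewrite -/c0 -/c1 -/c2 -/c3.
move: c0 c1 c2 c3 p01 p02 p03 p12 p13 p23 => c0 c1 c2 c3 p01 p02 p03 p12 p13 p23.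
have z (a b : R) : a - b = 0 -> a = b by move/eqP; rewrite subr_eq0 => /eqP.
congr mx4; apply: z.
- rewrite (_ : _ - _ = c1 * (n0 * c1 - n1 * c0) + c2 * (n0 * c2 - n2 * c0) + c3 * (n0 * c3 - n3 * c0)).
    by rewrite p01 p02 p03 !mulr0 !addr0.
  by clear; ring.
- rewrite (_ : _ - _ = - (c0 * (n0 * c1 - n1 * c0)) + c2 * (n1 * c2 - n2 * c1) + c3 * (n1 * c3 - n3 * c1)).
    by rewrite p01 p12 p13 !mulr0 oppr0 !addr0.
  by clear; ring.
- rewrite (_ : _ - _ = - (c0 * (n0 * c2 - n2 * c0)) - c1 * (n1 * c2 - n2 * c1) + c3 * (n2 * c3 - n3 * c2)).
    by rewrite p02 p12 p23 !mulr0 !oppr0 !addr0.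
  by clear; ring.
- rewrite (_ : _ - _ = - (c0 * (n0 * c3 - n3 * c0)) - c1 * (n1 * c3 - n3 * c1) - c2 * (n2 * c3 - n3 * c2)).
    by rewrite p03 p13 p23 !mulr0 !oppr0 !addr0.
  by clear; ring.
Qed.


(** Differential forms on R^4 are evaluated on constant vector fields. *)
Definition dform (B : E -> E -> E -> R) x u v w : R :=
  'D_u (fun y => B y v w) x + 'D_v (fun y => B y w u) x + 'D_w (fun y => B y u v) x.

(** With class Ck 3 the vector field dual to dform B is of class Ck 2, as
    integration by parts requires. *)
Definition form2 (V : set E) (B : E -> E -> E -> R) : Prop :=
  (forall x, V x -> alt2 (B x)) /\ forall v w, Ck 3 V (fun x => B x v w).

Lemma lin1_derive f x : differentiable f x -> lin1 (fun v => 'D_v f x).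
Proof.
move=> df v.
have H (F : 'I_2 -> 'I_2 -> R) : \sum_j \sum_k F j k = F 0 0 + F 0 1 + F 1 0 + F 1 1.
  by rewrite !sum_I2 addrA.
by rewrite (derive_coord v df) H.
Qed.

Lemma alt2_minor (j k l m : 'I_2) : alt2 (fun v w => v j k * w l m - v l m * w j k).
Proof.
move=> v w.
have c2 (P : 'I_2 -> Prop) : P 0 -> P 1 -> forall i, P i.
  by move=> P0 P1 i; case: (altP (i =P 0)) => [->|/ord2_neq0 ->].
move: j; apply: (c2); move: k; apply: (c2); move: l; apply: (c2); move: m; apply: (c2);
 rewrite !mxE /=; move: (v _ _) (v _ _) (v _ _) (v _ _) (w _ _) (w _ _) (w _ _) (w _ _);
 by clear=> *; ring.
Qed.

Lemma dform_alt3 V B x : open V -> V x -> form2 V B -> alt3 (dform B x).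
Proof.
move=> oV Vx [aB cB].
have dB v w : differentiable (fun y => B y v w) x by exact: Ck_diff (cB v w) Vx.
pose m (j k l n : 'I_2) (v w : E) : R := v j k * w l n - v l n * w j k.
pose D (v w u : E) : R := 'D_u (fun y => B y v w) x.
pose T (j k l o : 'I_2) u v w := wedge12 (D (delta_mx j k) (delta_mx l o)) (m j k l o) u v w.
have aT j k l o : alt3 (T j k l o).
  by apply: alt3_wedge; [exact: lin1_derive|exact: alt2_minor].
have E1 u v w : 'D_u (fun y => B y v w) x =
   m 0 0 0 1 v w * D e0 e1 u + m 0 0 1 0 v w * D e0 e2 u + m 0 0 1 1 v w * D e0 e3 u
   + m 0 1 1 0 v w * D e1 e2 u + m 0 1 1 1 v w * D e1 e3 u + m 1 0 1 1 v w * D e2 e3 u.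
  pose P (f : E -> R) (a : R) := differentiable f x /\ 'D_u f x = a.
  have PD (f g : E -> R) (s t : R) : P f s -> P g t -> P (fun y => f y + g y) (s + t).
    move=> [df fa] [dg gb]; split; first exact: (@differentiableD R E R f g x df dg).
    by rewrite (dD _ df dg) fa gb.
  have PM (s : R) (v' w' : E) : P (fun y => s * B y v' w') (s * D v' w' u).
    have dk : differentiable (fun _ : E => s) x by exact: differentiable_cst.
    split; first exact: (@differentiableM R E (fun _ => s) (fun y => B y v' w') x dk (dB v' w')).
    by rewrite (dM _ dk (dB v' w')) dC mul0r add0r.
  have [_ <-] := PD _ _ _ _ (PD _ _ _ _ (PD _ _ _ _ (PD _ _ _ _ (PD _ _ _ _
    (PM (m 0 0 0 1 v w) e0 e1) (PM (m 0 0 1 0 v w) e0 e2)) (PM (m 0 0 1 1 v w) e0 e3))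
    (PM (m 0 1 1 0 v w) e1 e2)) (PM (m 0 1 1 1 v w) e1 e3)) (PM (m 1 0 1 1 v w) e2 e3).
  by apply: (eq_on_derive _ oV Vx) => y Vy; exact: (aB y Vy v w).
have E2 : dform B x = (fun u v w => T 0 0 0 1 u v w + (T 0 0 1 0 u v w + (T 0 0 1 1 u v w
    + (T 0 1 1 0 u v w + (T 0 1 1 1 u v w + T 1 0 1 1 u v w))))).
  apply/funext => u; apply/funext => v; apply/funext => w.
  rewrite /dform !E1 /T /wedge12.
  move: (m 0 0 0 1) (m 0 0 1 0) (m 0 0 1 1) (m 0 1 1 0) (m 0 1 1 1) (m 1 0 1 1).
  move: (D e0 e1) (D e0 e2) (D e0 e3) (D e1 e2) (D e1 e3) (D e2 e3).
  clear=> d1 d2 d3 d4 d5 d6 m1 m2 m3 m4 m5 m6.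
  move: (d1 _) (d1 _) (d1 _) (d2 _) (d2 _) (d2 _) (d3 _) (d3 _) (d3 _)
   (d4 _) (d4 _) (d4 _) (d5 _) (d5 _) (d5 _) (d6 _) (d6 _) (d6 _)
   (m1 _ _) (m1 _ _) (m1 _ _) (m2 _ _) (m2 _ _) (m2 _ _) (m3 _ _) (m3 _ _) (m3 _ _)
   (m4 _ _) (m4 _ _) (m4 _ _) (m5 _ _) (m5 _ _) (m5 _ _) (m6 _ _) (m6 _ _) (m6 _ _).
  by move=> *; ring.
rewrite E2; do 5 (apply: alt3D; first exact: aT); exact: aT.
Qed.

(** d d = 0, in the form: the field dual to an exact 3-form is divergence free. *)
Lemma divergence_hodge (B : E -> E -> E -> R) x :
  (forall y, alt2 (B y)) -> (forall v w, Ck 3 setT (fun y => B y v w)) ->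
  divergence (fun j k y => hodge (dform B y) j k) x = 0.
Proof.
move=> aB cB.
pose P i j k l := 'D_i (fun y => 'D_j (fun z => B z k l) y) x.
have sym i j k l : P i j k l = P j i k l.
  rewrite /P. exact: (derive_comm i j openT (Logic.I : setT x) (Ck_S (cB k l))).
have anti i j k l : P i j k l = - P i j l k.
  rewrite /P.
  have -> : (fun y => 'D_j (fun z => B z k l) y) = (fun y => - 'D_j (fun z => B z l k) y).
    apply/funext => y.
    rewrite -(dN _ (Ck_diff (cB l k) (Logic.I : setT y))).
    by congr ('D_j _ y); apply/funext => z; exact: alt2C.
  by rewrite dN//; exact: (Ck_diff (CkD1 _ (cB l k)) (Logic.I : setT x)).
have d1 (j k l : E) : differentiable (fun y => 'D_j (fun z => B z k l) y) x.
  exact: (Ck_diff (CkD1 _ (cB k l)) (Logic.I : setT x)).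
have D3 s u v w : 'D_s (fun y => dform B y u v w) x = P s u v w + P s v w u + P s w u v.
  have d2 : differentiable (fun y => 'D_u (fun z => B z v w) y + 'D_v (fun z => B z w u) y) x.
    exact: (diffD (d1 u v w) (d1 v w u)).
  by rewrite /dform (dD s d2 (d1 w u v)) (dD s (d1 u v w) (d1 v w u)).
have dd3 u v w : differentiable (fun y => dform B y u v w) x.
  have d2 : differentiable (fun y => 'D_u (fun z => B z v w) y + 'D_v (fun z => B z w u) y) x.
    exact: (diffD (d1 u v w) (d1 v w u)).
  exact: (diffD d2 (d1 w u v)).
rewrite /divergence !sum_I2.
have h00 : (fun y => hodge (dform B y) 0 0) = (fun y => dform B y e1 e2 e3).
  by apply/funext => y; rewrite mxE.
have h01 : (fun y => hodge (dform B y) 0 1) = (fun y => - dform B y e0 e2 e3).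
  by apply/funext => y; rewrite mxE.
have h10 : (fun y => hodge (dform B y) 1 0) = (fun y => dform B y e0 e1 e3).
  by apply/funext => y; rewrite mxE.
have h11 : (fun y => hodge (dform B y) 1 1) = (fun y => - dform B y e0 e1 e2).
  by apply/funext => y; rewrite mxE.
rewrite h00 h01 h10 h11 (dN _ (dd3 _ _ _)) (dN _ (dd3 _ _ _)) !D3.
rewrite (sym e1 e0) (sym e2 e0) (sym e3 e0) (sym e2 e1) (sym e3 e1) (sym e3 e2).
rewrite (anti e0 e2 e3 e1) (anti e1 e3 e0 e2).
move: (P e0 e1 e2 e3) (P e0 e2 e1 e3) (P e0 e3 e1 e2) (P e1 e2 e3 e0) (P e1 e3 e2 e0) (P e2 e3 e0 e1).
by clear=> *; ring.
Qed.


Lemma alt2D b1 b2 : alt2 b1 -> alt2 b2 -> alt2 (fun v w => b1 v w + b2 v w).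
Proof.
move=> h1 h2 v w; rewrite (h1 v w) (h2 v w) !mulrDr.
move: (_ * b1 e0 e1) (_ * b1 e0 e2) (_ * b1 e0 e3) (_ * b1 e1 e2) (_ * b1 e1 e3) (_ * b1 e2 e3).
move: (_ * b2 e0 e1) (_ * b2 e0 e2) (_ * b2 e0 e3) (_ * b2 e1 e2) (_ * b2 e1 e3) (_ * b2 e2 e3).
by clear=> *; ring.
Qed.

Lemma alt2Z (k : R) b : alt2 b -> alt2 (fun v w => k * b v w).
Proof. by move=> h v w; rewrite (h v w) !mulrDr 6!(mulrCA k). Qed.

Lemma alt2_0 : alt2 (fun _ _ => 0).
Proof. by move=> v w; rewrite !mulr0 !addr0. Qed.

Lemma alt2_sum (I : Type) (r : seq I) (F : I -> E -> E -> R) :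
  (forall i, alt2 (F i)) -> alt2 (fun v w => \sum_(i <- r) F i v w).
Proof.
move=> aF; elim: r => [|i r IH] v w; first by rewrite !big_nil !mulr0 !addr0.
by rewrite !big_cons; exact: (alt2D (aF i) IH v w).
Qed.

End Forms.

(** * Defining functions and Stokes' theorem *)

Section Boundary.
Context {R : realType}.
Local Notation E := 'M[R]_2.
Implicit Types (rho : E -> R) (x v p q u w : E) (V : set E).

Lemma line_ball q v (r : R) : 0 < r -> exists2 d : R, 0 < d &
  forall t, 0 < t < d -> ball q r (q + t *: v).
Proof.
move=> r0; have n0 : 0 < 1 + `|v| by rewrite ltr_wpDr.
exists (r / (1 + `|v|)); first by rewrite divr_gt0.
move=> t /andP[t0 td]; rewrite -ball_normE /= opprD addNKr normrN normrZ gtr0_norm//.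
move: td; rewrite ltr_pdivlMr//; apply: le_lt_trans.
by rewrite ler_wpM2l ?(ltW t0)// lerDr.
Qed.

Variable Omega : set E.
Hypothesis oO : open Omega.
Local Notation M := (boundary Omega).

Lemma boundaryE q : M q <-> closure Omega q /\ ~ Omega q.
Proof.
rewrite /boundary; split=> -[a b]; split=> //; contradict b.
  exact: (open_nbhs_nbhs (conj oO b)).
exact: interior_subset b.
Qed.

Definition defining V rho : Prop :=
  [/\ open V, smooth_on V rho, forall q, V q -> exists v, 'D_v rho q != 0
    & forall q, V q -> (Omega q <-> rho q < 0)].

(** A zero of rho is a limit of points of Omega, because rho decreases from
    there in some direction. *)
Lemma defining_zero V rho q : defining V rho -> V q -> rho q = 0 <-> M q.
Proof.
move=> [oV sr reg sg] Vq.
have dr : differentiable rho q by exact: (sr [::] q Vq).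
split=> [r0|].
  apply/boundaryE; split; last by move=> /(sg q Vq); rewrite r0 ltxx.
  have [v Dv] : exists v, 'D_v rho q < 0.
    have [v Dv] := reg q Vq; have [lt|ge] := ltP ('D_v rho q) 0; first by exists v.
    by exists (- v); rewrite dlinN// oppr_lt0 lt_neqAle eq_sym Dv ge.
  have [d d0 Hd] := derive_sign dr Dv.
  move=> A /nbhs_ballP[r1 /= r10 HA].
  have [r2 r20 HV] := open_ball oV Vq.
  have [t1 t10 H1] := line_ball q v r10; have [t2 t20 H2] := line_ball q v r20.
  pose t := Num.min d (Num.min t1 t2) / 2.
  have m0 : 0 < Num.min d (Num.min t1 t2) by rewrite !lt_min d0 t10.
  have t0 : 0 < t by rewrite divr_gt0.
  have tm : t < Num.min d (Num.min t1 t2) by rewrite ltr_pdivrMr// ltr_pMr// ltr1n.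
  move: tm; rewrite !lt_min => /and3P[td tt1 tt2].
  exists (q + t *: v); split; last by apply: HA; apply: H1; rewrite t0.
  apply/sg; first by apply: HV; apply: H2; rewrite t0.
  by rewrite -r0; apply: Hd; rewrite t0.
move/boundaryE => [cl nO]; apply/eqP; rewrite eq_le leNgt andbC; apply/andP; split.
  by rewrite leNgt; apply/negP => /(sg q Vq).
apply/negP => r0.
have [r1 /andP[r10 _] H1] := continuous_ball (differentiable_continuous dr) r0.
have [r2 r20 HV] := open_ball oV Vq.
have nb : nbhs q (ball q (Num.min r1 r2)) by apply: nbhsx_ballx; rewrite lt_min r10.
have [x [Ox xb]] := cl _ nb.
have Vx : V x by apply: HV; apply: le_ball xb; rewrite ge_min lexx orbT.
have /(sg x Vx) := Ox; apply/negP; rewrite -leNgt ltW//; apply: H1.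
have : ball q r1 x by apply: le_ball xb; rewrite ge_min lexx.
by rewrite -ball_normE /= -normrN opprB.
Qed.

Lemma defining_out V rho q : defining V rho -> V q -> ~ closure Omega q -> 0 < rho q.
Proof.
move=> dV Vq nc; rewrite lt_neqAle; apply/andP; split.
  by apply/eqP => /esym /(defining_zero dV Vq) /boundaryE [].
have [_ _ _ sg] := dV; rewrite leNgt; apply/negP => /(sg q Vq) Oq.
exact: nc (subset_closure Oq).
Qed.

Lemma defining_tangent V rho q v : defining V rho -> V q -> M q -> tangent M q v ->
  ip (gradient rho q) v = 0.
Proof.
move=> dV Vq Mq tv; have [oV sr _ _] := dV.
rewrite -derive_gradient; last exact: (sr [::] q Vq).
by apply: (tv V rho (conj oV Vq) sr) => x Vx Mx; apply/(defining_zero dV Vx).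
Qed.

(** Moving against the gradient of rho leads into Omega, where rho' is
    negative too. *)
Lemma defining_same_side V rho V' rho' q : defining V rho -> defining V' rho' ->
  V q -> V' q -> M q -> 0 <= ip (gradient rho' q) (gradient rho q).
Proof.
move=> dV dV' Vq V'q Mq; have [oV sr reg sg] := dV; have [oV' sr' reg' sg'] := dV'.
have dr : differentiable rho q by exact: (sr [::] q Vq).
have dr' : differentiable rho' q by exact: (sr' [::] q V'q).
have [w Dw] := reg q Vq; have g0 := gradient_neq0 dr Dw.
set g := gradient rho q in g0 *.
have D1 : 'D_(- g) rho q < 0 by rewrite dlinN// derive_gradient// oppr_lt0.
have [d d0 Hd] := derive_sign dr D1.
rewrite leNgt; apply/negP => neg.
have D2 : 'D_(- g) (fun x => - rho' x) q < 0.
  by rewrite dN// dlinN// opprK derive_gradient.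
have [d' d'0 Hd'] := derive_sign (diffN dr') D2.
have [r1 r10 HV] := open_ball oV Vq; have [r2 r20 HV'] := open_ball oV' V'q.
have [t1 t10 H1] := line_ball q (- g) r10; have [t2 t20 H2] := line_ball q (- g) r20.
pose m := Num.min (Num.min d d') (Num.min t1 t2).
have m0 : 0 < m by rewrite !lt_min d0 d'0 t10.
have t0 : 0 < m / 2 by rewrite divr_gt0.
have : m / 2 < Num.min (Num.min d d') (Num.min t1 t2).
  by rewrite -/m ltr_pdivrMr// ltr_pMr// ltr1n.
rewrite !lt_min => /andP[/andP[a1 a2] /andP[a3 a4]].
have Vx : V (q + (m / 2) *: - g) by apply: HV; apply: H1; rewrite t0.
have V'x : V' (q + (m / 2) *: - g) by apply: HV'; apply: H2; rewrite t0.
have rq : rho q = 0 by apply/(defining_zero dV Vq).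
have rq' : rho' q = 0 by apply/(defining_zero dV' V'q).
have /(sg _ Vx) /(sg' _ V'x) : rho (q + (m / 2) *: - g) < 0.
  by rewrite -rq; apply: Hd; rewrite t0.
apply/negP; rewrite -leNgt -oppr_le0 ltW//.
by rewrite -oppr0 -rq'; apply: Hd'; rewrite t0.
Qed.

End Boundary.

Section Cut.
Context {R : realType}.
Local Notation E := 'M[R]_2.
Implicit Types (chi f : E -> R) (V S : set E) (q v : E).

Lemma open_setC S : closed S -> open (~` S).
Proof. by move=> cS; exact: closed_openC. Qed.

Lemma cut_Ck k chi f V S : open V -> closed S -> S `<=` V -> Ck k setT chi -> Ck k V f ->
  (forall x, ~ S x -> chi x = 0) -> Ck k setT (fun x => chi x * f x).
Proof.
move=> oV cS SV cc cf c0; apply: Ck_local => x _.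
have [Vx|nVx] := pselect (V x).
  exists V; split=> //; exact: (CkM oV (Ck_sub (@subsetT _ V) cc) cf).
exists (~` S); split; [exact: open_setC|by move=> /SV|].
by apply: (Ck_ext (open_setC cS) _ (Ck_cst k (~` S) 0)) => y Sy; rewrite c0// mul0r.
Qed.

Lemma cut_derive0 chi f S q v : closed S -> ~ S q -> (forall x, ~ S x -> chi x = 0) ->
  'D_v (fun x => chi x * f x) q = 0.
Proof.
move=> cS nS c0; rewrite (eq_on_derive (g := fun=> 0) v (open_setC cS) nS) ?dC//.
by move=> x Sx; rewrite c0// mul0r.
Qed.

End Cut.

Section Stokes.
Context {R : realType}.
Local Notation E := 'M[R]_2.
Implicit Types (x v q u w : E) (V : set E).

(** What the gluing of local forms needs near a boundary point. The sign compares
    the volume form with the outward normal, so that no orientation of M has to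
    be chosen. *)
Record local_datum := LocalDatum {
  ld_dom : set E; ld_rho : E -> R; ld_form : E -> E -> E -> R; ld_sign : R; ld_rad : R }.

Variable Omega : set E.
Variables (vol : E -> E -> E -> E -> R) (b : E -> E -> E -> R) (h : E -> R).
Local Notation M := (boundary Omega).
Hypothesis oO : open Omega.
Hypothesis nondeg : forall q, M q -> exists u v w,
  [/\ tangent M q u, tangent M q v, tangent M q w & vol q u v w != 0].

Definition good_datum p (d : local_datum) : Prop :=
  let V := ld_dom d in
  [/\ defining Omega V (ld_rho d), V p,
      form2 V (ld_form d) /\ (forall q v w, V q -> M q -> tangent M q v -> tangent M q w ->
         ld_form d q v w = b q v w),
      (forall q u v w, V q -> M q -> tangent M q u -> tangent M q v -> tangent M q w ->
         dform (ld_form d) q u v w = h q * vol q u v w) &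
      [/\ ld_sign d = 1 \/ ld_sign d = -1,
          (forall q u v w, V q -> M q -> tangent M q u -> tangent M q v -> tangent M q w ->
             vol q u v w != 0 ->
             0 < ld_sign d * ip (gradient (ld_rho d) q) (cross u v w) * vol q u v w),
          0 < ld_rad d <= 1 & forall x, sqd p x <= ld_rad d ^+ 2 -> V x]].

Lemma sqd_small p V : open V -> V p -> exists r : R, 0 < r <= 1 /\
  forall x, sqd p x <= r ^+ 2 -> V x.
Proof.
move=> oV Vp; have [r r0 H] := open_ball oV Vp.
exists (Num.min r 1 / 2); have m0 : 0 < Num.min r 1 by rewrite lt_min r0 ltr01.
have mr : Num.min r 1 / 2 < r.
  by apply: lt_le_trans (_ : Num.min r 1 <= r); rewrite ?ge_min ?lexx// ltr_pdivrMr// ltr_pMr// ltr1n.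
split.
  rewrite divr_gt0//= ler_pdivrMr// mul1r.
  by apply: le_trans (_ : 1 <= 2); rewrite ?ler1n// ge_min lexx orbT.
move=> x xs; apply: H; rewrite -ball_normE /= -normrN opprB.
apply: ip_lt_norm => //; apply: (le_lt_trans xs).
by rewrite ltrXn2r// ?nnegrE ltW// divr_gt0.
Qed.

(** The function K has, up to a positive factor, the value of vol on bases of
    the tangent space that are positive for the outward normal. It is continuous
    and nonzero, hence of constant sign near p. *)
Lemma exists_good p : M p -> smooth_boundary Omega ->
  (exists V c, [/\ open_nbhs p V, (forall q, V q -> alt3 (c q)),
     (forall u v w, {for p, continuous (fun q => c q u v w)}) &
     forall q u v w, V q -> M q -> tangent M q u -> tangent M q v -> tangent M q w ->
       c q u v w = vol q u v w]) ->
  (exists V B, [/\ open_nbhs p V, form2 V B,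
     (forall q v w, V q -> M q -> tangent M q v -> tangent M q w -> B q v w = b q v w) &
     forall q u v w, V q -> M q -> tangent M q u -> tangent M q v -> tangent M q w ->
       dform B q u v w = h q * vol q u v w]) ->
  exists d, good_datum p d.
Proof.
move=> Mp sb [V2 [c [[oV2 V2p] ac cc cvol]]] [V3 [B [[oV3 V3p] fB Bb dB]]].
have [V1 [rho [[oV1 V1p] sr reg sg]]] := sb p Mp.
have dV1 : defining Omega V1 rho by [].
have cr := (smooth_onP V1 rho).1 sr.
(* the sign of vol relative to the outward normal *)
pose K q := ip (gradient rho q) (hodge (c q)).
have cK : {for p, continuous K}.
  have cD j k : {for p, continuous (fun q => gradient rho q j k)}.
    rewrite (_ : (fun q => _) = (fun q => 'D_(delta_mx j k) rho q)); last first.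
      by apply/funext => q; rewrite mxE.
    exact: Ck_cont (CkD1 _ (cr 1)) V1p.
  have cH j k : {for p, continuous (fun q => hodge (c q) j k)}.
    have cn u v w : {for p, continuous (fun q => - c q u v w)}.
      rewrite (_ : (fun q => _) = (fun q => (-1) * c q u v w)); last first.
        by apply/funext => q; rewrite mulN1r.
      exact: contZ (cc u v w).
    under [X in {for _, continuous X}]eq_fun do rewrite mxE.
    by case: ifP => _; case: ifP => _; [exact: cc|exact: cn|exact: cc|exact: cn].
  rewrite (_ : K = fun q => gradient rho q 0 0 * hodge (c q) 0 0 + gradient rho q 0 1 * hodge (c q) 0 1
     + gradient rho q 1 0 * hodge (c q) 1 0 + gradient rho q 1 1 * hodge (c q) 1 1); last first.
    by apply/funext => q; rewrite /K ipE.
  exact: (contD (contD (contD (contM (cD _ _) (cH _ _)) (contM (cD _ _) (cH _ _)))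
     (contM (cD _ _) (cH _ _))) (contM (cD _ _) (cH _ _))).
have KE q u v w : V1 q -> V2 q -> M q -> tangent M q u -> tangent M q v -> tangent M q w ->
    ip (cross u v w) (cross u v w) * K q = ip (gradient rho q) (cross u v w) * vol q u v w.
  move=> V1q V2q Mq tu tv tw.
  have np := normal_parallel (defining_tangent oO dV1 V1q Mq tu)
    (defining_tangent oO dV1 V1q Mq tv) (defining_tangent oO dV1 V1q Mq tw).
  by rewrite /K -ipZl np ipZl -(cvol q u v w)// (ac q V2q).
have volcross q u v w : V2 q -> M q -> tangent M q u -> tangent M q v -> tangent M q w ->
    vol q u v w != 0 -> 0 < ip (cross u v w) (cross u v w).
  move=> V2q Mq tu tv tw; rewrite -(cvol q u v w)// (ac q V2q); exact: ip_neq0.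
have K0 : K p != 0.
  have [u [v [w [tu tv tw vn]]]] := nondeg Mp.
  have cc0 := volcross p u v w V2p Mp tu tv tw vn.
  apply: contra vn => /eqP K0; have := KE p u v w V1p V2p Mp tu tv tw.
  rewrite K0 mulr0 => /esym/eqP; rewrite mulf_eq0 => /orP[|//] /eqP g0.
  have np := normal_parallel (defining_tangent oO dV1 V1p Mp tu)
    (defining_tangent oO dV1 V1p Mp tv) (defining_tangent oO dV1 V1p Mp tw).
  have [w' Dw'] := reg p V1p.
  have := gradient_neq0 (Ck_diff (cr 0%N) V1p) Dw'.
  have : ip (cross u v w) (cross u v w) * ip (gradient rho p) (gradient rho p) = 0.
    by rewrite -ipZl np ipZl g0 mul0r.
  by move/eqP; rewrite mulf_eq0 (gt_eqF cc0) /= => /eqP ->; rewrite ltxx.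
pose sgn : R := if 0 < K p then 1 else -1.
have sgn2 : sgn = 1 \/ sgn = -1 by rewrite /sgn; case: ifP; [left|right].
have csK : {for p, continuous (fun q => sgn * K q)} by exact: contZ.
have sK : 0 < sgn * K p.
  rewrite /sgn; case: ifP => [K1|/negbT]; first by rewrite mul1r.
  by rewrite -leNgt le_eqVlt (negbTE K0) /= mulN1r oppr_gt0.
have [r1 /andP[r10 _] Hr1] := continuous_ball csK sK.
pose W := V1 `&` V2 `&` V3 `&` ball p r1.
have oW : open W.
  exact: (openI (openI (openI oV1 oV2) oV3) (ball_open p r1)).
have Wp : W p by split; [split; [split|]|exact: ballxx].
have [r [r01 Hr]] := sqd_small oW Wp.
exists (LocalDatum W rho B sgn r); split => /=.
- split=> //.
  + by apply/smooth_onP => k; apply: Ck_sub (cr k) => q [[[]]].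
  + by move=> q [[[V1q _] _] _]; exact: reg.
  + by move=> q [[[V1q _] _] _]; exact: sg.
- by [].
- split; last by move=> q v w [[_ V3q] _]; exact: Bb.
  have [f1 f2] := fB; split; first by move=> q [[_ V3q] _]; exact: f1.
  by move=> v w; apply: Ck_sub (f2 v w) => q [[_ V3q] _].
- by move=> q u v w [[_ V3q] _]; exact: dB.
- split=> // q u v w [[[V1q V2q] _] qr] Mq tu tv tw vn.
  have cc0 := volcross q u v w V2q Mq tu tv tw vn.
  rewrite -mulrA -KE// mulrCA mulr_gt0//; apply: Hr1.
  by move: qr; rewrite -ball_normE /= -normrN opprB.
Qed.

End Stokes.

Section StokesTheorem.
Context {R : realType}.
Local Notation E := 'M[R]_2.
Implicit Types (x v q u w : E) (V : set E).

Lemma box_closed (L : R) : closed (box L : set E).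
Proof. exact: (compact_closed (@norm_hausdorff _ _) (@compact_box R L)). Qed.

Lemma open_gt (f : E -> R) (a : R) : (forall x, {for x, continuous f}) ->
  open [set x | a < f x].
Proof.
move=> cf; rewrite openE => x /= ax; have [r /andP[r0 _] Hr] := continuous_ball (cf x) ax.
apply/nbhs_ballP; exists r => // y; rewrite -ball_normE /= -normrN opprB; exact: Hr.
Qed.

(** The local forms agree on the tangent spaces of M only. In the sum B of the
    chi_p be_p the terms d chi_p /\ be_p cancel at points of M, where the sum of
    the chi_p is 1; thus dB = h vol on tangent vectors, up to the local signs
    that compare vol with the outward normal. With these signs inserted in B,
    the flux density through M of the field dual to dB is h times a positive
    factor. *)
Theorem stokes (Omega : set E) vol b h : open Omega -> bounded_set Omega ->
  smooth_boundary Omega -> compact (boundary Omega) ->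
  (forall q, boundary Omega q -> exists u v w,
    [/\ tangent (boundary Omega) q u, tangent (boundary Omega) q v,
        tangent (boundary Omega) q w & vol q u v w != 0]) ->
  (forall p, boundary Omega p -> exists d, good_datum Omega vol b h p d) ->
  (forall q, boundary Omega q -> 0 <= h q) ->
  forall q, boundary Omega q -> h q = 0.
Proof.
move=> oO bO sb cM nondeg data h0 q0 Mq0.
set M := boundary Omega in cM nondeg data h0 Mq0 *.
have /choice[dat Hdat] : forall p, exists d, M p -> good_datum Omega vol b h p d.
  move=> p; have [/data[d Hd]|nM] := pselect (M p); first by exists d.
  by exists (LocalDatum set0 (fun=> 0) (fun _ _ _ => 0) 0 0).
pose rd p := ld_rad (dat p).
pose bp p : E -> R := bump p (rd p ^+ 2).
have cbp p : Ck 3 setT (bp p) := Ck_bump p _.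
(* The bumps are positive exactly on balls, finitely many of which cover M. *)
have [ps psM psC] : exists2 ps : seq E, (forall p, p \in ps -> M p) &
    forall x, M x -> exists2 p, p \in ps & 0 < bp p x.
  have cov := cM; rewrite compact_cover in cov.
  have [||D DM DC] := cov E M (fun p => [set x | 0 < bp p x]).
  - by move=> p Mp; apply: open_gt => x; exact: (Ck_cont (cbp p) (Logic.I : setT x)).
  - move=> x Mx; exists x => //=; apply: bump_gt0.
    have [_ _ _ _ [_ _ /andP[r0 _] _]] := Hdat x Mx.
    by rewrite /sqd subrr /ip big1 ?exprn_gt0// => j _; rewrite big1// => k _; rewrite mxE mul0r.
  exists D; first by move=> p pD; exact: set_mem (DM p pD).
  by move=> x /DC [p pD bx]; exists p.
have ps_good p (pp : p \in ps) := Hdat p (psM p pp).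
pose s x := \sum_(p <- ps) bp p x.
have cs : Ck 3 setT s by exact: Ck_sum openT cbp.
have s0 x : 0 <= s x by apply: sumr_ge0 => p _; exact: bump_ge0.
have sM x : M x -> 0 < s x.
  move=> Mx; have [p pp bx] := psC x Mx.
  rewrite /s (big_rem p pp) /= ltr_pwDl//; apply: sumr_ge0 => i _; exact: bump_ge0.
have [sg2 sg20 Hsg] := compact_pos_min cM (fun x _ => Ck_cont cs (Logic.I : setT x)) sM.
pose sg := sg2 / 2.
have sg0 : 0 < sg by rewrite divr_gt0.
have sgs : sg < sg2 by rewrite ltr_pdivrMr// ltr_pMr// ltr1n.
(* The denominator is s where s exceeds sg and is positive everywhere, so that
   the chi p sum to 1 near M. *)
pose den x := s x + pospart 5 (sg - s x).
have den0 x : 0 < den x.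
  have [le|gt] := leP (s x) 0.
    by rewrite ltr_wpDl//; apply: pospart_gt0; rewrite subr_gt0 (le_lt_trans le).
  by rewrite ltr_pwDl// pospart_ge0.
have cden : Ck 3 setT den.
  exact: (CkD openT cs (Ck_pospart openT (CkB openT (Ck_cst _ _ _) cs))).
pose chi p x := bp p x / den x.
have cchi p : Ck 3 setT (chi p).
  exact: (CkM openT (cbp p) (CkV openT (fun x _ => lt0r_neq0 (den0 x)) cden)).
have chi0 p x : 0 <= chi p x by rewrite divr_ge0 ?bump_ge0// ltW.
have sumchi x : \sum_(p <- ps) chi p x = s x / den x by rewrite -mulr_suml.
pose N0 : set E := [set x | sg < s x].
have oN0 : open N0 by apply: open_gt => x; exact: (Ck_cont cs (Logic.I : setT x)).
have MN0 x : M x -> N0 x by move=> Mx; exact: lt_le_trans (Hsg x Mx).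
have sum1 x : N0 x -> \sum_(p <- ps) chi p x = 1.
  move=> Nx; rewrite sumchi /den pospart_eq0 ?addr0 ?divff//.
    by rewrite gt_eqF// (lt_trans sg0 Nx).
  by rewrite subr_le0 ltW.
have sumle x : \sum_(p <- ps) chi p x <= 1.
  by rewrite sumchi ler_pdivrMr// mul1r /den lerDl pospart_ge0.
pose S p : set E := [set x | sqd p x <= rd p ^+ 2].
have cS p : closed (S p).
  apply: (@preimage_closed _ _ (sqd p) [set y | y <= rd p ^+ 2]); last exact: closed_le.
  by move=> x _; exact: (Ck_cont (Ck_sqd 0 p openT) (Logic.I : setT x)).
have chiS p x : ~ S p x -> chi p x = 0.
  move=> nS; rewrite /chi (_ : bp p x = 0) ?mul0r//; apply: bump_eq0.
  by rewrite leNgt; apply/negP => /ltW.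
pose V p := ld_dom (dat p); pose rh p := ld_rho (dat p); pose be p := ld_form (dat p).
pose si p := ld_sign (dat p).
have SV p : p \in ps -> S p `<=` V p by move=> pp x; have [_ _ _ _ [_ _ _]] := ps_good p pp; apply.
have dV p : p \in ps -> defining Omega (V p) (rh p) by move=> pp; have [] := ps_good p pp.
have oV p : p \in ps -> open (V p) by move=> pp; have [] := dV p pp.
have chiV p x : p \in ps -> chi p x != 0 -> V p x.
  by move=> pp c0; apply: (SV p pp); apply: contrapT => /chiS c1; rewrite c1 eqxx in c0.
have crh k p : p \in ps -> Ck k (V p) (rh p).
  by move=> pp; have [_ sr _ _] := dV p pp; exact: ((smooth_onP _ _).1 sr k).
(* Away from M, the locally constant sign of Omega completes the sum. *)
pose sgn x : R := if `[< Omega x >] then -1 else 1.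
pose rho x := \sum_(p <- ps) chi p x * rh p x + (1 - \sum_(p <- ps) chi p x) * sgn x.
have cc p : p \in ps -> Ck 3 setT (fun x => chi p x * rh p x).
  by move=> pp; exact: (cut_Ck (oV p pp) (cS p) (SV p pp) (cchi p) (crh 3%N p pp) (@chiS p)).
have csum (F : E -> E -> R) : (forall p, p \in ps -> Ck 3 setT (F p)) ->
    Ck 3 setT (fun x => \sum_(p <- ps) F p x).
  move=> cF; have -> : (fun x => \sum_(p <- ps) F p x) =
     (fun x => \sum_(p <- ps) (if p \in ps then F p x else 0)).
    by apply/funext => x; apply: eq_big_seq => p ->.
  apply: (Ck_sum _ openT) => p; case pp : (p \in ps); [exact: cF|exact: Ck_cst].
have csc : Ck 3 setT (fun x => \sum_(p <- ps) chi p x) by exact: Ck_sum openT cchi.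
have Mcl x : M x -> closure Omega x by case.
have cl_cases x : ~ M x -> Omega x \/ (~` closure Omega) x.
  move=> nM; have [Ox|nO] := pselect (Omega x); [by left|right => cx].
  by apply: nM; apply/(boundaryE oO).
have crho : Ck 3 setT rho.
  apply: (CkD openT (csum _ cc)); apply: Ck_local => x _.
  have [Nx|nNx] := pselect (N0 x).
    exists N0; split=> //; apply: (Ck_ext oN0 _ (Ck_cst 3 N0 0)) => y Ny.
    by rewrite sum1// subrr mul0r.
  have [Ox|nO] := cl_cases x (fun Mx => nNx (MN0 x Mx)).
    exists Omega; split=> //.
    apply: (@Ck_ext R E 3 Omega (fun x => (1 - \sum_(p <- ps) chi p x) * -1)) => //.
      by move=> y Oy; rewrite /sgn; case: asboolP.
    apply: (CkM oO) (Ck_cst 3 Omega (-1)); apply: (CkB oO (Ck_cst _ _ _)).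
    exact: (Ck_sub (@subsetT _ Omega) csc).
  have oC := open_setC (@closed_closure _ Omega).
  exists (~` closure Omega); split=> //.
  apply: (@Ck_ext R E 3 _ (fun x => (1 - \sum_(p <- ps) chi p x) * 1)) => //.
    move=> y Oy; rewrite /sgn; case: asboolP => // Oy'.
    by exfalso; apply: Oy; exact: subset_closure Oy'.
  apply: (CkM oC) (Ck_cst 3 _ 1); apply: (CkB oC (Ck_cst _ _ _)).
  exact: (Ck_sub (@subsetT _ _) csc).
have rhM p x : p \in ps -> M x -> chi p x * rh p x = 0.
  move=> pp Mx; have [->|c0] := eqVneq (chi p x) 0; first by rewrite mul0r.
  have Vx := chiV p x pp c0.
  by rewrite ((defining_zero oO (dV p pp) Vx).2 Mx) mulr0.
have rhoM x : rho x = 0 <-> M x.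
  split=> [r0|Mx]; last first.
    rewrite /rho sum1; last exact: MN0.
    by rewrite subrr mul0r addr0 big_seq big1// => p pp; exact: rhM.
  apply: contrapT => nM.
  have pos p : p \in ps -> chi p x != 0 -> 0 < chi p x * (sgn x * rh p x).
    move=> pp c0; have Vx := chiV p x pp c0.
    have cp : 0 < chi p x by rewrite lt_neqAle eq_sym c0 chi0.
    apply: mulr_gt0 => //; have [_ _ _ sgp] := dV p pp; rewrite /sgn; case: asboolP => Ox.
      by rewrite mulN1r oppr_gt0; apply/sgp.
    rewrite mul1r; apply: (defining_out oO (dV p pp) Vx) => cx.
    by apply: nM; apply/(boundaryE oO).
  have E1 : sgn x * rho x = \sum_(p <- ps) chi p x * (sgn x * rh p x) + (1 - \sum_(p <- ps) chi p x).
    rewrite /rho mulrDr mulr_sumr; congr (_ + _).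
      by apply: eq_bigr => p _; rewrite mulrCA.
    by rewrite mulrCA /sgn; case: asboolP => _; rewrite ?mulrNN !mulr1.
  have T0 p : p \in ps -> 0 <= chi p x * (sgn x * rh p x).
    move=> pp; have [->|c0] := eqVneq (chi p x) 0; first by rewrite mul0r.
    exact: ltW (pos p pp c0).
  have S0 : 0 <= \sum_(p <- ps) chi p x * (sgn x * rh p x).
    by rewrite big_seq; apply: sumr_ge0.
  move: E1; rewrite r0 mulr0 => /esym/eqP; rewrite paddr_eq0 ?subr_ge0//.
  move=> /andP[/eqP Z1 /eqP Z2].
  have [p pp c0] : exists2 p, p \in ps & chi p x != 0.
    apply: contrapT => none; move/eqP: Z2; rewrite big_seq big1 ?subr0 ?oner_eq0//.
    move=> p pp; apply/eqP; apply: contrapT => /negP c0.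
    by apply: none; exists p.
  have := pos p pp c0; apply/negP; rewrite -leNgt -Z1 (big_rem p pp) /= lerDl.
  by rewrite big_seq; apply: sumr_ge0 => i /mem_rem; exact: T0.
pose Bp p x v w := if p \in ps then si p * (chi p x * be p x v w) else 0.
pose B x v w := \sum_(p <- ps) Bp p x v w.
have cBp p v w : Ck 3 setT (fun x => Bp p x v w).
  rewrite /Bp; case pp : (p \in ps); last exact: Ck_cst.
  have [_ _ [[_ cb] _] _ _] := ps_good p pp.
  apply: (CkM openT (Ck_cst 3 setT (si p))).
  exact: (cut_Ck (oV p pp) (cS p) (SV p pp) (cchi p) (cb v w) (@chiS p)).
have cB v w : Ck 3 setT (fun x => B x v w) := Ck_sum ps openT (fun p => cBp p v w).
have aB x : alt2 (B x).
  apply: alt2_sum => p; rewrite /Bp; case pp : (p \in ps); last exact: alt2_0.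
  apply: alt2Z; have [Vx|nV] := pselect (V p x).
    by apply: alt2Z; have [_ _ [[ab _] _] _ _] := ps_good p pp; exact: ab.
  have c0 : chi p x = 0 by apply: chiS => /(SV p pp).
  rewrite (_ : (fun _ => _) = fun _ _ => 0); first exact: alt2_0.
  by apply/funext => v; apply/funext => w; rewrite c0 mul0r.
have fB : form2 setT B by split.
have dchi0 p x v : ~ S p x -> 'D_v (chi p) x = 0.
  move=> nS; rewrite (eq_on_derive (g := fun=> 0) v (open_setC (cS p)) nS) ?dC//.
  by move=> y; exact: chiS.
have dchi p x : differentiable (chi p) x by exact: (Ck_diff (cchi p) (Logic.I : setT x)).
have sdchi x v : N0 x -> \sum_(p <- ps) 'D_v (chi p) x = 0.
  move=> Nx; have [_ <-] := dsum ps v (fun p => dchi p x).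
  by rewrite (eq_on_derive (g := fun=> 1) v oN0 Nx) ?dC//.
(* Both signs compare the same volume form with normals of the same side. *)
have same_sign p p1 q : p \in ps -> p1 \in ps -> V p q -> V p1 q -> M q -> si p = si p1.
  move=> pp pp1 Vq V1q Mq; have [u [v [w [tu tv tw vn]]]] := nondeg q Mq.
  have [_ _ _ _ [s1 s2 _ _]] := ps_good p pp; have [_ _ _ _ [s1' s2' _ _]] := ps_good p1 pp1.
  have := s2 q u v w Vq Mq tu tv tw vn; have := s2' q u v w V1q Mq tu tv tw vn.
  have np := normal_parallel (defining_tangent oO (dV p pp) Vq Mq tu)
    (defining_tangent oO (dV p pp) Vq Mq tv) (defining_tangent oO (dV p pp) Vq Mq tw).
  have np1 := normal_parallel (defining_tangent oO (dV p1 pp1) V1q Mq tu)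
    (defining_tangent oO (dV p1 pp1) V1q Mq tv) (defining_tangent oO (dV p1 pp1) V1q Mq tw).
  have := defining_same_side oO (dV p pp) (dV p1 pp1) Vq V1q Mq.
  rewrite -/(rh p) -/(rh p1) -/(si p) -/(si p1) in np np1 s1 s1' *.
  set c := cross u v w in np np1 *; set k := ip c c in np np1.
  set g := gradient (rh p) q in np *; set g1 := gradient (rh p1) q in np1 *.
  move=> gg.
  have k0 : 0 <= k by exact: ip_ge0.
  have A : ip g c * ip g1 c * k = k ^+ 2 * ip g1 g.
    have := congr1 (fun z => ip z g) np1; have := congr1 (fun z => ip z c) np.
    rewrite !ipZl -/k (ipC c g) => e1 e2.
    by rewrite expr2 -[RHS]mulrA e2 [RHS]mulrC [ip g1 c * _]mulrC.
  have A0 : 0 <= ip g c * ip g1 c * k by rewrite A mulr_ge0// sqr_ge0.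
  have kpos : 0 < k \/ ip g c = 0.
    have [/eqP ki|kn] := boolP (k == 0); last by left; rewrite lt_neqAle eq_sym kn.
    by right; rewrite ipC (ip_eq0 _ ki).
  move: s1 s1' kpos A0; move: (ip g c) (ip g1 c) (vol q u v w) (si p) (si p1) => a a1 vl x y.
  clear=> s1 s1' kpos A0 h1 h2.
  case: kpos => [kp|a0]; last by rewrite a0 mulr0 mul0r ltxx in h2.
  have aa : 0 <= a * a1 by rewrite -(pmulr_lge0 _ kp).
  have := mulr_gt0 h1 h2.
  have -> : y * a1 * vl * (x * a * vl) = x * y * (a * a1 * vl ^+ 2) by ring.
  have t0 := mulr_ge0 aa (sqr_ge0 vl); move: (_ * vl ^+ 2) t0 => t t0.
  case: s1 => ->; case: s1' => ->; rewrite ?mulrNN ?mul1r ?mulN1r ?mulr1 //;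
    by rewrite oppr_gt0 ltNge t0.
pose F p x := if p \in ps then chi p x * rh p x else 0.
have cF p : Ck 3 setT (F p).
  by rewrite /F; case pp : (p \in ps); [exact: cc|exact: Ck_cst].
have gradsum q v : M q -> 'D_v rho q = \sum_(p <- ps) 'D_v (F p) q.
  move=> Mq; have [_ <-] := dsum ps v (fun p => Ck_diff (cF p) (Logic.I : setT q)).
  apply: (eq_on_derive v oN0 (MN0 q Mq)) => x Nx.
  rewrite /rho sum1// subrr mul0r addr0; apply: eq_big_seq => p pp.
  by rewrite /F pp.
have gradterm q v p : M q -> p \in ps -> V p q ->
    'D_v (F p) q = chi p q * ip (gradient (rh p) q) v.
  move=> Mq pp Vq; have -> : F p = (fun x => chi p x * rh p x) by apply/funext => x; rewrite /F pp.
  have dr : differentiable (rh p) q by exact: Ck_diff (crh 0%N p pp) Vq.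
  have r0 : rh p q = 0 by apply/(defining_zero oO (dV p pp) Vq).
  by rewrite (dM _ (dchi p q) dr) r0 mulr0 add0r derive_gradient.
have gradterm0 q v p : M q -> p \in ps -> ~ V p q -> 'D_v (F p) q = 0.
  move=> Mq pp nV; have -> : F p = (fun x => chi p x * rh p x) by apply/funext => x; rewrite /F pp.
  have nS : ~ S p q by move/(SV p pp).
  exact: (cut_derive0 _ _ (cS p) nS (@chiS p)).
have point q : M q -> forall u v w, tangent M q u -> tangent M q v -> tangent M q w ->
    exists2 sq : R, dform B q u v w = sq * (h q * vol q u v w) &
      (vol q u v w != 0 -> 0 < sq * ip (gradient rho q) (cross u v w) * vol q u v w).
  move=> Mq u v w tu tv tw.
  have [p1 pp1 bp1] := psC q Mq.
  have c1 : 0 < chi p1 q by rewrite divr_gt0.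
  have V1q : V p1 q by apply: chiV => //; rewrite gt_eqF.
  exists (si p1).
    have dBp p : differentiable (fun x => Bp p x v w) q /\ differentiable (fun x => Bp p x w u) q
        /\ differentiable (fun x => Bp p x u v) q.
      by split; [|split]; exact: (Ck_diff (cBp p _ _) (Logic.I : setT q)).
    have term p x y z : p \in ps -> tangent M q x -> tangent M q y -> tangent M q z ->
       'D_x (fun t => Bp p t y z) q = si p1 * ('D_x (chi p) q * b q y z + chi p q * 'D_x (fun t => be p t y z) q).
      move=> pp tx ty tz.
      have -> : (fun t => Bp p t y z) = (fun t => si p * (chi p t * be p t y z)).
        by apply/funext => t; rewrite /Bp pp.
      have [_ _ [[_ cb] bb] _ _] := ps_good p pp.
      have [Vq|nV] := pselect (V p q).
        have db : differentiable (fun t => be p t y z) q by exact: Ck_diff (cb y z) Vq.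
        rewrite (dM _ (diffC _ _) (diffM (dchi p q) db)) dC mul0r add0r.
        rewrite (dM _ (dchi p q) db) (same_sign p p1 q pp pp1 Vq V1q Mq).
        by rewrite -(bb q y z Vq Mq ty tz).
      have nS : ~ S p q by move/(SV p pp).
      rewrite chiS// dchi0// !mul0r addr0 mulr0.
      rewrite (eq_on_derive (g := fun=> 0) x (open_setC (cS p)) nS) ?dC//.
      by move=> t /chiS ->; rewrite mul0r mulr0.
    have sumterm x y z : tangent M q x -> tangent M q y -> tangent M q z ->
      'D_x (fun t => B t y z) q = si p1 * \sum_(p <- ps) chi p q * 'D_x (fun t => be p t y z) q.
      move=> tx ty tz.
      have [_ ->] := dsum ps x (fun p => Ck_diff (cBp p y z) (Logic.I : setT q)).
      rewrite big_seq (eq_bigr (fun p => si p1 * ('D_x (chi p) q * b q y z + chi p q * 'D_x (fun t => be p t y z) q))); last first.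
        by move=> p pp; exact: term.
      rewrite -big_seq -mulr_sumr big_split /= -mulr_suml sdchi; last exact: MN0.
      by rewrite mul0r add0r.
    rewrite /dform !sumterm// -!mulrDr; congr (_ * _).
    rewrite -!big_split /=.
    have -> : h q * vol q u v w = \sum_(p <- ps) chi p q * (h q * vol q u v w).
      by rewrite -mulr_suml sum1 ?mul1r//; exact: MN0.
    rewrite big_seq [RHS]big_seq; apply: eq_bigr => p pp; rewrite -!mulrDr.
    have [->|c0] := eqVneq (chi p q) 0; first by rewrite !mul0r.
    have [_ _ _ db _] := ps_good p pp.
    by rewrite -(db q u v w (chiV p q pp c0) Mq tu tv tw).
  move=> vn; set c := cross u v w.
  have drho : differentiable rho q by exact: (Ck_diff crho (Logic.I : setT q)).
  rewrite -derive_gradient//.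
  rewrite gradsum//.
  have term p : p \in ps -> 0 <= si p1 * 'D_c (F p) q * vol q u v w /\
      (chi p q != 0 -> 0 < si p1 * 'D_c (F p) q * vol q u v w).
    move=> pp; have [Vq|nV] := pselect (V p q); last first.
      have nS : ~ S p q by move/(SV p pp).
      rewrite (gradterm0 q c p Mq pp nV) mulr0 mul0r lexx; split=> //.
      by rewrite (chiS p q nS) eqxx.
    rewrite (gradterm q c p Mq pp Vq).
    have [_ _ _ _ [_ s2 _ _]] := ps_good p pp.
    have := s2 q u v w Vq Mq tu tv tw vn; rewrite -/(si p) (same_sign p p1 q pp pp1 Vq V1q Mq).
    have -> : si p1 * (chi p q * ip (gradient (rh p) q) c) * vol q u v w =
       chi p q * (si p1 * ip (gradient (rh p) q) c * vol q u v w) by ring.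
    move=> X; split; first exact: mulr_ge0 (chi0 p q) (ltW X).
    by move=> cn; apply: mulr_gt0 => //; rewrite lt_neqAle eq_sym cn chi0.
  rewrite mulr_sumr mulr_suml (big_rem p1 pp1) /= ltr_pwDl//.
    by apply: (term p1 pp1).2; rewrite gt_eqF.
  by rewrite big_seq; apply: sumr_ge0 => i /mem_rem ii; exact: (term i ii).1.
have [L0 L00 OL] : exists2 L : R, 0 < L & Omega `<=` box L.
  have [K [Kr HK]] := bO; exists (Num.max (K + 1) 1); first by rewrite lt_max ltr01 orbT.
  move=> x Ox j k; have xK : `|x| <= Num.max (K + 1) 1.
    have KM : K < Num.max (K + 1) 1 by rewrite lt_max ltrDl ltr01.
    exact: (HK _ KM x Ox).
  apply/ler_addgt0Pr => e e0; apply: ltW.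
  have m0 : 0 < Num.max (K + 1) 1 + e by rewrite addr_gt0// lt_max ltr01 orbT.
  by apply: (entry_norm x m0).1; apply: (le_lt_trans xK); rewrite ltrDl.
have clL : closure Omega `<=` box L0.
  move=> x cx; apply: box_closed => A nA.
  by have [y [Oy Ay]] := cx A nA; exists y; split=> //; exact: OL.
pose L' := L0 + 1.
have L'0 : 0 < L' by rewrite addr_gt0.
have ML' : M `<=` box L'.
  by move=> x /Mcl/clL xL j k; apply: (le_trans (xL j k)); rewrite lerDl.
have chiL p x : p \in ps -> ~ box L' x -> chi p x = 0.
  move=> pp nb; rewrite /chi (_ : bp p x = 0) ?mul0r//; apply: bump_eq0.
  rewrite leNgt; apply/negP => sx; apply: nb.
  have pL : box L0 p by apply: clL; exact: Mcl (psM p pp).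
  have [_ _ _ _ [_ _ /andP[r0 r1] _]] := ps_good p pp.
  apply: (box_norm pL ltr01); apply: lt_le_trans r1.
  exact: ip_lt_norm r0 sx.
have oL' : open (~` box L' : set E) by apply: open_setC; exact: box_closed.
have rout x : ~ box L' x -> forall v, 'D_v rho x = 0.
  move=> nx v; rewrite (eq_on_derive (g := fun=> 1) v oL' nx) ?dC// => y ny.
  rewrite /rho !big_seq [X in X + _]big1; last by move=> p pp; rewrite chiL// mul0r.
  rewrite big1; last by move=> p pp; rewrite chiL.
  rewrite add0r subr0 mul1r /sgn; case: asboolP => // Oy; exfalso; apply: ny => j k.
  by apply: (le_trans (OL y Oy j k)); rewrite lerDl.
pose Y j k x := hodge (dform B x) j k.
have cD u v w : Ck 2 setT (fun x => dform B x u v w).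
  exact: (CkD openT (CkD openT (CkD1 _ (cB v w)) (CkD1 _ (cB w u))) (CkD1 _ (cB u v))).
have cY j k : Ck 2 setT (Y j k).
  rewrite /Y; under eq_fun do rewrite mxE.
  by case: (j == 0); case: (k == 0); [exact: cD|exact: (CkN openT (cD _ _ _))|exact: cD|exact: (CkN openT (cD _ _ _))].
have Yout j k x : ~ box L' x -> Y j k x = 0.
  move=> nx; have d0 u v w : dform B x u v w = 0.
    have B0 s' t' z' : 'D_s' (fun y => B y t' z') x = 0.
      rewrite (eq_on_derive (g := fun=> 0) s' oL' nx) ?dC// => y ny.
      rewrite /B big_seq big1// => p pp; rewrite /Bp pp chiL// mul0r mulr0//.
    by rewrite /dform !B0 !addr0.
  by rewrite /Y mxE; case: ifP => _; case: ifP => _; rewrite d0 ?oppr0.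
have flE q u v w : M q -> tangent M q u -> tangent M q v -> tangent M q w ->
   ip (cross u v w) (cross u v w) * flux rho Y q = ip (gradient rho q) (cross u v w) * dform B q u v w.
  move=> Mq tu tv tw.
  have drho : differentiable rho q by exact: (Ck_diff crho (Logic.I : setT q)).
  have tan0 z : tangent M q z -> ip (gradient rho q) z = 0.
    move=> tz; rewrite -derive_gradient// gradsum// big_seq big1// => p pp.
    have [Vq|nV] := pselect (V p q); last exact: gradterm0.
    by rewrite gradterm// (defining_tangent oO (dV p pp) Vq Mq tz) mulr0.
  have np := normal_parallel (tan0 u tu) (tan0 v tv) (tan0 w tw).
  have -> : flux rho Y q = ip (gradient rho q) (hodge (dform B q)).
    by rewrite /flux /ip; apply: eq_bigr => j _; apply: eq_bigr => k _; rewrite mxE.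
  by rewrite -ipZl np ipZl -(dform_alt3 openT (Logic.I : setT q) fB).
have pos q : M q -> exists2 k : R, 0 < k & flux rho Y q = k * h q.
  move=> Mq; have [u [v [w [tu tv tw vn]]]] := nondeg q Mq.
  have [sq dB sp] := point q Mq u v w tu tv tw.
  have s1 := sp vn; have fe := flE q u v w Mq tu tv tw.
  set c := cross u v w in fe s1.
  have c0 : 0 < ip c c.
    apply: (@ip_neq0 R c (gradient rho q)); rewrite ipC.
    by apply: contraTneq s1 => ->; rewrite mulr0 mul0r ltxx.
  exists ((sq * ip (gradient rho q) c * vol q u v w) / ip c c); first by rewrite divr_gt0.
  apply: (mulfI (lt0r_neq0 c0)); rewrite fe dB.
  move: (ip _ c) (vol _ _ _ _) (ip c c) c0 => a vl k k0.
  by field; rewrite gt_eqF.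
have T0 := tube L'0 cM ML' crho rhoM _ rout cY Yout.
have [k k0 fk] := pos q0 Mq0.
have : flux rho Y q0 = 0.
  apply: T0 => //.
  - move=> x Mx; have [u [v [w [tu tv tw vn]]]] := nondeg x Mx.
    have [sq _ sp] := point x Mx u v w tu tv tw; have := sp vn.
    exists (cross u v w); rewrite derive_gradient; last exact: (Ck_diff crho (Logic.I : setT x)).
    by apply: contraTneq (sp vn) => ->; rewrite mulr0 mul0r ltxx.
  - by move=> x; apply: divergence_hodge.
  - by move=> x Mx; have [k' k'0 ->] := pos x Mx; rewrite mulr_ge0 ?h0// ltW.
by rewrite fk => /eqP; rewrite mulf_eq0 (gt_eqF k0) /= => /eqP.
Qed.

End StokesTheorem.

(** * Real and imaginary parts, tangential derivatives *)

Section ReIm.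
Context {R : realType}.
Local Notation Re := complex.Re.
Local Notation Im := complex.Im.
Implicit Types (z w : R[i]).

Lemma ReM z w : Re (z * w) = Re z * Re w - Im z * Im w.
Proof. by case: z => a b; case: w => c d. Qed.
Lemma ImM z w : Im (z * w) = Re z * Im w + Im z * Re w.
Proof. by case: z => a b; case: w => c d. Qed.
Lemma ReD z w : Re (z + w) = Re z + Re w.
Proof. by case: z => a b; case: w => c d. Qed.
Lemma ImD z w : Im (z + w) = Im z + Im w.
Proof. by case: z => a b; case: w => c d. Qed.
Lemma ReN z : Re (- z) = - Re z.
Proof. by case: z => a b. Qed.
Lemma ImN z : Im (- z) = - Im z.
Proof. by case: z => a b. Qed.
Lemma ReJ z : Re (z^*) = Re z.
Proof. by case: z => a b. Qed.
Lemma ImJ z : Im (z^*) = - Im z.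
Proof. by case: z => a b. Qed.
Lemma Rei : Re ('i : R[i]) = 0.
Proof. by rewrite -complexiE. Qed.
Lemma Imi : Im ('i : R[i]) = 1.
Proof. by rewrite -complexiE. Qed.
Lemma ReP (x y : R) : Re (x +i* y)%C = x.
Proof. by []. Qed.
Lemma ImP (x y : R) : Im (x +i* y)%C = y.
Proof. by []. Qed.
Lemma Re2 : Re (2 : R[i]) = 2.
Proof. by []. Qed.
Lemma Im2 : Im (2 : R[i]) = 0.
Proof. by rewrite /=  addr0. Qed.
Lemma Re2V : Re (2^-1 : R[i]) = 2^-1.
Proof.
have h : (2 : R[i]) * 2^-1 = 1 by rewrite mulfV// pnatr_eq0.
have := congr1 (@complex.Re R) h; rewrite ReM Re2 Im2 mul0r subr0 => e.
by apply: (@mulfI R 2); rewrite ?pnatr_eq0// e mulfV// pnatr_eq0.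
Qed.
Lemma Im2V : Im (2^-1 : R[i]) = 0.
Proof.
have h : (2 : R[i]) * 2^-1 = 1 by rewrite mulfV// pnatr_eq0.
have := congr1 (@complex.Im R) h; rewrite ImM Re2 Im2 mul0r addr0 => e.
by apply: (@mulfI R 2); rewrite ?pnatr_eq0// e mulr0.
Qed.
Lemma Re_sum (I : Type) (r : seq I) (F : I -> R[i]) :
  Re (\sum_(i <- r) F i) = \sum_(i <- r) Re (F i).
Proof. by elim/big_rec2: _ => // i y1 y2 _ <-; rewrite ReD. Qed.
Lemma Im_sum (I : Type) (r : seq I) (F : I -> R[i]) :
  Im (\sum_(i <- r) F i) = \sum_(i <- r) Im (F i).
Proof. by elim/big_rec2: _ => // i y1 y2 _ <-; rewrite ImD. Qed.

Definition ReImE := (ReP, ImP, ReM, ImM, ReD, ImD, ReN, ImN, ReJ, ImJ, Rei, Imi, Re2, Im2, Re2V, Im2V).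

Local Notation E := 'M[R]_2.
Implicit Types (a Z : 'M[R[i]]_2) (v : E).

Lemma pairing_ip (u v : E) : pairing u v = ip u v.
Proof. by []. Qed.

Lemma Re_pairing a Z : Re (pairing a Z) = ip (remx a) (remx Z) - ip (immx a) (immx Z).
Proof.
rewrite /pairing Re_sum /ip -sumrB; apply: eq_bigr => j _.
by rewrite Re_sum -sumrB; apply: eq_bigr => k _; rewrite ReM !mxE.
Qed.

Lemma Im_pairing a Z : Im (pairing a Z) = ip (remx a) (immx Z) + ip (immx a) (remx Z).
Proof.
rewrite /pairing Im_sum /ip -big_split; apply: eq_bigr => j _.
by rewrite Im_sum -big_split; apply: eq_bigr => k _; rewrite ImM !mxE.
Qed.

Lemma remx_cmx v : remx (cmx v) = v.
Proof. by apply/matrixP => j k; rewrite !mxE. Qed.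
Lemma immx_cmx v : immx (cmx v) = 0.
Proof. by apply/matrixP => j k; rewrite !mxE. Qed.
Lemma remx_conj Z : remx (conj_coef Z) = remx Z.
Proof. by apply/matrixP => j k; rewrite !mxE ReJ. Qed.
Lemma immx_conj Z : immx (conj_coef Z) = - immx Z.
Proof. by apply/matrixP => j k; rewrite !mxE ImJ. Qed.

Lemma ip0r (u : E) : ip u 0 = 0.
Proof. by rewrite /ip big1// => j _; rewrite big1// => k _; rewrite mxE mulr0. Qed.
Lemma ip0l (u : E) : ip 0 u = 0.
Proof. by rewrite ipC ip0r. Qed.
Lemma ipDr (u v w : E) : ip u (v + w) = ip u v + ip u w.
Proof. by rewrite ipC ipDl !(ipC u). Qed.
Lemma ipZr (k : R) (u v : E) : ip u (k *: v) = k * ip u v.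
Proof. by rewrite ipC ipZl ipC. Qed.
Lemma ipNr (u v : E) : ip u (- v) = - ip u v.
Proof. by rewrite -scaleN1r ipZr mulN1r. Qed.
Lemma ipNl (u v : E) : ip (- u) v = - ip u v.
Proof. by rewrite ipC ipNr ipC. Qed.

Lemma Re_pairing_cmx a v : Re (pairing a (cmx v)) = ip (remx a) v.
Proof. by rewrite Re_pairing remx_cmx immx_cmx ip0r subr0. Qed.
Lemma Im_pairing_cmx a v : Im (pairing a (cmx v)) = ip (immx a) v.
Proof. by rewrite Im_pairing remx_cmx immx_cmx ip0r add0r. Qed.

Definition wedge11 (a b v w : E) : R := ip a v * ip b w - ip a w * ip b v.

Lemma Re_wedge (a b : 'M[R[i]]_2) (v w : E) :
  Re (wedge a b v w) = wedge11 (remx a) (remx b) v w - wedge11 (immx a) (immx b) v w.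
Proof.
by rewrite /wedge !ReImE !Re_pairing_cmx !Im_pairing_cmx /wedge11; ring.
Qed.

Lemma Im_wedge (a b : 'M[R[i]]_2) (v w : E) :
  Im (wedge a b v w) = wedge11 (remx a) (immx b) v w + wedge11 (immx a) (remx b) v w.
Proof.
by rewrite /wedge !ReImE !Re_pairing_cmx !Im_pairing_cmx /wedge11; ring.
Qed.

End ReIm.

Section Tder.
Context {R : realType}.
Local Notation E := 'M[R]_2.
Implicit Types (M V S : set E) (p q v w : E) (f g : E -> R).

Lemma smoothD V f g : open V -> smooth_on V f -> smooth_on V g -> smooth_on V (fun x => f x + g x).
Proof.
by move=> oV sf sg; apply: (smooth_onP _ _).2 => k; apply: CkD => //; apply: (smooth_onP _ _).1.
Qed.
Lemma smoothB V f g : open V -> smooth_on V f -> smooth_on V g -> smooth_on V (fun x => f x - g x).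
Proof.
by move=> oV sf sg; apply: (smooth_onP _ _).2 => k; apply: CkB => //; apply: (smooth_onP _ _).1.
Qed.
Lemma smoothM V f g : open V -> smooth_on V f -> smooth_on V g -> smooth_on V (fun x => f x * g x).
Proof.
by move=> oV sf sg; apply: (smooth_onP _ _).2 => k; apply: CkM => //; apply: (smooth_onP _ _).1.
Qed.
Lemma smoothN V f : open V -> smooth_on V f -> smooth_on V (fun x => - f x).
Proof.
by move=> oV sf; apply: (smooth_onP _ _).2 => k; apply: CkN => //; apply: (smooth_onP _ _).1.
Qed.
Lemma smoothC V (c : R) : smooth_on V (fun _ => c).
Proof. by apply: (smooth_onP _ _).2 => k; exact: Ck_cst. Qed.
Lemma smoothV V f : open V -> (forall x, V x -> f x != 0) -> smooth_on V f ->
  smooth_on V (fun x => (f x)^-1).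
Proof.
by move=> oV f0 sf; apply: (smooth_onP _ _).2 => k; apply: CkV => //; apply: (smooth_onP _ _).1.
Qed.
Lemma smooth_sub V S f : S `<=` V -> smooth_on V f -> smooth_on S f.
Proof.
by move=> SV sf; apply: (smooth_onP _ _).2 => k; apply: (Ck_sub SV); apply: (smooth_onP _ _).1.
Qed.
Lemma smooth_ext V f g : open V -> (forall x, V x -> f x = g x) -> smooth_on V f -> smooth_on V g.
Proof.
by move=> oV fg sf; apply: (smooth_onP _ _).2 => k; apply: (Ck_ext oV fg); apply: (smooth_onP _ _).1.
Qed.
Lemma smooth_der V f v : smooth_on V f -> smooth_on V (fun x => 'D_v f x).
Proof. by move=> sf vs; exact: (sf (v :: vs)). Qed.
Lemma smooth_diff V f p : smooth_on V f -> V p -> differentiable f p.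
Proof. by move=> sf; exact: (sf [::]). Qed.
Lemma smooth_sum V (I : Type) (r : seq I) (F : I -> E -> R) : open V ->
  (forall i, smooth_on V (F i)) -> smooth_on V (fun x => \sum_(i <- r) F i x).
Proof.
move=> oV sF; apply: (smooth_onP _ _).2 => k; apply: (Ck_sum _ oV) => i.
exact: (smooth_onP _ _).1.
Qed.

Lemma tangent_eq M V f g p v : open V -> V p -> smooth_on V f -> smooth_on V g ->
  (forall q, V q -> M q -> f q = g q) -> tangent M p v -> 'D_v f p = 'D_v g p.
Proof.
move=> oV Vp sf sg fg tv; apply/eqP; rewrite -subr_eq0 -dB; [|exact: smooth_diff sf Vp|exact: smooth_diff sg Vp].
apply/eqP; apply: (tv V (fun x => f x - g x) (conj oV Vp) (smoothB oV sf sg)).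
by move=> q Vq Mq; rewrite fg// subrr.
Qed.

(** On tangent vectors the derivative does not depend on the extension that
    local_ext chooses. *)
Lemma tderE M V f g p v : open V -> V p -> smooth_on V g ->
  (forall q, V q -> M q -> g q = f q) -> tangent M p v -> tder M f p v = 'D_v g p.
Proof.
move=> oV Vp sg gf tv; rewrite /tder /local_ext.
set S := [set g0 | _]; have : S (xget f S).
  by apply: xgetPex; exists g; exists V.
move=> [W [[oW Wp] sh hf]].
apply: (@tangent_eq M (W `&` V)) => //; first exact: openI.
- exact: smooth_sub (@subIsetl _ W V) sh.
- exact: smooth_sub (@subIsetr _ W V) sg.
- by move=> q [Wq Vq] Mq; rewrite hf// gf.
Qed.

Definition smooth_mx V (X : E -> E) : Prop := forall j k, smooth_on V (fun q => X q j k).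

Lemma smooth_mx_sub V S X : S `<=` V -> smooth_mx V X -> smooth_mx S X.
Proof. by move=> SV sX j k; exact: smooth_sub SV (sX j k). Qed.

Lemma smooth_field_ext S X p : smooth_field S X -> S p ->
  exists V (Y : E -> E), [/\ open_nbhs p V, smooth_mx V Y & forall q, V q -> S q -> Y q = X q].
Proof.
move=> sX Sp.
have [V00 [g00 [[ho00 p00] s00 e00]]] := sX 0 0 p Sp.
have [V01 [g01 [[ho01 p01] s01 e01]]] := sX 0 1 p Sp.
have [V10 [g10 [[ho10 p10] s10 e10]]] := sX 1 0 p Sp.
have [V11 [g11 [[ho11 p11] s11 e11]]] := sX 1 1 p Sp.
pose V := V00 `&` V01 `&` V10 `&` V11.
exists V, (fun q => mx4 (g00 q) (g01 q) (g10 q) (g11 q)); split.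
- by split=> //; exact: (openI (openI (openI ho00 ho01) ho10) ho11).
- move=> j k; under eq_fun do rewrite mxE.
  by case: (j == 0); case: (k == 0);
   [apply: (smooth_sub _ s00)|apply: (smooth_sub _ s01)|apply: (smooth_sub _ s10)|apply: (smooth_sub _ s11)];
   by move=> q [[[A B] C] D].
- move=> q [[[q00 q01] q10] q11] Sq; rewrite [RHS]mx4_eta.
  by rewrite e00// e01// e10// e11.
Qed.

Lemma csmooth_field_ext S (X : E -> 'M[R[i]]_2) p : csmooth_field S X -> S p ->
  exists V (Y1 Y2 : E -> E), [/\ open_nbhs p V, smooth_mx V Y1, smooth_mx V Y2 &
    forall q, V q -> S q -> Y1 q = remx (X q) /\ Y2 q = immx (X q)].
Proof.
move=> sX Sp.
have s1 : smooth_field S (fun q => remx (X q)).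
  by move=> j k; have [s1 _] := sX j k; under eq_fun do rewrite mxE.
have s2 : smooth_field S (fun q => immx (X q)).
  by move=> j k; have [_ s2] := sX j k; under eq_fun do rewrite mxE.
have [V1 [Y1 [[ho1 p1] sm1 e1]]] := smooth_field_ext s1 Sp.
have [V2 [Y2 [[ho2 p2] sm2 e2]]] := smooth_field_ext s2 Sp.
exists (V1 `&` V2), Y1, Y2; split.
- by split=> //; exact: openI.
- exact: smooth_mx_sub (@subIsetl _ _ _) sm1.
- exact: smooth_mx_sub (@subIsetr _ _ _) sm2.
- by move=> q [V1q V2q] Sq; rewrite e1// e2.
Qed.

End Tder.
Arguments smoothC {R} V c.
Arguments smooth_der {R V f} v.

(** * The exterior derivative of one-forms *)

Section OneForms.
Context {R : realType}.
Local Notation E := 'M[R]_2.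
Implicit Types (M V : set E) (p q v w : E) (f g : E -> R) (al X : E -> E).

(** The exterior derivative of the one-form al, by Cartan's formula on constant
    vector fields. *)
Definition d1 al q v w : R :=
  'D_v (fun x => ip (al x) w) q - 'D_w (fun x => ip (al x) v) q.

Lemma smooth_ip V al w : open V -> smooth_mx V al -> smooth_on V (fun x => ip (al x) w).
Proof.
move=> oV sa; apply: (smooth_sum _ oV) => j; apply: (smooth_sum _ oV) => k.
exact: smoothM oV (sa j k) (smoothC V (w j k)).
Qed.

Lemma smooth_ip2 V al X : open V -> smooth_mx V al -> smooth_mx V X ->
  smooth_on V (fun x => ip (al x) (X x)).
Proof.
move=> oV sa sX; apply: (smooth_sum _ oV) => j; apply: (smooth_sum _ oV) => k.
exact: smoothM oV (sa j k) (sX j k).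
Qed.

Lemma derive_ip V al q v w : open V -> V q -> smooth_mx V al ->
  'D_v (fun x => ip (al x) w) q = \sum_j \sum_k 'D_v (fun x => al x j k) q * w j k.
Proof.
move=> oV Vq sa.
have d j k : differentiable (fun x => al x j k) q by exact: smooth_diff (sa j k) Vq.
have dm j k : differentiable (fun x => al x j k * w j k) q by exact: diffM (d j k) (diffC _ _).
have dr j := dsum (index_enum 'I_2) v (fun k => dm j k).
have [_ ->] := dsum (index_enum 'I_2) v (fun j => (dr j).1).
apply: eq_bigr => j _; rewrite (dr j).2; apply: eq_bigr => k _.
by rewrite (dM v (d j k) (diffC _ _)) dC mulr0 addr0.
Qed.

Lemma ext_dE M V (a al : E -> E) q v w : open V -> V q -> smooth_mx V al ->
  (forall x, V x -> M x -> al x = a x) -> tangent M q v -> tangent M q w ->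
  ext_d M a q v w = d1 al q v w.
Proof.
move=> oV Vq sa ea tv tw; rewrite /d1 !(derive_ip _ _ oV Vq sa) /ext_d -sumrB.
apply: eq_bigr => j _; rewrite -sumrB; apply: eq_bigr => k _.
have e x : V x -> M x -> al x j k = a x j k by move=> Vx Mx; rewrite ea.
by rewrite (tderE oV Vq (sa j k) e tv) (tderE oV Vq (sa j k) e tw).
Qed.

Definition dirder X f q : R := 'D_(X q) f q.

Lemma dirderE X f q : dirder X f q = 'D_(X q) f q.
Proof. by []. Qed.

Lemma smooth_dirder V X f : open V -> smooth_mx V X -> smooth_on V f ->
  smooth_on V (dirder X f).
Proof.
move=> oV sX sf; apply: (smooth_ext oV (f := fun q => \sum_j \sum_k X q j k * 'D_(delta_mx j k) f q)).
  by move=> x Vx; rewrite /dirder derive_coord//; exact: smooth_diff sf Vx.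
apply: (smooth_sum _ oV) => j; apply: (smooth_sum _ oV) => k.
exact: smoothM oV (sX j k) (smooth_der _ sf).
Qed.

Lemma tangentD M p v w : tangent M p v -> tangent M p w -> tangent M p (v + w).
Proof.
move=> tv tw V g oV sg g0; rewrite dlinD; last exact: smooth_diff sg oV.2.
by rewrite (tv V g oV sg g0) (tw V g oV sg g0) addr0.
Qed.

Lemma tangentZ M p (a : R) v : tangent M p v -> tangent M p (a *: v).
Proof.
move=> tv V g oV sg g0; rewrite dlinZ; last exact: smooth_diff sg oV.2.
by rewrite (tv V g oV sg g0) mulr0.
Qed.

Lemma tangentN M p v : tangent M p v -> tangent M p (- v).
Proof. by move=> tv; rewrite -scaleN1r; exact: tangentZ. Qed.

(** A one-form vanishing on the tangent spaces of a hypersurface is a multiple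
    of the differential of a defining function, so that its exterior
    derivative vanishes there too. *)
Lemma d1_pullback Omega V rho al q v w : open Omega -> defining Omega V rho -> V q ->
  boundary Omega q -> smooth_mx V al ->
  (forall x, V x -> boundary Omega x -> forall u, 'D_u rho x = 0 -> ip (al x) u = 0) ->
  tangent (boundary Omega) q v -> tangent (boundary Omega) q w ->
  d1 al q v w = 0.
Proof.
move=> oO dV Vq Mq sa al0 tv tw; have [oV sr reg _] := dV.
have [n Dn] := reg q Vq.
pose c u x := 'D_u rho x.
have sc u : smooth_on V (c u) by exact: smooth_der.
have zero u x : V x -> boundary Omega x ->
    ip (al x) u * c n x - ip (al x) n * c u x = 0.
  move=> Vx Mx; have dr : differentiable rho x by exact: smooth_diff sr Vx.
  have [n0|n0] := eqVneq (c n x) 0.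
    by rewrite n0 (al0 x Vx Mx n n0) mulr0 mul0r subrr.
  have : ip (al x) (c n x *: u + - c u x *: n) = 0.
    apply: (al0 x Vx Mx); rewrite dlinD// !dlinZ// -/(c u x) -/(c n x); ring.
  by rewrite ipDr !ipZr => <-; ring.
have Dz u y : tangent (boundary Omega) q y ->
    'D_y (fun x => ip (al x) u * c n x - ip (al x) n * c u x) q = 0.
  move=> ty; apply: (ty V _ (conj oV Vq)); last by move=> x Vx Mx; exact: zero.
  exact: (smoothB oV (smoothM oV (smooth_ip u oV sa) (sc n)) (smoothM oV (smooth_ip n oV sa) (sc u))).
have tc u : tangent (boundary Omega) q u -> c u q = 0.
  move=> tu; rewrite /c derive_gradient ?(defining_tangent oO dV)//.
  exact: smooth_diff sr Vq.
have ta u : tangent (boundary Omega) q u -> ip (al q) u = 0.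
  by move=> tu; apply: (al0 q Vq Mq); exact: tc.
have da u : differentiable (fun x => ip (al x) u) q by exact: smooth_diff (smooth_ip u oV sa) Vq.
have dc u : differentiable (c u) q by exact: smooth_diff (sc u) Vq.
have key u y : tangent (boundary Omega) q u -> tangent (boundary Omega) q y ->
    'D_y (fun x => ip (al x) u) q * c n q = ip (al q) n * 'D_y (c u) q.
  move=> tu ty; have := Dz u y ty.
  rewrite (dB _ (diffM (da u) (dc n)) (diffM (da n) (dc u))) (dM _ (da u) (dc n)) (dM _ (da n) (dc u)).
  rewrite (ta u tu) (tc u tu) mul0r mulr0 add0r addr0 => /eqP; rewrite subr_eq0 => /eqP //.
have sym : 'D_v (c w) q = 'D_w (c v) q.
  by apply: (derive_comm _ _ oV Vq); exact: (smooth_onP _ _).1.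
apply: (mulIf Dn); rewrite /d1 mul0r mulrBl -/(c n q) (key w v tw tv) (key v w tv tw) sym.
by rewrite subrr.
Qed.

End OneForms.

(** * Adapted frames in real terms *)

Section Chart.
Context {R : realType}.
Local Notation E := 'M[R]_2.
Implicit Types (M V : set E) (p q v w : E).

(** Smooth extensions, to a neighbourhood in C^2, of the objects of an adapted
    frame: Z_1 = X + i Y, theta^1 = a1 + i a2, theta_1^1 = o1 + i o2,
    A^1_1bar = t1 + i t2. *)
Record chart := Chart {
  cV : set E; cth : E -> E; cT : E -> E; cX : E -> E; cY : E -> E;
  ca1 : E -> E; ca2 : E -> E; co1 : E -> E; co2 : E -> E;
  ct1 : E -> R; ct2 : E -> R }.

Record chart_of M theta (F : @frame R) p (c : chart) : Prop := ChartOf {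
  co_open : open (cV c);
  co_p : cV c p;
  co_dom : cV c `<=` fr_dom F;
  co_sth : smooth_mx (cV c) (cth c);
  co_sT : smooth_mx (cV c) (cT c);
  co_sX : smooth_mx (cV c) (cX c);
  co_sY : smooth_mx (cV c) (cY c);
  co_sa1 : smooth_mx (cV c) (ca1 c);
  co_sa2 : smooth_mx (cV c) (ca2 c);
  co_so1 : smooth_mx (cV c) (co1 c);
  co_so2 : smooth_mx (cV c) (co2 c);
  co_st1 : smooth_on (cV c) (ct1 c);
  co_st2 : smooth_on (cV c) (ct2 c);
  co_th : forall q, cV c q -> M q -> cth c q = theta q;
  co_T : forall q, cV c q -> M q -> cT c q = fr_T F q;
  co_Z : forall q, cV c q -> M q -> cX c q = remx (fr_Z F q) /\ cY c q = immx (fr_Z F q);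
  co_a : forall q, cV c q -> M q -> ca1 c q = remx (fr_th F q) /\ ca2 c q = immx (fr_th F q);
  co_o : forall q, cV c q -> M q -> co1 c q = remx (fr_om F q) /\ co2 c q = immx (fr_om F q);
  co_t : forall q, cV c q -> M q -> ct1 c q = complex.Re (fr_tor F q) /\ ct2 c q = complex.Im (fr_tor F q) }.

Lemma exists_chart M theta F p : smooth_field M theta -> adapted_frame M theta F ->
  M p -> fr_dom F p -> exists c, chart_of M theta F p c.
Proof.
move=> sth aF Mp Dp.
have Sp : (M `&` fr_dom F) p by [].
have [V1 [th [[h1 p1] sm1 e1]]] := smooth_field_ext sth Mp.
have [V2 [T [[h2 p2] sm2 e2]]] := smooth_field_ext (af_smooth_T aF) Sp.
have [V3 [X [Y [[h3 p3] sm3 sm3' e3]]]] := csmooth_field_ext (af_smooth_Z aF) Sp.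
have [V4 [a1 [a2 [[h4 p4] sm4 sm4' e4]]]] := csmooth_field_ext (af_smooth_th aF) Sp.
have [V5 [b1 [b2 [[h5 p5] sm5 sm5' e5]]]] := csmooth_field_ext (af_smooth_om aF) Sp.
have [str sti] := af_smooth_tor aF.
have [V6 [t1 [[h6 p6] sm6 e6]]] := str p Sp.
have [V7 [t2 [[h7 p7] sm7 e7]]] := sti p Sp.
pose V := V1 `&` V2 `&` V3 `&` V4 `&` V5 `&` V6 `&` V7 `&` fr_dom F.
have sub q : V q -> [/\ [/\ V1 q, V2 q, V3 q & V4 q], V5 q, V6 q, V7 q & fr_dom F q].
  by move=> [[[[[[[]]]]]]].
have S i : V i -> M i -> (M `&` fr_dom F) i by move=> /sub[_ _ _ _ d] m.
exists (Chart V th T X Y a1 a2 b1 b2 t1 t2); split=> /=.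
- exact: (openI (openI (openI (openI (openI (openI (openI h1 h2) h3) h4) h5) h6) h7) (af_open aF)).
- by split=> //; do 6 (split=> //).
- by move=> q /sub[].
- by apply: smooth_mx_sub sm1 => q /sub[[]].
- by apply: smooth_mx_sub sm2 => q /sub[[]].
- by apply: smooth_mx_sub sm3 => q /sub[[]].
- by apply: smooth_mx_sub sm3' => q /sub[[]].
- by apply: smooth_mx_sub sm4 => q /sub[[]].
- by apply: smooth_mx_sub sm4' => q /sub[[]].
- by apply: smooth_mx_sub sm5 => q /sub[[]].
- by apply: smooth_mx_sub sm5' => q /sub[[]].
- by apply: smooth_sub sm6 => q /sub[[]].
- by apply: smooth_sub sm7 => q /sub[[]].
- by move=> q /sub[[v1 _ _ _] _ _ _ _] Mq; exact: e1.
- by move=> q Vq Mq; have [[_ v2 _ _] _ _ _ _] := sub q Vq; apply: e2 => //; exact: S.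
- by move=> q Vq Mq; have [[_ _ v3 _] _ _ _ _] := sub q Vq; apply: e3 => //; exact: S.
- by move=> q Vq Mq; have [[_ _ _ v4] _ _ _ _] := sub q Vq; apply: e4 => //; exact: S.
- by move=> q Vq Mq; have [_ v5 _ _ _] := sub q Vq; apply: e5 => //; exact: S.
- move=> q Vq Mq; have [_ _ v6 v7 _] := sub q Vq; have Sq := S q Vq Mq.
  by rewrite e6// e7.
Qed.

Section InChart.
Variables (Omega : set E) (theta : E -> E) (F : @frame R) (p0 : E) (c : chart).
Hypothesis oO : open Omega.
Local Notation M := (boundary Omega).
Hypothesis psh : pseudohermitian M theta.
Hypothesis aF : adapted_frame M theta F.
Hypothesis hc : chart_of M theta F p0 c.
Variable q : E.
Hypothesis Vq : cV c q.
Hypothesis Mq : M q.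
Local Notation V := (cV c).
Local Notation th := (cth c).
Local Notation T := (cT c).
Local Notation X := (cX c).
Local Notation Y := (cY c).
Local Notation a1 := (ca1 c).
Local Notation a2 := (ca2 c).
Local Notation o2 := (co2 c).
Local Notation t1 := (ct1 c).
Local Notation t2 := (ct2 c).
Let Dq : fr_dom F q := co_dom hc Vq.

Lemma ch_tanT : tangent M q (T q).
Proof. by rewrite (co_T hc Vq Mq); have [] := af_reeb aF Mq Dq. Qed.

Lemma ch_contact : contact_plane M q (X q) /\ contact_plane M q (Y q).
Proof.
have [-> ->] := co_Z hc Vq Mq; by have [cx cy _] := af_type10 aF Mq Dq.
Qed.

Lemma ch_tanX : tangent M q (X q).
Proof. by have [[]] := ch_contact. Qed.
Lemma ch_tanY : tangent M q (Y q).
Proof. by have [_ []] := ch_contact. Qed.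

Lemma ch_thT : ip (th q) (T q) = 1.
Proof. by rewrite (co_T hc Vq Mq) (co_th hc Vq Mq); have [_ <- _] := af_reeb aF Mq Dq. Qed.
Lemma ch_thX : ip (th q) (X q) = 0.
Proof.
have [_ _ H _] := psh; rewrite (co_th hc Vq Mq) -pairing_ip.
by apply/(H q Mq _ ch_tanX); have [] := ch_contact.
Qed.
Lemma ch_thY : ip (th q) (Y q) = 0.
Proof.
have [_ _ H _] := psh; rewrite (co_th hc Vq Mq) -pairing_ip.
by apply/(H q Mq _ ch_tanY); have [] := ch_contact.
Qed.

Lemma ch_J : Jst (X q) = - Y q /\ Jst (Y q) = X q.
Proof.
have [_ _ /matrixP J] := af_type10 aF Mq Dq.
have [-> ->] := co_Z hc Vq Mq.
have e j k := J j k.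
split; apply/matrixP => j k; have := e j k; rewrite !mxE => e'.
  have := congr1 (@complex.Re R) e'; rewrite !ReImE mul0r sub0r mul1r => <-.
  by case: ifP => _; rewrite ?ReN.
have := congr1 (@complex.Im R) e'; rewrite !ReImE mul0r add0r mul1r => <-.
by case: ifP => _; rewrite ?ImN.
Qed.

Lemma ch_a : [/\ ip (a1 q) (X q) = 2^-1, ip (a1 q) (Y q) = 0, ip (a2 q) (X q) = 0
   & ip (a2 q) (Y q) = - 2^-1] /\ ip (a1 q) (T q) = 0 /\ ip (a2 q) (T q) = 0.
Proof.
have [d1 d2 d3] := af_dual aF Mq Dq.
have [-> ->] := co_a hc Vq Mq; have [-> ->] := co_Z hc Vq Mq; rewrite (co_T hc Vq Mq).
move: (congr1 (@complex.Re R) d1) (congr1 (@complex.Im R) d1)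
  (congr1 (@complex.Re R) d2) (congr1 (@complex.Im R) d2)
  (congr1 (@complex.Re R) d3) (congr1 (@complex.Im R) d3).
rewrite !Re_pairing_cmx !Im_pairing_cmx !Re_pairing !Im_pairing /fr_Zbar.
rewrite remx_conj immx_conj !ipNr opprK.
move: (ip _ _) (ip _ _) (ip _ _) (ip _ _) (ip _ _) (ip _ _) => x1 x2 x3 x4 x5 x6.
rewrite /= => h1 h2 h3 h4 h5 h6; split; [split|split]; lra.
Qed.

Lemma ch_o1 v : tangent M q v -> ip (co1 c q) v = 0.
Proof.
by move=> tv; have [-> _] := co_o hc Vq Mq; rewrite -Re_pairing_cmx (af_imaginary aF Mq Dq tv).
Qed.

Lemma ch_dth_ext v w : tangent M q v -> tangent M q w -> ext_d M theta q v w = d1 th q v w.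
Proof. by move=> tv tw; apply: (ext_dE (co_open hc) Vq (co_sth hc) (co_th hc)). Qed.

Lemma ch_dthT v : tangent M q v -> d1 th q (T q) v = 0.
Proof.
move=> tv; rewrite -ch_dth_ext//; last exact: ch_tanT.
by rewrite (co_T hc Vq Mq); have [_ _ ->] := af_reeb aF Mq Dq.
Qed.

Lemma ch_dth v w : tangent M q v -> tangent M q w ->
  d1 th q v w = 2 * wedge11 (a1 q) (a2 q) v w.
Proof.
move=> tv tw; rewrite -ch_dth_ext//.
have := congr1 (@complex.Re R) (af_normalized aF Mq Dq tv tw).
rewrite !(Re_wedge, Im_wedge, ReImE) mul0r sub0r mul1r /fr_thbar remx_conj immx_conj => ->.
have [-> ->] := co_a hc Vq Mq; rewrite /wedge11 !ipNl; ring.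
Qed.

Lemma ch_da v w : tangent M q v -> tangent M q w ->
  d1 a1 q v w = - wedge11 (a2 q) (o2 q) v w + t1 q * wedge11 (th q) (a1 q) v w
                + t2 q * wedge11 (th q) (a2 q) v w /\
  d1 a2 q v w = wedge11 (a1 q) (o2 q) v w - t1 q * wedge11 (th q) (a2 q) v w
                + t2 q * wedge11 (th q) (a1 q) v w.
Proof.
move=> tv tw; have st := af_structure aF Mq Dq tv tw.
have e1 x : V x -> M x -> a1 x = remx (fr_th F x) by move=> Vx Mx; have [] := co_a hc Vx Mx.
have e2 x : V x -> M x -> a2 x = immx (fr_th F x) by move=> Vx Mx; have [] := co_a hc Vx Mx.
have := congr1 (@complex.Re R) st; have := congr1 (@complex.Im R) st.
rewrite /cext_d !(Re_wedge, Im_wedge, ReImE) /fr_thbar remx_conj immx_conj remx_cmx immx_cmx.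
rewrite (ext_dE (co_open hc) Vq (co_sa1 hc) e1 tv tw) (ext_dE (co_open hc) Vq (co_sa2 hc) e2 tv tw).
have [t1E t2E] := co_t hc Vq Mq; rewrite -t1E -t2E -(e1 q Vq Mq) -(e2 q Vq Mq) -(co_th hc Vq Mq).
have [wE1 wE2] := co_o hc Vq Mq; rewrite -wE1 -wE2.
rewrite /wedge11 !ip0l !ipNl !ch_o1// => -> ->.
by split; ring.
Qed.

(** A_{11,1bar} = web1 + i web2, see ch_A111. *)
Definition web1 := dirder X t1 q - dirder Y t2 q
  - 2 * (ip (o2 q) (Y q) * t1 q + ip (o2 q) (X q) * t2 q).
Definition web2 := - dirder X t2 q - dirder Y t1 q
  - 2 * (ip (o2 q) (X q) * t1 q - ip (o2 q) (Y q) * t2 q).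

Lemma ch_A111 : complex.Re (A11_1bar M F q) = web1 /\ complex.Im (A11_1bar M F q) = web2.
Proof.
have e1 x : V x -> M x -> t1 x = complex.Re (A11 F x).
  by move=> Vx Mx; have [-> _] := co_t hc Vx Mx; rewrite /A11 ReJ.
have e2 x : V x -> M x -> - t2 x = complex.Im (A11 F x).
  by move=> Vx Mx; have [_ ->] := co_t hc Vx Mx; rewrite /A11 ImJ.
have sn : smooth_on V (fun x => - t2 x) := smoothN (co_open hc) (co_st2 hc).
have [XE YE] := co_Z hc Vq Mq.
have tX := ch_tanX; have tY := ch_tanY; have tNY := tangentN ch_tanY.
rewrite /A11_1bar /vder /ctder !ReImE Re_pairing Im_pairing.
rewrite /fr_Zbar remx_conj immx_conj -XE -YE.
rewrite !(tderE (co_open hc) Vq (co_st1 hc) e1)// !(tderE (co_open hc) Vq sn e2)//.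
have [<- <-] := co_t hc Vq Mq.
have [<- <-] := co_o hc Vq Mq.
have d1' := smooth_diff (co_st1 hc) Vq; have d2' := smooth_diff (co_st2 hc) Vq.
rewrite !(dN _ d2') !(dlinN _ d1') !(dlinN _ d2') !ipNr !ch_o1//.
rewrite /web1 /web2 /dirder.
by split; ring.
Qed.

Lemma ch_do2 W v w : is_webster_curvature M theta W -> tangent M q v -> tangent M q w ->
  d1 o2 q v w = - (2 * W q * wedge11 (a1 q) (a2 q) v w)
   + 2 * (web1 * wedge11 (a2 q) (th q) v w + web2 * wedge11 (a1 q) (th q) v w).
Proof.
move=> HW tv tw; have [_ H] := HW q Mq; have st := H F aF Dq v w tv tw.
have e2 x : V x -> M x -> o2 x = immx (fr_om F x) by move=> Vx Mx; have [] := co_o hc Vx Mx.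
have := congr1 (@complex.Im R) st.
have [w1 w2] := ch_A111.
rewrite /cext_d !(w1, w2, Re_wedge, Im_wedge, ReImE) /fr_thbar remx_conj immx_conj remx_cmx immx_cmx.
rewrite (ext_dE (co_open hc) Vq (co_so2 hc) e2 tv tw).
have [<- <-] := co_a hc Vq Mq; rewrite -(co_th hc Vq Mq).
rewrite /wedge11 !ip0l !ipNl => ->.
by ring.
Qed.

End InChart.
End Chart.

Section Span.
Context {R : realType}.
Local Notation E := 'M[R]_2.
Implicit Types (M V : set E) (p q u v w : E) (al : E).

Lemma ip_delta al j k : ip al (delta_mx j k) = al j k.
Proof.
rewrite /ip (bigD1 j)//= (bigD1 k)//= big1 ?addr0.
  rewrite big1 ?addr0; first by rewrite mxE !eqxx mulr1.
  by move=> i ij; rewrite big1// => l _; rewrite mxE (negbTE ij) mulr0.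
by move=> l lk; rewrite mxE (negbTE lk) andbF mulr0.
Qed.

Lemma lin1_ip al : lin1 (ip al).
Proof. by move=> v; rewrite !ip_delta ipE; ring. Qed.

Lemma alt2_wedge11 (a b : E) : alt2 (wedge11 a b).
Proof.
move=> v w; rewrite /wedge11 !ip_delta !ipE.
move: (a _ _) (a _ _) (a _ _) (a _ _) (b _ _) (b _ _) (b _ _) (b _ _) (v _ _) (v _ _) (v _ _) (v _ _) (w _ _) (w _ _) (w _ _) (w _ _).
by clear=> *; ring.
Qed.

Lemma hodge_wedge (a b c : E) : hodge (wedge12 (ip a) (wedge11 b c)) = cross a b c.
Proof.
rewrite /hodge /cross /wedge12 /wedge11 !ip_delta /det3.
move: (a 0 0) (a 0 1) (a 1 0) (a 1 1) (b 0 0) (b 0 1) (b 1 0) (b 1 1) (c 0 0) (c 0 1) (c 1 0) (c 1 1).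
by clear=> *; congr mx4; ring.
Qed.

Lemma cross_span (T X Y : E) (a1 a2 a3 b1 b2 b3 c1 c2 c3 : R) :
  cross (a1 *: T + a2 *: X + a3 *: Y) (b1 *: T + b2 *: X + b3 *: Y)
        (c1 *: T + c2 *: X + c3 *: Y)
  = det3 a1 a2 a3 b1 b2 b3 c1 c2 c3 *: cross T X Y.
Proof.
rewrite /cross mx4Z !mxE /det3.
move: (T 0 0) (T 0 1) (T 1 0) (T 1 1) (X 0 0) (X 0 1) (X 1 0) (X 1 1) (Y 0 0) (Y 0 1) (Y 1 0) (Y 1 1).
by clear; move: a1 a2 a3 b1 b2 b3 c1 c2 c3; clear=> *; congr mx4; ring.
Qed.

(** In R^4 three independent vectors normal to g span its orthogonal complement;
    the dual covectors give the coordinates. *)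
Lemma dual_span (g T X Y th a1 a2 v : E) :
  ip g g != 0 -> ip g T = 0 -> ip g X = 0 -> ip g Y = 0 -> ip g v = 0 ->
  [/\ ip th T = 1, ip th X = 0 & ip th Y = 0] ->
  [/\ ip a1 X = 2^-1, ip a1 Y = 0, ip a2 X = 0 & ip a2 Y = - 2^-1] ->
  ip a1 T = 0 -> ip a2 T = 0 ->
  v = ip th v *: T + (2 * ip a1 v) *: X + (- (2 * ip a2 v)) *: Y.
Proof.
move=> g0 gT gX gY gv [tT tX tY] [aX aY bX bY] aT bT.
apply/eqP; rewrite -subr_eq0; apply/eqP.
set v' := v - _.
have tv' : ip v' th = 0.
  by rewrite ipC /v' ipDr ipNr !ipDr !ipZr tT tX tY; ring.
have av' : ip v' a1 = 0.
  by rewrite ipC /v' ipDr ipNr !ipDr !ipZr aT aX aY; field.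
have bv' : ip v' a2 = 0.
  by rewrite ipC /v' ipDr ipNr !ipDr !ipZr bT bX bY; field.
have gv' : ip g v' = 0.
  by rewrite /v' ipDr ipNr !ipDr !ipZr gT gX gY gv; ring.
set c := cross T X Y; set m := cross th a1 a2.
have mc : ip m c = - (4^-1).
  rewrite ipC /m -hodge_wedge /c -(alt3_wedge (lin1_ip th) (alt2_wedge11 a1 a2)).
  by rewrite /wedge12 /wedge11 tT tX tY aX aY bX bY; field.
have mc0 : ip m c != 0 by rewrite mc oppr_eq0 invr_eq0 pnatr_eq0.
have m0 := ip_neq0 mc0.
have c0 : 0 < ip c c by apply: (@ip_neq0 R c m); rewrite ipC.
have np := normal_parallel gT gX gY.
have nm := normal_parallel tv' av' bv'.
rewrite -/c in np; rewrite -/m in nm.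
have gc : ip g c != 0.
  apply/eqP => gc; have := congr1 (fun z => ip z g) np.
  rewrite !ipZl gc mul0r => /eqP; rewrite mulf_eq0 (negbTE g0) orbF.
  by rewrite gt_eqF.
have cv : ip c v' = 0.
  have := congr1 (fun z => ip z v') np; rewrite !ipZl gv' mulr0 => /esym/eqP.
  by rewrite mulf_eq0 (negbTE gc) /= => /eqP.
have vm : ip v' m = 0.
  have := congr1 (fun z => ip z c) nm; rewrite !ipZl (ipC v' c) cv mulr0 => /esym/eqP.
  by rewrite mulf_eq0 (negbTE mc0) orbF => /eqP.
move: nm; rewrite vm scale0r => /eqP; rewrite scaler_eq0 (gt_eqF m0) /=.
by move/eqP.
Qed.

(** A 3-form is determined on a 3-dimensional space by its value on a basis. *)
Lemma alt3_prop (c1 c2 : E -> E -> E -> R) (k : R) (T X Y u v w : E) (x y z : E -> R) :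
  alt3 c1 -> alt3 c2 -> c1 T X Y = k * c2 T X Y ->
  (forall s, s \in [:: u; v; w] -> s = x s *: T + y s *: X + z s *: Y) ->
  c1 u v w = k * c2 u v w.
Proof.
move=> h1 h2 e H.
have E0 (c : E -> E -> E -> R) : alt3 c -> c u v w =
    det3 (x u) (y u) (z u) (x v) (y v) (z v) (x w) (y w) (z w) * c T X Y.
  move=> h; rewrite (h u v w) (h T X Y) -ipZl -cross_span.
  by rewrite -!H// !inE eqxx ?orbT.
by rewrite (E0 _ h1) (E0 _ h2) e mulrCA.
Qed.

End Span.

Section ChartMore.
Context {R : realType}.
Local Notation E := 'M[R]_2.
Implicit Types (M V : set E) (p q v w : E).

Definition shrink (c : @chart R) V : chart :=
  Chart (cV c `&` V) (cth c) (cT c) (cX c) (cY c) (ca1 c) (ca2 c) (co1 c) (co2 c) (ct1 c) (ct2 c).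

Lemma chart_shrink M theta F p c V : open V -> V p -> chart_of M theta F p c ->
  chart_of M theta F p (shrink c V).
Proof.
move=> oV Vp h; have s := @subIsetl _ (cV c) V.
split=> /=.
- exact: openI (co_open h) oV.
- by split=> //; exact: co_p h.
- by move=> q [/(co_dom h)].
- exact: smooth_mx_sub s (co_sth h).
- exact: smooth_mx_sub s (co_sT h).
- exact: smooth_mx_sub s (co_sX h).
- exact: smooth_mx_sub s (co_sY h).
- exact: smooth_mx_sub s (co_sa1 h).
- exact: smooth_mx_sub s (co_sa2 h).
- exact: smooth_mx_sub s (co_so1 h).
- exact: smooth_mx_sub s (co_so2 h).
- exact: smooth_sub s (co_st1 h).
- exact: smooth_sub s (co_st2 h).
- by move=> q [/(co_th h)].
- by move=> q [/(co_T h)].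
- by move=> q [/(co_Z h)].
- by move=> q [/(co_a h)].
- by move=> q [/(co_o h)].
- by move=> q [/(co_t h)].
Qed.

Variables (Omega : set E) (theta : E -> E) (F : @frame R) (p0 : E) (c : @chart R).
Local Notation M := (boundary Omega).
Hypothesis psh : pseudohermitian M theta.
Hypothesis aF : adapted_frame M theta F.
Hypothesis hc : chart_of M theta F p0 c.
Variable q : E.
Hypothesis Vq : cV c q.
Hypothesis Mq : M q.

Lemma ch_span v : tangent M q v ->
  v = ip (cth c q) v *: cT c q + (2 * ip (ca1 c q) v) *: cX c q
      + (- (2 * ip (ca2 c q) v)) *: cY c q.
Proof.
move=> tv; have [sh _ _ _] := psh.
have [V [rho [[oV Vq'] sr reg sg]]] := sh q Mq.
have dr := smooth_diff sr Vq'.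
have tg u : tangent M q u -> ip (gradient rho q) u = 0.
  move=> tu; rewrite -derive_gradient//; apply: (tu V rho (conj oV Vq') sr).
  by move=> x Vx /(sg x Vx).
have [n Dn] := reg q Vq'; have g0 := gradient_neq0 dr Dn.
have [ha [aT bT]] := ch_a aF hc Vq Mq.
apply: (@dual_span R (gradient rho q)) => //.
- by rewrite gt_eqF.
- by apply: tg; exact: (ch_tanT aF hc Vq Mq).
- by apply: tg; exact: (ch_tanX aF hc Vq Mq).
- by apply: tg; exact: (ch_tanY aF hc Vq Mq).
- exact: tg.
- by split; [exact: (ch_thT aF hc Vq Mq)|exact: (ch_thX psh aF hc Vq Mq)|exact: (ch_thY psh aF hc Vq Mq)].
Qed.

Variables (f fe : E -> R).
Hypothesis sf : smooth_on (cV c) fe.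
Hypothesis ef : forall x, cV c x -> M x -> fe x = f x.
Local Notation fX := (dirder (cX c) fe).
Local Notation fY := (dirder (cY c) fe).
Local Notation x := (ip (co2 c q) (cX c q)).
Local Notation y := (ip (co2 c q) (cY c q)).

Lemma ch_cov0 : cov_0 M F f q = dirder (cT c) fe q.
Proof.
rewrite /cov_0 -(co_T hc Vq Mq); apply: (tderE (co_open hc) Vq sf ef).
exact: (ch_tanT aF hc Vq Mq).
Qed.

Lemma ch_cov1 s : cV c s -> M s ->
  complex.Re (cov_1 M F f s) = fX s /\ complex.Im (cov_1 M F f s) = fY s.
Proof.
move=> Vs Ms; rewrite /cov_1 /vder /ctder !ReImE.
have [<- <-] := co_Z hc Vs Ms.
have tX := ch_tanX aF hc Vs Ms; have tY := ch_tanY aF hc Vs Ms.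
have e0 z : cV c z -> M z -> 0 = complex.Im ((f z)%:C)%C by [].
have e1 z : cV c z -> M z -> fe z = complex.Re ((f z)%:C)%C by exact: ef.
rewrite !(tderE (co_open hc) Vs sf e1)// !(tderE (co_open hc) Vs (smoothC _ 0) e0)//.
by rewrite !dC /dirder; split; ring.
Qed.

Lemma ch_cov11 :
  complex.Re (cov_11 M F f q) = dirder (cX c) fX q - dirder (cY c) fY q + (y * fX q + x * fY q) /\
  complex.Im (cov_11 M F f q) = dirder (cX c) fY q + dirder (cY c) fX q - (x * fX q - y * fY q).
Proof.
have sX := smooth_dirder (co_open hc) (co_sX hc) sf.
have sY := smooth_dirder (co_open hc) (co_sY hc) sf.
have tX := ch_tanX aF hc Vq Mq; have tY := ch_tanY aF hc Vq Mq.
have e1 z : cV c z -> M z -> fX z = complex.Re (cov_1 M F f z) by move=> Vz Mz; have [->] := ch_cov1 Vz Mz.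
have e2 z : cV c z -> M z -> fY z = complex.Im (cov_1 M F f z) by move=> Vz Mz; have [_ ->] := ch_cov1 Vz Mz.
rewrite /cov_11 /vder /ctder; have [] := ch_cov1 Vq Mq.
move: (cov_1 M F f q) => z zr zi.
rewrite !(ReD, ImD, ReN, ImN, ReM, ImM, ReP, ImP, Rei, Imi, Re_pairing, Im_pairing) zr zi.
have [XE YE] := co_Z hc Vq Mq; have [oE oE'] := co_o hc Vq Mq.
rewrite -XE -YE -oE -oE'.
rewrite (tderE (co_open hc) Vq sX e1 tX) (tderE (co_open hc) Vq sX e1 tY).
rewrite (tderE (co_open hc) Vq sY e2 tX) (tderE (co_open hc) Vq sY e2 tY).
rewrite (ch_o1 aF hc Vq Mq tX) (ch_o1 aF hc Vq Mq tY).
move: (dirder (cX c) fe) (dirder (cY c) fe) => A B; rewrite !dirderE.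
move: ('D_(cX c q) A q) ('D_(cY c q) A q) ('D_(cX c q) B q) ('D_(cY c q) B q) (A q) (B q) => *.
by split; ring.
Qed.

Lemma ch_soliton : cov_11 M F f q + 'i * A11 F q * ((f q)%:C)%C = 0 ->
  dirder (cX c) fX q - dirder (cY c) fY q + (y * fX q + x * fY q) + ct2 c q * fe q = 0 /\
  dirder (cX c) fY q + dirder (cY c) fX q - (x * fX q - y * fY q) + ct1 c q * fe q = 0.
Proof.
have [] := ch_cov11; have [tE tE'] := co_t hc Vq Mq; move: (cov_11 M F f q) => z zr zi h.
have := congr1 (@complex.Re R) h; have := congr1 (@complex.Im R) h.
rewrite /A11 !(ReD, ImD) zr zi !ReImE -tE -tE' -(ef Vq Mq).
move: (dirder (cX c) fe) (dirder (cY c) fe) => A B.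
move: (dirder (cX c) A q) (dirder (cY c) A q) (dirder (cX c) B q) (dirder (cY c) B q) (A q) (B q).
move=> p1 p2 p3 p4 r1 r2 e1 e2.
by split; [rewrite -[RHS]e2|rewrite -[RHS]e1]; ring.
Qed.

End ChartMore.

(** * The exterior derivative of two-forms, restriction to the boundary *)

Section Calculus.
Context {R : realType}.
Local Notation E := 'M[R]_2.
Implicit Types (M V : set E) (p q u v w : E) (f g : E -> R) (al be : E -> E).

Lemma smooth_mxD V al be : open V -> smooth_mx V al -> smooth_mx V be ->
  smooth_mx V (fun x => al x + be x).
Proof.
move=> oV sa sb j k; under eq_fun do rewrite mxE.
exact: smoothD oV (sa j k) (sb j k).
Qed.

Lemma smooth_mxZ V f al : open V -> smooth_on V f -> smooth_mx V al ->
  smooth_mx V (fun x => f x *: al x).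
Proof.
move=> oV sf sa j k; under eq_fun do rewrite mxE.
exact: smoothM oV sf (sa j k).
Qed.

Lemma smooth_gradient V f : smooth_on V f -> smooth_mx V (gradient f).
Proof.
by move=> sf j k; under eq_fun do rewrite mxE; exact: smooth_der.
Qed.

Lemma d1D V al be q v w : open V -> V q -> smooth_mx V al -> smooth_mx V be ->
  d1 (fun x => al x + be x) q v w = d1 al q v w + d1 be q v w.
Proof.
move=> oV Vq sa sb; rewrite /d1.
have D z y : 'D_z (fun x => ip (al x + be x) y) q =
    'D_z (fun x => ip (al x) y) q + 'D_z (fun x => ip (be x) y) q.
  under eq_fun do rewrite ipDl.
  exact: (dD z (smooth_diff (smooth_ip y oV sa) Vq) (smooth_diff (smooth_ip y oV sb) Vq)).
by rewrite !D opprD addrACA.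
Qed.

Lemma d1Z V f al q v w : open V -> V q -> smooth_on V f -> smooth_mx V al ->
  d1 (fun x => f x *: al x) q v w =
  'D_v f q * ip (al q) w - 'D_w f q * ip (al q) v + f q * d1 al q v w.
Proof.
move=> oV Vq sf sa; rewrite /d1.
have D z y : 'D_z (fun x => ip (f x *: al x) y) q =
    'D_z f q * ip (al q) y + f q * 'D_z (fun x => ip (al x) y) q.
  under eq_fun do rewrite ipZl.
  exact: (dM z (smooth_diff sf Vq) (smooth_diff (smooth_ip y oV sa) Vq)).
rewrite !D; move: ('D_v f q) ('D_w f q) ('D_v _ q) ('D_w _ q).
by clear=> *; ring.
Qed.

Lemma smooth_comm V f q v w : open V -> V q -> smooth_on V f ->
  'D_v (fun x => 'D_w f x) q = 'D_w (fun x => 'D_v f x) q.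
Proof. by move=> oV Vq /smooth_onP sf; exact: (derive_comm v w oV Vq (sf 2)). Qed.

Lemma d1_gradient V f q v w : open V -> V q -> smooth_on V f -> d1 (gradient f) q v w = 0.
Proof.
move=> oV Vq sf; rewrite /d1.
have D z y : 'D_z (fun x => ip (gradient f x) y) q = 'D_z (fun x => 'D_y f x) q.
  apply: (eq_on_derive _ oV Vq) => x Vx; rewrite -derive_gradient//.
  exact: smooth_diff sf Vx.
by rewrite !D (smooth_comm v w oV Vq sf) subrr.
Qed.

Lemma d1_sum V al q v w : open V -> V q -> smooth_mx V al ->
  d1 al q v w = \sum_j \sum_k wedge11 (gradient (fun x => al x j k) q) (delta_mx j k) v w.
Proof.
move=> oV Vq sa; rewrite /d1 !(derive_ip _ _ oV Vq sa) -sumrB.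
apply: eq_bigr => j _; rewrite -sumrB; apply: eq_bigr => k _.
rewrite /wedge11 (ipC (delta_mx j k)) (ipC (delta_mx j k)) !ip_delta.
by rewrite -!derive_gradient//; exact: smooth_diff (sa j k) Vq.
Qed.

Lemma form2_d1 V al : open V -> smooth_mx V al -> form2 V (d1 al).
Proof.
move=> oV sa; split=> [x Vx v w|v w].
  pose F (j k : 'I_2) := wedge11 (gradient (fun y => al y j k) x) (delta_mx j k).
  have aF : alt2 (fun v w => \sum_j \sum_k F j k v w).
    apply: (@alt2_sum _ _ _ (fun j v w => \sum_k F j k v w)) => j.
    by apply: alt2_sum => k; exact: alt2_wedge11.
  have -> : d1 al x = fun v w => \sum_j \sum_k F j k v w.
    by apply/funext => v'; apply/funext => w'; exact: (d1_sum v' w' oV Vx sa).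
  exact: aF.
by apply: (smooth_onP _ _).1; exact: smoothB oV (smooth_der v (smooth_ip w oV sa)) (smooth_der w (smooth_ip v oV sa)).
Qed.

Lemma form2_wedge11 V al be : open V -> smooth_mx V al -> smooth_mx V be ->
  form2 V (fun x => wedge11 (al x) (be x)).
Proof.
move=> oV sa sb; split=> [x Vx|v w]; first exact: alt2_wedge11.
apply: (smooth_onP _ _).1.
exact: (smoothB oV (smoothM oV (smooth_ip v oV sa) (smooth_ip w oV sb))
  (smoothM oV (smooth_ip w oV sa) (smooth_ip v oV sb))).
Qed.

Lemma form2D V (B C : E -> E -> E -> R) : open V -> form2 V B -> form2 V C ->
  form2 V (fun x v w => B x v w + C x v w).
Proof.
move=> oV [aB cB] [aC cC]; split=> [x Vx|v w]; first exact: alt2D (aB x Vx) (aC x Vx).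
exact: (CkD oV (cB v w) (cC v w)).
Qed.

Lemma form2Z V f (B : E -> E -> E -> R) : open V -> smooth_on V f -> form2 V B ->
  form2 V (fun x v w => f x * B x v w).
Proof.
move=> oV sf [aB cB]; split=> [x Vx|v w]; first exact: alt2Z (f x) _ (aB x Vx).
exact: (CkM oV ((smooth_onP _ _).1 sf _) (cB v w)).
Qed.

Lemma dform_D V (B C : E -> E -> E -> R) q u v w : V q -> form2 V B -> form2 V C ->
  dform (fun x v w => B x v w + C x v w) q u v w = dform B q u v w + dform C q u v w.
Proof.
move=> Vq [_ cB] [_ cC]; rewrite /dform.
have D z v' w' := dD z (Ck_diff (cB v' w') Vq) (Ck_diff (cC v' w') Vq).
rewrite !D; move: ('D_u _ q) ('D_v _ q) ('D_w _ q) ('D_u _ q) ('D_v _ q) ('D_w _ q).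
by clear=> *; ring.
Qed.

Lemma dform_Z V f (B : E -> E -> E -> R) q u v w : V q -> smooth_on V f -> form2 V B ->
  dform (fun x v w => f x * B x v w) q u v w =
  wedge12 (fun z => 'D_z f q) (B q) u v w + f q * dform B q u v w.
Proof.
move=> Vq sf [_ cB]; rewrite /dform /wedge12.
have D z v' w' := dM z (smooth_diff sf Vq) (Ck_diff (cB v' w') Vq).
rewrite !D; move: ('D_u _ q) ('D_v _ q) ('D_w _ q) ('D_u _ q) ('D_v _ q) ('D_w _ q).
by clear=> *; ring.
Qed.

Lemma dform_d1 V al q u v w : open V -> V q -> smooth_mx V al -> dform (d1 al) q u v w = 0.
Proof.
move=> oV Vq sa; have s z := smooth_ip z oV sa.
pose P x y z := 'D_x (fun r => 'D_y (fun s => ip (al s) z) r) q.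
have D x y z : 'D_x (fun r => d1 al r y z) q = P x y z - P x z y.
  by exact: (dB x (smooth_diff (smooth_der y (s z)) Vq) (smooth_diff (smooth_der z (s y)) Vq)).
have sym x y z : P x y z = P y x z := smooth_comm x y oV Vq (s z).
rewrite /dform !D (sym v u) (sym w u) (sym w v).
by move: (P u v w) (P u w v) (P v w u) => *; ring.
Qed.

Lemma dform_wedge11 V al be q u v w : open V -> V q -> smooth_mx V al -> smooth_mx V be ->
  dform (fun x => wedge11 (al x) (be x)) q u v w =
  wedge12 (ip (be q)) (d1 al q) u v w - wedge12 (ip (al q)) (d1 be q) u v w.
Proof.
move=> oV Vq sa sb; rewrite /dform /d1 /wedge12 /wedge11.
have D x y z : 'D_x (fun r => ip (al r) y * ip (be r) z - ip (al r) z * ip (be r) y) q =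
   'D_x (fun r => ip (al r) y) q * ip (be q) z + ip (al q) y * 'D_x (fun r => ip (be r) z) q
   - ('D_x (fun r => ip (al r) z) q * ip (be q) y + ip (al q) z * 'D_x (fun r => ip (be r) y) q).
  have da z' := smooth_diff (smooth_ip z' oV sa) Vq.
  have db z' := smooth_diff (smooth_ip z' oV sb) Vq.
  by rewrite (dB x (diffM (da y) (db z)) (diffM (da z) (db y))) (dM x (da y) (db z)) (dM x (da z) (db y)).
rewrite !D.
move: ('D_u (fun r => ip (al r) v) q) ('D_u (fun r => ip (al r) w) q)
 ('D_v (fun r => ip (al r) u) q) ('D_v (fun r => ip (al r) w) q)
 ('D_w (fun r => ip (al r) u) q) ('D_w (fun r => ip (al r) v) q)
 ('D_u (fun r => ip (be r) v) q) ('D_u (fun r => ip (be r) w) q)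
 ('D_v (fun r => ip (be r) u) q) ('D_v (fun r => ip (be r) w) q)
 ('D_w (fun r => ip (be r) u) q) ('D_w (fun r => ip (be r) v) q)
 (ip (al q) u) (ip (al q) v) (ip (al q) w) (ip (be q) u) (ip (be q) v) (ip (be q) w).
by clear=> *; ring.
Qed.

End Calculus.

Section Pullback.
Context {R : realType}.
Local Notation E := 'M[R]_2.
Implicit Types (p q u v w : E).
Variables (Omega : set E) (theta : E -> E).
Local Notation M := (boundary Omega).
Hypothesis oO : open Omega.
Hypothesis sb : smooth_boundary Omega.
Hypothesis psh : pseudohermitian M theta.

(** The vectors T, X, Y span the kernel of d rho. *)
Lemma ch_kernel F p0 c V rho q u : adapted_frame M theta F -> chart_of M theta F p0 c ->
  cV c q -> M q -> defining Omega V rho -> V q -> 'D_u rho q = 0 -> tangent M q u.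
Proof.
move=> aF hc cq Mq dV Vq Du; have [oV sr reg sg] := dV.
have dr := smooth_diff sr Vq.
have [n Dn] := reg q Vq; have g0 := gradient_neq0 dr Dn.
have [ha [aT bT]] := ch_a aF hc cq Mq.
have tT := ch_tanT aF hc cq Mq; have tX := ch_tanX aF hc cq Mq; have tY := ch_tanY aF hc cq Mq.
have tt : [/\ ip (cth c q) (cT c q) = 1, ip (cth c q) (cX c q) = 0 & ip (cth c q) (cY c q) = 0].
  by split; [exact: (ch_thT aF hc cq Mq)|exact: (ch_thX psh aF hc cq Mq)|exact: (ch_thY psh aF hc cq Mq)].
have gu : ip (gradient rho q) u = 0 by rewrite -derive_gradient.
have g0' : ip (gradient rho q) (gradient rho q) != 0 by rewrite gt_eqF.
rewrite (dual_span g0' (defining_tangent oO dV Vq Mq tT) (defining_tangent oO dV Vq Mq tX)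
  (defining_tangent oO dV Vq Mq tY) gu tt ha aT bT).
exact: (tangentD (tangentD (tangentZ _ tT) (tangentZ _ tX)) (tangentZ _ tY)).
Qed.

Lemma ch_pullback F p0 c W al q v w : adapted_frame M theta F -> chart_of M theta F p0 c ->
  cV c q -> M q -> open W -> W q -> smooth_mx W al ->
  (forall x, W x -> cV c x -> M x -> forall u, tangent M x u -> ip (al x) u = 0) ->
  tangent M q v -> tangent M q w -> d1 al q v w = 0.
Proof.
move=> aF hc cq Mq oW Wq sa al0 tv tw.
have [V [rho [[oV Vq] sr reg sg]]] := sb Mq.
pose V' := V `&` W `&` cV c.
have sub x : V' x -> [/\ V x, W x & cV c x] by move=> [[]].
have dV : defining Omega V rho by [].
have dV' : defining Omega V' rho.
  split; first exact: (openI (openI oV oW) (co_open hc)).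
  - by apply: (smooth_sub _ sr) => x /sub[].
  - by move=> x /sub[Vx _ _]; exact: reg.
  - by move=> x /sub[Vx _ _]; exact: sg.
apply: (d1_pullback oO dV') => //.
- by apply: (smooth_mx_sub _ sa) => x /sub[].
- move=> x /sub[Vx Wx cx] Mx u Du; apply: al0 => //.
  exact: (ch_kernel aF hc cx Mx dV Vx Du).
Qed.

End Pullback.

(** * Change of frame *)

Section FrameChange.
Context {R : realType}.
Local Notation E := 'M[R]_2.
Implicit Types (p q u v w : E).

Lemma eq_by (a b a' b' : R) : a = b -> a' - b' = a - b -> a' = b'.
Proof. by move=> -> /eqP; rewrite subrr subr_eq0 => /eqP. Qed.

Lemma JstD (v w : E) : Jst (v + w) = Jst v + Jst w.
Proof. by apply/matrixP => j k; rewrite !mxE; case: ifP => _; rewrite ?opprD. Qed.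

Lemma JstZ (a : R) (v : E) : Jst (a *: v) = a *: Jst v.
Proof. by apply/matrixP => j k; rewrite !mxE; case: ifP => _; rewrite ?mulrN. Qed.

(** Evaluated on the pairs (X', Y'), (T, X') and (T, Y'), the structure
    equations of the two frames determine the connection form and the torsion of
    the second frame. *)
Lemma rot_algebra (A B Ax Ay Az Bx By Bz x y z t1 t2 x' y' z' s1 s2 : R) :
  A ^+ 2 + B ^+ 2 = 1 ->
  A * Ax + B * Bx = 0 -> A * Ay + B * By = 0 -> A * Az + B * Bz = 0 ->
  - (2^-1) * x' = Ax * - (B / 2) - Ay * (A / 2)
     + A * (- (- (B / 2) * y - - (A / 2) * x))
     - (Bx * - (A / 2) - By * - (B / 2)) - B * (A / 2 * y - - (B / 2) * x) ->
  2^-1 * y' = Bx * - (B / 2) - By * (A / 2)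
     + B * (- (- (B / 2) * y - - (A / 2) * x))
     + (Ax * - (A / 2) - Ay * - (B / 2)) + A * (A / 2 * y - - (B / 2) * x) ->
  2^-1 * s1 = Az * (A / 2) + A * (- (B / 2) * z + t1 * (A / 2) + t2 * - (B / 2))
     - Bz * - (B / 2) - B * (- (A / 2) * z - t1 * - (B / 2) + t2 * (A / 2)) ->
  2^-1 * (s2 - z') = Bz * (A / 2) + B * (- (B / 2) * z + t1 * (A / 2) + t2 * - (B / 2))
     + Az * - (B / 2) + A * (- (A / 2) * z - t1 * - (B / 2) + t2 * (A / 2)) ->
  - (2^-1) * (s2 + z') = Az * - (B / 2)
     + A * (- (A / 2) * z + t1 * - (B / 2) + t2 * - (A / 2))
     - Bz * - (A / 2) - B * (B / 2 * z - t1 * - (A / 2) + t2 * - (B / 2)) ->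
  [/\ x' = x - (A * Bx - B * Ax), y' = y - (A * By - B * Ay), z' = z - (A * Bz - B * Az),
     s1 = (A ^+ 2 - B ^+ 2) * t1 - 2 * A * B * t2 &
     s2 = (A ^+ 2 - B ^+ 2) * t2 + 2 * A * B * t1].
Proof.
move=> n.
have rot (a b : R) : A * a + B * b = 0 -> a = - B * (A * b - B * a) /\ b = A * (A * b - B * a).
  move=> h; split; [rewrite -[LHS]mul1r|rewrite -[LHS]mul1r]; rewrite -n.
    transitivity (A * (A * a + B * b) - B * (A * b - B * a)); first by ring.
    by rewrite h; ring.
  transitivity (B * (A * a + B * b) + A * (A * b - B * a)); first by ring.
  by rewrite h; ring.
move=> /rot[]; set px := A * Bx - B * Ax => -> ->.
move=> /rot[]; set py := A * By - B * Ay => -> ->.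
move=> /rot[]; set pz := A * Bz - B * Az => -> ->.
move: px py pz => px py pz e1 e2 e3 e4 e5; split.
- transitivity (- 2 * (- (2^-1) * x')); first by field.
  rewrite e1; transitivity ((A ^+ 2 + B ^+ 2) * (x - px)); first by field.
  by rewrite n mul1r.
- transitivity (2 * (2^-1 * y')); first by field.
  rewrite e2; transitivity ((A ^+ 2 + B ^+ 2) * (y - py)); first by field.
  by rewrite n mul1r.
- transitivity (- (2^-1 * (s2 - z')) - (- (2^-1) * (s2 + z'))); first by field.
  rewrite e4 e5; transitivity ((A ^+ 2 + B ^+ 2) * (z - pz)); first by field.
  by rewrite n mul1r.
- transitivity (2 * (2^-1 * s1)); first by field.
  by rewrite e3; field.
- transitivity ((2^-1 * (s2 - z')) - (- (2^-1) * (s2 + z'))); first by field.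
  by rewrite e4 e5; field.
Qed.

Variables (Omega : set E) (theta : E -> E) (F F' : @frame R) (p0 p0' : E) (c c' : @chart R).
Local Notation M := (boundary Omega).
Hypothesis oO : open Omega.
Hypothesis sb : smooth_boundary Omega.
Hypothesis psh : pseudohermitian M theta.
Hypothesis aF : adapted_frame M theta F.
Hypothesis aF' : adapted_frame M theta F'.
Hypothesis hc : chart_of M theta F p0 c.
Hypothesis hc' : chart_of M theta F' p0' c'.

(** The second frame is the rotation of the first one by an angle of cosine rotc
    and sine rots, see fc_XY and fc_norm. *)
Definition rotc (x : E) : R := 2 * ip (ca1 c x) (cX c' x).
Definition rots (x : E) : R := - (2 * ip (ca2 c x) (cX c' x)).

Section Pointwise.
Variable q : E.
Hypothesis Vq : cV c q.
Hypothesis Vq' : cV c' q.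
Hypothesis Mq : M q.

Lemma fc_th : cth c' q = cth c q.
Proof. by rewrite (co_th hc Vq Mq) (co_th hc' Vq' Mq). Qed.

Lemma fc_dth v w : tangent M q v -> tangent M q w ->
  wedge11 (ca1 c' q) (ca2 c' q) v w = wedge11 (ca1 c q) (ca2 c q) v w.
Proof.
move=> tv tw; apply: (@mulfI R 2); first by rewrite pnatr_eq0.
rewrite -(ch_dth aF hc Vq Mq tv tw) -(ch_dth aF' hc' Vq' Mq tv tw).
by rewrite -(ch_dth_ext hc Vq tv tw) -(ch_dth_ext hc' Vq' tv tw).
Qed.

(** The Reeb field is unique. *)
Lemma fc_T : cT c' q = cT c q.
Proof.
have tT' := ch_tanT aF' hc' Vq' Mq.
have tX := ch_tanX aF hc Vq Mq; have tY := ch_tanY aF hc Vq Mq.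
have [[aX aY bX bY] _] := ch_a aF hc Vq Mq; have [_ [aT bT]] := ch_a aF' hc' Vq' Mq.
have := ch_span psh aF hc Vq Mq tT'; rewrite -fc_th (ch_thT aF' hc' Vq' Mq) scale1r.
have := fc_dth tT' tX; have := fc_dth tT' tY.
rewrite /wedge11 aX aY bX bY aT bT !mul0r !mulr0 !subrr ?sub0r ?subr0.
move=> /esym/eqP; rewrite mulf_eq0 oppr_eq0 invr_eq0 pnatr_eq0 orbF => /eqP ->.
move=> /esym/eqP; rewrite oppr_eq0 mulf_eq0 invr_eq0 pnatr_eq0 /= => /eqP ->.
by rewrite !mulr0 oppr0 !scale0r !addr0.
Qed.

Lemma fc_XY : cX c' q = rotc q *: cX c q + rots q *: cY c q /\
  cY c' q = - rots q *: cX c q + rotc q *: cY c q.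
Proof.
have tX' := ch_tanX aF' hc' Vq' Mq.
have XE := ch_span psh aF hc Vq Mq tX'.
rewrite -fc_th (ch_thX psh aF' hc' Vq' Mq) scale0r add0r in XE.
split; first exact: XE.
have [JX JY] := ch_J aF hc Vq Mq; have [JX' _] := ch_J aF' hc' Vq' Mq.
rewrite -[LHS]opprK -JX' [in LHS]XE JstD !JstZ JX JY -/(rotc q) -/(rots q).
move: (rotc q) (rots q) (cX c q) (cY c q) => a b X Y.
by apply/matrixP => j k; rewrite !mxE; ring.
Qed.

(** Both frames are orthonormal for the Levi form, by the normalization of
    d theta. *)
Lemma fc_norm : rotc q ^+ 2 + rots q ^+ 2 = 1.
Proof.
have tX' := ch_tanX aF' hc' Vq' Mq; have tY' := ch_tanY aF' hc' Vq' Mq.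
have [[aX aY bX bY] _] := ch_a aF hc Vq Mq; have [[aX' aY' bX' bY'] _] := ch_a aF' hc' Vq' Mq.
have := fc_dth tX' tY'; rewrite /wedge11 aX' aY' bX' bY'.
have [-> ->] := fc_XY; rewrite !ipDr !ipZr aX aY bX bY.
move: (rotc q) (rots q) => a b h.
transitivity (- 4 * (2^-1 * - 2^-1 - 0 * 0) : R); last by field.
by rewrite h; field.
Qed.

Lemma fc_a v : tangent M q v ->
  ip (ca1 c' q) v = rotc q * ip (ca1 c q) v - rots q * ip (ca2 c q) v /\
  ip (ca2 c' q) v = rots q * ip (ca1 c q) v + rotc q * ip (ca2 c q) v.
Proof.
move=> tv; have [[aX aY bX bY] [aT bT]] := ch_a aF' hc' Vq' Mq.
have e := ch_span psh aF hc Vq Mq tv.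
have [XE YE] := fc_XY; have n := fc_norm.
have Xi : cX c q = rotc q *: cX c' q - rots q *: cY c' q.
  rewrite -[LHS]scale1r -n XE YE; move: (rotc q) (rots q) (cX c q) (cY c q) => a b X Y.
  by apply/matrixP => j k; rewrite !mxE; ring.
have Yi : cY c q = rots q *: cX c' q + rotc q *: cY c' q.
  rewrite -[LHS]scale1r -n XE YE; move: (rotc q) (rots q) (cX c q) (cY c q) => a b X Y.
  by apply/matrixP => j k; rewrite !mxE; ring.
rewrite {1 4}e -fc_T Xi Yi !ipDr !ipZr !ipDr !ipNr !ipZr aX aY bX bY aT bT.
by split; field.
Qed.

End Pointwise.

Let W := cV c `&` cV c'.
Let oW : open W := openI (co_open hc) (co_open hc').
Let sl : W `<=` cV c := @subIsetl _ _ _.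
Let sr : W `<=` cV c' := @subIsetr _ _ _.
Let sa1 : smooth_mx W (ca1 c) := smooth_mx_sub sl (co_sa1 hc).
Let sa2 : smooth_mx W (ca2 c) := smooth_mx_sub sl (co_sa2 hc).
Let so2 : smooth_mx W (co2 c) := smooth_mx_sub sl (co_so2 hc).
Let sa1' : smooth_mx W (ca1 c') := smooth_mx_sub sr (co_sa1 hc').
Let sa2' : smooth_mx W (ca2 c') := smooth_mx_sub sr (co_sa2 hc').
Let so2' : smooth_mx W (co2 c') := smooth_mx_sub sr (co_so2 hc').
Let sX' : smooth_mx W (cX c') := smooth_mx_sub sr (co_sX hc').

Lemma smooth_rotc : smooth_on W rotc.
Proof. exact: smoothM oW (smoothC W 2) (smooth_ip2 oW sa1 sX'). Qed.

Lemma smooth_rots : smooth_on W rots.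
Proof. exact: smoothN oW (smoothM oW (smoothC W 2) (smooth_ip2 oW sa2 sX')). Qed.

Let sC := smooth_rotc.
Let sS := smooth_rots.

Section AtPoint.
Variable q : E.
Hypothesis Wq : W q.
Hypothesis Mq : M q.
Let Vq : cV c q := sl Wq.
Let Vq' : cV c' q := sr Wq.

Lemma fc_dnorm v : tangent M q v ->
  rotc q * 'D_v rotc q + rots q * 'D_v rots q = 0.
Proof.
move=> tv; apply: (@mulfI R 2); first by rewrite pnatr_eq0.
have dC' := smooth_diff sC Wq; have dS := smooth_diff sS Wq.
have sm : smooth_on W (fun x => rotc x * rotc x + rots x * rots x).
  exact: smoothD oW (smoothM oW sC sC) (smoothM oW sS sS).
have e x : W x -> M x -> rotc x * rotc x + rots x * rots x = 1.
  by move=> [Vx Vx'] Mx; rewrite -!expr2 fc_norm.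
have := tangent_eq oW Wq sm (smoothC W 1) e tv.
rewrite dC (dD _ (diffM dC' dC') (diffM dS dS)) (dM _ dC' dC') (dM _ dS dS).
by move: ('D_v rotc q) ('D_v rots q) => a b h; rewrite mulr0 -h; ring.
Qed.

(** Differentiates the relations of fc_a along M. *)
Lemma fc_d1 v w : tangent M q v -> tangent M q w ->
  d1 (ca1 c') q v w =
    'D_v rotc q * ip (ca1 c q) w - 'D_w rotc q * ip (ca1 c q) v + rotc q * d1 (ca1 c) q v w
    - ('D_v rots q * ip (ca2 c q) w - 'D_w rots q * ip (ca2 c q) v) - rots q * d1 (ca2 c) q v w /\
  d1 (ca2 c') q v w =
    'D_v rots q * ip (ca1 c q) w - 'D_w rots q * ip (ca1 c q) v + rots q * d1 (ca1 c) q v w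
    + ('D_v rotc q * ip (ca2 c q) w - 'D_w rotc q * ip (ca2 c q) v) + rotc q * d1 (ca2 c) q v w.
Proof.
move=> tv tw.
have sNC : smooth_on W (fun x => - rotc x) := smoothN oW sC.
have sNS : smooth_on W (fun x => - rots x) := smoothN oW sS.
have dC' := smooth_diff sC Wq; have dS := smooth_diff sS Wq.
split.
  have s1 := smooth_mxZ oW sNC sa1; have s2 := smooth_mxZ oW sS sa2.
  have := ch_pullback oO sb psh aF hc Vq Mq oW Wq (smooth_mxD oW (smooth_mxD oW sa1' s1) s2).
  have H x : W x -> cV c x -> M x -> forall u, tangent M x u ->
      ip (ca1 c' x + - rotc x *: ca1 c x + rots x *: ca2 c x) u = 0.
    move=> [_ Vx'] Vx Mx u tu; have [e _] := fc_a Vx Vx' Mx tu.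
    by rewrite !ipDl !ipZl e; ring.
  move=> /(_ v w H tv tw).
  rewrite (d1D _ _ oW Wq (smooth_mxD oW sa1' s1) s2) (d1D _ _ oW Wq sa1' s1).
  rewrite (d1Z _ _ oW Wq sNC sa1) (d1Z _ _ oW Wq sS sa2) !(dN _ dC').
  move: (d1 _ _ _ _) (d1 _ _ _ _) (d1 _ _ _ _) ('D_v _ q) ('D_w _ q) ('D_v _ q) ('D_w _ q).
  by move=> z1 z2 z3 z4 z5 z6 z7 h; apply/eqP; rewrite -subr_eq0; apply/eqP; rewrite -[RHS]h; ring.
have s1 := smooth_mxZ oW sNS sa1; have s2 := smooth_mxZ oW sNC sa2.
have := ch_pullback oO sb psh aF hc Vq Mq oW Wq (smooth_mxD oW (smooth_mxD oW sa2' s1) s2).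
have H x : W x -> cV c x -> M x -> forall u, tangent M x u ->
    ip (ca2 c' x + - rots x *: ca1 c x + - rotc x *: ca2 c x) u = 0.
  move=> [_ Vx'] Vx Mx u tu; have [_ e] := fc_a Vx Vx' Mx tu.
  by rewrite !ipDl !ipZl e; ring.
move=> /(_ v w H tv tw).
rewrite (d1D _ _ oW Wq (smooth_mxD oW sa2' s1) s2) (d1D _ _ oW Wq sa2' s1).
rewrite (d1Z _ _ oW Wq sNS sa1) (d1Z _ _ oW Wq sNC sa2) !(dN _ dC') !(dN _ dS).
move: (d1 _ _ _ _) (d1 _ _ _ _) (d1 _ _ _ _) ('D_v _ q) ('D_w _ q) ('D_v _ q) ('D_w _ q).
by move=> z1 z2 z3 z4 z5 z6 z7 h; apply/eqP; rewrite -subr_eq0; apply/eqP; rewrite -[RHS]h; ring.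
Qed.

Let psi v := rotc q * 'D_v rots q - rots q * 'D_v rotc q.

Lemma fc_values :
  [/\ ip (co2 c' q) (cX c' q) = ip (co2 c q) (cX c' q) - psi (cX c' q),
      ip (co2 c' q) (cY c' q) = ip (co2 c q) (cY c' q) - psi (cY c' q),
      ip (co2 c' q) (cT c' q) = ip (co2 c q) (cT c' q) - psi (cT c' q),
      ct1 c' q = (rotc q ^+ 2 - rots q ^+ 2) * ct1 c q - 2 * rotc q * rots q * ct2 c q &
      ct2 c' q = (rotc q ^+ 2 - rots q ^+ 2) * ct2 c q + 2 * rotc q * rots q * ct1 c q].
Proof.
have tX := ch_tanX aF' hc' Vq' Mq; have tY := ch_tanY aF' hc' Vq' Mq.
have tT := ch_tanT aF' hc' Vq' Mq.
have [[aX aY bX bY] [aT bT]] := ch_a aF hc Vq Mq.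
have [[aX' aY' bX' bY'] [aT' bT']] := ch_a aF' hc' Vq' Mq.
have [XE YE] := fc_XY Vq Vq' Mq.
have pXa : ip (ca1 c q) (cX c' q) = rotc q / 2.
  by rewrite XE ipDr !ipZr aX aY; ring.
have pXb : ip (ca2 c q) (cX c' q) = - (rots q / 2).
  by rewrite XE ipDr !ipZr bX bY; ring.
have pYa : ip (ca1 c q) (cY c' q) = - (rots q / 2).
  by rewrite YE ipDr !ipZr aX aY; ring.
have pYb : ip (ca2 c q) (cY c' q) = - (rotc q / 2).
  by rewrite YE ipDr !ipZr bX bY; ring.
have pTa : ip (ca1 c q) (cT c' q) = 0 by rewrite (fc_T Vq Vq' Mq).
have pTb : ip (ca2 c q) (cT c' q) = 0 by rewrite (fc_T Vq Vq' Mq).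
have qT := ch_thT aF' hc' Vq' Mq; have qX := ch_thX psh aF' hc' Vq' Mq; have qY := ch_thY psh aF' hc' Vq' Mq.
have qE := fc_th Vq Vq' Mq.
have S v w (tv : tangent M q v) (tw : tangent M q w) : _ := (fc_d1 tv tw, ch_da aF hc Vq Mq tv tw, ch_da aF' hc' Vq' Mq tv tw).
have [[[eXY eXY'] [sXY sXY']] [rXY rXY']] := S _ _ tX tY.
have [[[eTX eTX'] [sTX sTX']] [rTX rTX']] := S _ _ tT tX.
have [[[eTY eTY'] [sTY sTY']] [rTY rTY']] := S _ _ tT tY.
clear S; rewrite rXY sXY sXY' in eXY; rewrite rXY' sXY sXY' in eXY'.
rewrite rTX sTX sTX' in eTX; rewrite rTX' sTX sTX' in eTX'.
rewrite rTY sTY sTY' in eTY.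
move: eXY eXY' eTX eTX' eTY; clear rXY rXY' sXY sXY' rTX rTX' sTX sTX' rTY rTY' sTY sTY' eTY'.
rewrite /wedge11 -qE aX' aY' bX' bY' aT' bT' pXa pXb pYa pYb pTa pTb qT qX qY.
move: (fc_norm Vq Vq' Mq) (fc_dnorm tX) (fc_dnorm tY) (fc_dnorm tT); rewrite /psi.
move: ('D_(cX c' q) rotc q) ('D_(cX c' q) rots q) ('D_(cY c' q) rotc q) ('D_(cY c' q) rots q)
  ('D_(cT c' q) rotc q) ('D_(cT c' q) rots q) => Ax Bx Ay By Az Bz.
move: (ip (co2 c q) (cX c' q)) (ip (co2 c q) (cY c' q)) (ip (co2 c q) (cT c' q))
  (ip (co2 c' q) (cX c' q)) (ip (co2 c' q) (cY c' q)) (ip (co2 c' q) (cT c' q)) => x y z x' y' z'.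
move: (rotc q) (rots q) (ct1 c q) (ct2 c q) (ct1 c' q) (ct2 c' q) => r s t1 t2 t1' t2'.
move=> n nX nY nT eXY eXY' eTX eTX' eTY; apply: (rot_algebra n nX nY nT).
- by apply: (eq_by eXY); ring.
- by apply: (eq_by eXY'); ring.
- by apply: (eq_by eTX); ring.
- by apply: (eq_by eTX'); ring.
- by apply: (eq_by eTY); ring.
Qed.

End AtPoint.

Lemma fc_o2 q v : W q -> M q -> tangent M q v ->
  ip (co2 c' q) v = ip (co2 c q) v - (rotc q * 'D_v rots q - rots q * 'D_v rotc q).
Proof.
move=> Wq Mq tv; have [eX eY eT _ _] := fc_values Wq Mq.
rewrite {1 2 3 4}(ch_span psh aF' hc' (sr Wq) Mq tv).
have dC' := smooth_diff sC Wq; have dS := smooth_diff sS Wq.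
move: (ip (cth c' q) v) (2 * ip (ca1 c' q) v) (- (2 * ip (ca2 c' q) v)) => k1 k2 k3.
rewrite !ipDr !ipZr !(dlinD _ _ dC') !(dlinD _ _ dS) !(dlinZ _ _ dC') !(dlinZ _ _ dS) eX eY eT.
move: ('D_(cX c' q) rotc q) ('D_(cX c' q) rots q) ('D_(cY c' q) rotc q) ('D_(cY c' q) rots q)
  ('D_(cT c' q) rotc q) ('D_(cT c' q) rots q) => Ax Bx Ay By Az Bz.
by move: (ip (co2 c q) (cX c' q)) (ip (co2 c q) (cY c' q)) (ip (co2 c q) (cT c' q)) (rotc q) (rots q) => *; ring.
Qed.

(** The connection form changes by the differential of the angle of rotation,
    so that its exterior derivative is the same in all frames. *)
Lemma fc_do2 q v w : W q -> M q -> tangent M q v -> tangent M q w ->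
  d1 (co2 c' ) q v w = d1 (co2 c) q v w.
Proof.
move=> Wq Mq tv tw.
have sm1 : smooth_on W (fun=> -1) := smoothC W (-1).
have sNS : smooth_on W (fun x => - rots x) := smoothN oW sS.
have s1 := smooth_mxZ oW sm1 so2.
have s2 := smooth_mxZ oW sC (smooth_gradient sS).
have s3 := smooth_mxZ oW sNS (smooth_gradient sC).
have s12 := smooth_mxD oW so2' s1; have s123 := smooth_mxD oW s12 s2.
have H x : W x -> cV c x -> M x -> forall u, tangent M x u ->
    ip (co2 c' x + -1 *: co2 c x + rotc x *: gradient rots x + - rots x *: gradient rotc x) u = 0.
  move=> Wx _ Mx u tu; have dC' := smooth_diff sC Wx; have dS := smooth_diff sS Wx.
  rewrite !ipDl !ipZl -(derive_gradient u dS) -(derive_gradient u dC') (fc_o2 Wx Mx tu).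
  by move: ('D_u rotc x) ('D_u rots x) => *; ring.
have := ch_pullback oO sb psh aF hc (sl Wq) Mq oW Wq (smooth_mxD oW s123 s3) H tv tw.
have dC' := smooth_diff sC Wq; have dS := smooth_diff sS Wq.
rewrite (d1D _ _ oW Wq s123 s3) (d1D _ _ oW Wq s12 s2) (d1D _ _ oW Wq so2' s1).
rewrite (d1Z _ _ oW Wq sm1 so2) (d1Z _ _ oW Wq sC (smooth_gradient sS)).
rewrite (d1Z _ _ oW Wq sNS (smooth_gradient sC)) !(d1_gradient _ _ oW Wq) //.
rewrite -!(derive_gradient _ dS) -!(derive_gradient _ dC') !dC !(dN _ dS).
move: (fc_norm (sl Wq) (sr Wq) Mq) (fc_dnorm Wq tv) (fc_dnorm Wq tw).
move: ('D_v rotc q) ('D_v rots q) ('D_w rotc q) ('D_w rots q) (d1 _ _ _ _) (d1 _ _ _ _).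
move: (rotc q) (rots q) => r s Av Bv Aw Bw k1 k2 n nv nw e.
(* the differential of a unit vector of R^2 has rank at most one *)
have z : Av * Bw - Aw * Bv = 0.
  rewrite -[LHS]mul1r -[X in X * _]n.
  transitivity (r * ((r * Av + s * Bv) * Bw - (r * Aw + s * Bw) * Bv)
    + s * (Av * (r * Aw + s * Bw) - Aw * (r * Av + s * Bv))); first by ring.
  by rewrite nv nw; ring.
by apply: (eq_by e); apply: (eq_by (congr1 ( *%R (-2)) z)); ring.
Qed.

Lemma fc_f (f fe fe' : E -> R) q : smooth_on (cV c) fe -> (forall x, cV c x -> M x -> fe x = f x) ->
  smooth_on (cV c') fe' -> (forall x, cV c' x -> M x -> fe' x = f x) -> W q -> M q ->
  dirder (cX c') fe' q = rotc q * dirder (cX c) fe q + rots q * dirder (cY c) fe q /\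
  dirder (cY c') fe' q = - rots q * dirder (cX c) fe q + rotc q * dirder (cY c) fe q.
Proof.
move=> sf ef sf' ef' Wq Mq.
have e x : W x -> M x -> fe' x = fe x by move=> [Vx Vx'] Mx; rewrite ef// ef'.
have D v (tv : tangent M q v) := tangent_eq oW Wq (smooth_sub sr sf') (smooth_sub sl sf) e tv.
have df := smooth_diff sf (sl Wq).
have [XE YE] := fc_XY (sl Wq) (sr Wq) Mq.
rewrite /dirder (D _ (ch_tanX aF' hc' (sr Wq) Mq)) (D _ (ch_tanY aF' hc' (sr Wq) Mq)).
by rewrite XE YE !(dlinD _ _ df) !(dlinZ _ _ df).
Qed.
End FrameChange.

(** * Stokes' theorem for forms given in frames *)

Section FrameStokes.
Context {R : realType}.
Local Notation E := 'M[R]_2.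
Implicit Types (p q u v w : E).
Variables (Omega : set E) (theta : E -> E).
Local Notation M := (boundary Omega).
Hypothesis oO : open Omega.
Hypothesis bO : bounded_set Omega.
Hypothesis sb : smooth_boundary Omega.
Hypothesis cM : compact M.
Hypothesis psh : pseudohermitian M theta.

Lemma ch_dthXY F p0 c q : adapted_frame M theta F -> chart_of M theta F p0 c ->
  cV c q -> M q -> d1 (cth c) q (cX c q) (cY c q) = - (2^-1).
Proof.
move=> aF hc Vq Mq.
rewrite (ch_dth aF hc Vq Mq (ch_tanX aF hc Vq Mq) (ch_tanY aF hc Vq Mq)) /wedge11.
by have [[-> -> -> ->] _] := ch_a aF hc Vq Mq; field.
Qed.

Lemma ch_vol F p0 c q : adapted_frame M theta F -> chart_of M theta F p0 c ->
  cV c q -> M q ->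
  wedge12 (ip (cth c q)) (d1 (cth c) q) (cT c q) (cX c q) (cY c q) = - (2^-1).
Proof.
move=> aF hc Vq Mq; rewrite /wedge12 (ch_dthXY aF hc Vq Mq).
by rewrite (ch_thT aF hc Vq Mq) (ch_thX psh aF hc Vq Mq) (ch_thY psh aF hc Vq Mq) mul1r !mul0r !addr0.
Qed.

(** Stokes' theorem on M for a 2-form given locally by a formula in the frames:
    theta /\ d theta is a volume form, with value -1/2 on (T, X, Y). *)
Theorem frame_stokes (b : E -> E -> E -> R) (h : E -> R) :
  (forall q, M q -> 0 <= h q) ->
  (forall p, M p -> exists F c B, [/\ adapted_frame M theta F, chart_of M theta F p c,
     form2 (cV c) B,
     (forall q v w, cV c q -> M q -> tangent M q v -> tangent M q w -> B q v w = b q v w)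
   & forall q, cV c q -> M q -> dform B q (cT c q) (cX c q) (cY c q) = - (h q / 2)]) ->
  forall q, M q -> h q = 0.
Proof.
move=> h0 H.
pose vol q := wedge12 (pairing (theta q)) (ext_d M theta q).
have volE F p0 c q u v w : adapted_frame M theta F -> chart_of M theta F p0 c ->
    cV c q -> M q -> tangent M q u -> tangent M q v -> tangent M q w ->
    wedge12 (ip (cth c q)) (d1 (cth c) q) u v w = vol q u v w.
  move=> aF hc Vq Mq tu tv tw; rewrite /vol /wedge12 !pairing_ip -(co_th hc Vq Mq).
  by rewrite (ch_dth_ext hc Vq tu tv) (ch_dth_ext hc Vq tv tw) (ch_dth_ext hc Vq tw tu).
have nondeg q : M q -> exists u v w,
    [/\ tangent M q u, tangent M q v, tangent M q w & vol q u v w != 0].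
  move=> Mq; have [F [c [B [aF hc _ _ _]]]] := H q Mq; have Vq := co_p hc.
  have tT := ch_tanT aF hc Vq Mq; have tX := ch_tanX aF hc Vq Mq; have tY := ch_tanY aF hc Vq Mq.
  exists (cT c q), (cX c q), (cY c q); split=> //.
  by rewrite -(volE _ _ _ _ _ _ _ aF hc Vq Mq tT tX tY) (ch_vol aF hc Vq Mq) oppr_eq0 invr_eq0 pnatr_eq0.
apply: (stokes oO bO sb cM nondeg (b := b) _ h0).
move=> p Mp; have [F [c [B [aF hc fB Bb dB]]]] := H p Mp.
have oV := co_open hc; have Vp := co_p hc; have sth := co_sth hc.
have fd := form2_d1 oV sth.
apply: (exists_good oO nondeg Mp sb).
- exists (cV c), (fun q => wedge12 (ip (cth c q)) (d1 (cth c) q)); split=> //.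
  + by move=> q Vq; exact: alt3_wedge (lin1_ip _) (fd.1 q Vq).
  + move=> u v w.
    have s x y z : Ck 3 (cV c) (fun q => ip (cth c q) x * d1 (cth c) q y z).
      exact: CkM oV ((smooth_onP _ _).1 (smooth_ip x oV sth) 3) (fd.2 y z).
    exact: Ck_cont (CkD oV (CkD oV (s u v w) (s v w u)) (s w u v)) Vp.
  + by move=> q u v w Vq Mq tu tv tw; exact: (volE _ _ _ _ _ _ _ aF hc).
- exists (cV c), B; split=> // q u v w Vq Mq tu tv tw.
  rewrite -(volE _ _ _ _ _ _ _ aF hc Vq Mq tu tv tw).
  apply: (@alt3_prop _ _ _ _ (cT c q) (cX c q) (cY c q) _ _ _ (fun s => ip (cth c q) s)
    (fun s => 2 * ip (ca1 c q) s) (fun s => - (2 * ip (ca2 c q) s))).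
  + exact: dform_alt3 oV Vq fB.
  + exact: alt3_wedge (lin1_ip _) (fd.1 q Vq).
  + by rewrite (dB q Vq Mq) (ch_vol aF hc Vq Mq) mulrN.
  + move=> s; rewrite !inE => /or3P[] /eqP ->; exact: (ch_span psh aF hc Vq Mq).
Qed.

End FrameStokes.

Section FrameValues.
Context {R : realType}.
Local Notation E := 'M[R]_2.
Variables (Omega : set E) (theta : E -> E) (F : @frame R) (p0 : E) (c : @chart R).
Local Notation M := (boundary Omega).
Hypothesis psh : pseudohermitian M theta.
Hypothesis aF : adapted_frame M theta F.
Hypothesis hc : chart_of M theta F p0 c.
Variable q : E.
Hypothesis Vq : cV c q.
Hypothesis Mq : M q.
Local Notation T := (cT c q).
Local Notation X := (cX c q).
Local Notation Y := (cY c q).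
Local Notation x := (ip (co2 c q) X).
Local Notation y := (ip (co2 c q) Y).
Local Notation z := (ip (co2 c q) T).
Let tT := ch_tanT aF hc Vq Mq.
Let tX := ch_tanX aF hc Vq Mq.
Let tY := ch_tanY aF hc Vq Mq.

Lemma ch_da_XY : d1 (ca1 c) q X Y = - (x / 2) /\ d1 (ca2 c) q X Y = y / 2.
Proof.
have [-> ->] := ch_da aF hc Vq Mq tX tY; rewrite /wedge11.
have [[-> -> -> ->] _] := ch_a aF hc Vq Mq.
by rewrite (ch_thX psh aF hc Vq Mq) (ch_thY psh aF hc Vq Mq); split; field.
Qed.

Lemma ch_da_TX : d1 (ca1 c) q T X = ct1 c q / 2 /\ d1 (ca2 c) q T X = (ct2 c q - z) / 2.
Proof.
have [-> ->] := ch_da aF hc Vq Mq tT tX; rewrite /wedge11.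
have [[-> _ -> _] [-> ->]] := ch_a aF hc Vq Mq.
by rewrite (ch_thT aF hc Vq Mq) (ch_thX psh aF hc Vq Mq); split; field.
Qed.

Lemma ch_da_TY : d1 (ca1 c) q T Y = - ((z + ct2 c q) / 2) /\ d1 (ca2 c) q T Y = ct1 c q / 2.
Proof.
have [-> ->] := ch_da aF hc Vq Mq tT tY; rewrite /wedge11.
have [[_ -> _ ->] [-> ->]] := ch_a aF hc Vq Mq.
by rewrite (ch_thT aF hc Vq Mq) (ch_thY psh aF hc Vq Mq); split; field.
Qed.

Lemma ch_do2_values (W : E -> R) : is_webster_curvature M theta W ->
  [/\ d1 (co2 c) q X Y = W q / 2, d1 (co2 c) q Y T = - web1 c q &
      d1 (co2 c) q T X = - web2 c q].
Proof.
move=> HW; rewrite !(ch_do2 aF hc Vq Mq HW)// /wedge11.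
have [[-> -> -> ->] [-> ->]] := ch_a aF hc Vq Mq.
rewrite (ch_thT aF hc Vq Mq) (ch_thX psh aF hc Vq Mq) (ch_thY psh aF hc Vq Mq).
by split; field.
Qed.

End FrameValues.

(** * Constancy of the curvature *)

Section Curvature.
Context {R : realType}.
Local Notation E := 'M[R]_2.
Implicit Types (p q u v w : E) (c : @chart R) (fe : E -> R).

Definition solP c fe x : R := dirder (cX c) fe x * ct1 c x - dirder (cY c) fe x * ct2 c x.
Definition solQ c fe x : R := - (dirder (cX c) fe x * ct2 c x + dirder (cY c) fe x * ct1 c x).
Definition sol_lam c fe x : E := solP c fe x *: ca2 c x + solQ c fe x *: ca1 c x.

(** By Webster's equation its restriction to M is
    f (mu - W) d theta + 2 Im ((f A_{11,1bar} - f_1bar A_11) theta^1) /\ theta.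
    In the present shape no second derivative of the torsion occurs in its
    differential, and no derivative of the torsion when it is compared in two
    frames. *)
Definition sol_form (mu : R) c fe x v w : R :=
  fe x * (d1 (co2 c) x v w + mu * d1 (cth c) x v w)
  + (- 2) * wedge11 (sol_lam c fe x) (cth c x) v w.

Variables (Omega : set E) (theta : E -> E).
Local Notation M := (boundary Omega).
Hypothesis oO : open Omega.
Hypothesis sb : smooth_boundary Omega.
Hypothesis psh : pseudohermitian M theta.

Section InChart.
Variables (F : @frame R) (p0 : E) (c : @chart R) (f fe : E -> R) (mu : R).
Hypothesis aF : adapted_frame M theta F.
Hypothesis hc : chart_of M theta F p0 c.
Hypothesis sf : smooth_on (cV c) fe.
Let oV := co_open hc.
Let sfX : smooth_on (cV c) (dirder (cX c) fe) := smooth_dirder oV (co_sX hc) sf.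
Let sfY : smooth_on (cV c) (dirder (cY c) fe) := smooth_dirder oV (co_sY hc) sf.
Let sP : smooth_on (cV c) (solP c fe) :=
  smoothB oV (smoothM oV sfX (co_st1 hc)) (smoothM oV sfY (co_st2 hc)).
Let sQ : smooth_on (cV c) (solQ c fe) :=
  smoothN oV (smoothD oV (smoothM oV sfX (co_st2 hc)) (smoothM oV sfY (co_st1 hc))).
Let sl1 := smooth_mxZ oV sP (co_sa2 hc).
Let sl2 := smooth_mxZ oV sQ (co_sa1 hc).
Let slam : smooth_mx (cV c) (sol_lam c fe) := smooth_mxD oV sl1 sl2.
Let smu : smooth_on (cV c) (fun=> mu) := smoothC (cV c) mu.
Let s2 : smooth_on (cV c) (fun=> - 2) := smoothC (cV c) (- 2).
Let fo := form2_d1 oV (co_so2 hc).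
Let ft := form2_d1 oV (co_sth hc).
Let fm := form2Z oV smu ft.
Let fC := form2D oV fo fm.
Let fw := form2_wedge11 oV slam (co_sth hc).

Lemma sol_form_form2 : form2 (cV c) (sol_form mu c fe).
Proof. exact: form2D oV (form2Z oV sf fC) (form2Z oV s2 fw). Qed.

(** Apart from f_0 (mu - W), the differential is a combination of the real and
    imaginary parts of f_11 + i A_11 f = 0, with the torsion as coefficients. *)
Lemma dform_sol_form q (W : E -> R) : cV c q -> M q -> is_webster_curvature M theta W ->
  (forall x, cV c x -> M x -> fe x = f x) ->
  W q + 2^-1 * cov_0 M F f q = mu ->
  cov_11 M F f q + 'i * A11 F q * ((f q)%:C)%C = 0 ->
  dform (sol_form mu c fe) q (cT c q) (cX c q) (cY c q) = - (mu - W q) ^+ 2.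
Proof.
move=> Vq Mq HW ef sol0 sol1.
have f0 : dirder (cT c) fe q = 2 * (mu - W q).
  rewrite -sol0 (ch_cov0 aF hc Vq Mq sf ef); by move: (dirder _ _ _) (W q) => a b; field.
have [s1' s2'] := ch_soliton aF hc Vq Mq sf ef sol1.
have [oXY oYT oTX] := ch_do2_values psh aF hc Vq Mq HW.
have [a1XY a2XY] := ch_da_XY psh aF hc Vq Mq.
have [[aX aY bX bY] [aT bT]] := ch_a aF hc Vq Mq.
have tX := ch_tanX aF hc Vq Mq; have tY := ch_tanY aF hc Vq Mq.
have thYT : d1 (cth c) q (cY c q) (cT c q) = 0.
  by rewrite /d1 -opprB -/(d1 _ _ _ _) (ch_dthT aF hc Vq Mq tY) oppr0.
have thTX := ch_dthT aF hc Vq Mq tX.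
have thXY := ch_dthXY aF hc Vq Mq.
have lT : ip (sol_lam c fe q) (cT c q) = 0.
  by rewrite /sol_lam ipDl !ipZl aT bT !mulr0 addr0.
have dsX := smooth_diff sfX Vq; have dsY := smooth_diff sfY Vq.
have dt1 := smooth_diff (co_st1 hc) Vq; have dt2 := smooth_diff (co_st2 hc) Vq.
have dP v : 'D_v (solP c fe) q = 'D_v (dirder (cX c) fe) q * ct1 c q + dirder (cX c) fe q * 'D_v (ct1 c) q
   - ('D_v (dirder (cY c) fe) q * ct2 c q + dirder (cY c) fe q * 'D_v (ct2 c) q).
  by rewrite (dB _ (diffM dsX dt1) (diffM dsY dt2)) (dM _ dsX dt1) (dM _ dsY dt2).
have dQ v : 'D_v (solQ c fe) q = - ('D_v (dirder (cX c) fe) q * ct2 c q + dirder (cX c) fe q * 'D_v (ct2 c) q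
   + ('D_v (dirder (cY c) fe) q * ct1 c q + dirder (cY c) fe q * 'D_v (ct1 c) q)).
  rewrite (dN _ (diffD (diffM dsX dt2) (diffM dsY dt1))) (dD _ (diffM dsX dt2) (diffM dsY dt1)).
  by rewrite (dM _ dsX dt2) (dM _ dsY dt1).
have lXY : d1 (sol_lam c fe) q (cX c q) (cY c q) =
   - 2^-1 * ('D_(cX c q) (solP c fe) q + 'D_(cY c q) (solQ c fe) q)
   + solP c fe q * (ip (co2 c q) (cY c q) / 2) - solQ c fe q * (ip (co2 c q) (cX c q) / 2).
  rewrite (d1D _ _ oV Vq sl1 sl2) (d1Z _ _ oV Vq sP (co_sa2 hc)) (d1Z _ _ oV Vq sQ (co_sa1 hc)).
  rewrite aX aY bX bY a1XY a2XY.
  by move: ('D_(cX c q) (solP c fe) q) ('D_(cY c q) (solQ c fe) q) (solP c fe q) (solQ c fe q) => *; ring.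
apply: (etrans (dform_D _ _ _ Vq (form2Z oV sf fC) (form2Z oV s2 fw))).
rewrite (dform_Z _ _ _ Vq sf fC) (dform_Z _ _ _ Vq s2 fw).
rewrite (dform_D _ _ _ Vq fo fm) (dform_Z _ _ _ Vq smu ft).
rewrite !(dform_d1 _ _ _ oV Vq) ?(dform_wedge11 _ _ _ oV Vq slam (co_sth hc)); last 2 first.
- exact: co_sth hc.
- exact: co_so2 hc.
rewrite /wedge12 !dC (ch_thT aF hc Vq Mq) (ch_thX psh aF hc Vq Mq) (ch_thY psh aF hc Vq Mq).
rewrite lT lXY oXY oYT oTX thXY thYT thTX -/(dirder (cT c) fe q) -/(dirder (cX c) fe q) -/(dirder (cY c) fe q).
rewrite f0 dP dQ /web1 /web2 /solP /solQ.
move: s1' s2'; move: (dirder (cX c) fe) (dirder (cY c) fe) => A B; rewrite !dirderE.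
move: (ct1 c) (ct2 c) => t1' t2'.
move: ('D_(cX c q) A q) ('D_(cY c q) A q) ('D_(cX c q) B q) ('D_(cY c q) B q)
  ('D_(cX c q) t1' q) ('D_(cX c q) t2' q) ('D_(cY c q) t1' q) ('D_(cY c q) t2' q).
move: (A q) (B q) => fX fY fXX fYX fXY fYY Xt1 Xt2 Yt1 Yt2.
move: (ip (co2 c q) (cX c q)) (ip (co2 c q) (cY c q)) (t1' q) (t2' q) (fe q) (W q) => x y t1 t2 g k e1 e2.
have e : t1 * (fXX - fYY + (y * fX + x * fY) + t2 * g)
  - t2 * (fXY + fYX - (x * fX - y * fY) + t1 * g) = 0 by rewrite e1 e2 !mulr0 subrr.
rewrite !mul0r !mulr0; by apply: (eq_by e); field.
Qed.

End InChart.

Definition gauge (f : E -> R) p (F : @frame R) c fe : Prop :=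
  [/\ adapted_frame M theta F, chart_of M theta F p c, smooth_on (cV c) fe
    & forall x, cV c x -> M x -> fe x = f x].

Lemma exists_gauge (W f : E -> R) p : is_webster_curvature M theta W ->
  (exists V fe, [/\ open_nbhs p V, smooth_on V fe & forall x, V x -> M x -> fe x = f x]) ->
  M p -> exists (F : @frame R) c fe, gauge f p F c fe.
Proof.
move=> HW [V [fe [[oV Vp] sf ef]]] Mp.
have [[F aF Fp] _] := HW p Mp.
have [_ [sth _] _ _] := psh.
have [c hc] := exists_chart sth aF Mp Fp.
exists F, (shrink c V), fe; split=> //.
- exact: chart_shrink.
- exact: smooth_sub (@subIsetr _ _ _) sf.
- by move=> x [_ Vx]; exact: ef.
Qed.

Lemma sol_form_gauge f p p' F F' c c' fe fe' mu q v w :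
  gauge f p F c fe -> gauge f p' F' c' fe' -> cV c q -> cV c' q -> M q ->
  tangent M q v -> tangent M q w ->
  sol_form mu c' fe' q v w = sol_form mu c fe q v w.
Proof.
move=> [aF hc sf ef] [aF' hc' sf' ef'] Vq Vq' Mq tv tw.
have Wq : (cV c `&` cV c') q by [].
have lam s : tangent M q s -> ip (sol_lam c' fe' q) s = ip (sol_lam c fe q) s.
  move=> ts; rewrite /sol_lam !ipDl !ipZl /solP /solQ.
  have [-> ->] := fc_f psh aF aF' hc hc' sf ef sf' ef' Wq Mq.
  have [_ _ _ -> ->] := fc_values oO sb psh aF aF' hc hc' Wq Mq.
  have [-> ->] := fc_a psh aF aF' hc hc' Vq Vq' Mq ts.
  move: (fc_norm psh aF aF' hc hc' Vq Vq' Mq).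
  move: (rotc c c' q) (rots c c' q) (dirder _ _ _) (dirder _ _ _) (ct1 c q) (ct2 c q) (ip _ _) (ip _ _).
  move=> A B fY fX t1 t2 b a n.
  transitivity ((A ^+ 2 + B ^+ 2) ^+ 2 * ((fX * t1 - fY * t2) * b - (fX * t2 + fY * t1) * a)); first by ring.
  by rewrite n; ring.
rewrite /sol_form /wedge11 !lam// (fc_do2 oO sb psh aF aF' hc hc' Wq Mq tv tw).
rewrite (fc_th hc hc' Vq Vq' Mq) -(ch_dth_ext hc Vq tv tw) -(ch_dth_ext hc' Vq' tv tw).
by rewrite ef// ef'.
Qed.

Hypothesis bO : bounded_set Omega.
Hypothesis cM : compact M.

(** The form sol_form has the differential 2 (mu - W)^2 theta /\ d theta, since
    f_0 = 2 (mu - W). *)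
Theorem soliton_curvature (f W : E -> R) (mu : R) : smooth_along M f ->
  is_webster_curvature M theta W ->
  (forall F : @frame R, adapted_frame M theta F -> forall p, M p -> fr_dom F p ->
    W p + 2^-1 * cov_0 M F f p = mu /\
    cov_11 M F f p + 'i * A11 F p * ((f p)%:C)%C = 0) ->
  forall p, M p -> W p = mu.
Proof.
move=> sf HW sol p Mp.
have /choice[G HG] : forall q, exists g : @frame R * @chart R * (E -> R), M q -> gauge f q g.1.1 g.1.2 g.2.
  move=> q; have [Mq|nM] := pselect (M q); last first.
    by exists (Frame set0 (fun=> 0) (fun=> 0) (fun=> 0) (fun=> 0) (fun=> 0),
      Chart set0 (fun=> 0) (fun=> 0) (fun=> 0) (fun=> 0) (fun=> 0) (fun=> 0) (fun=> 0) (fun=> 0) (fun=> 0) (fun=> 0), fun=> 0).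
  by have [F [c [fe g]]] := exists_gauge HW (sf q Mq) Mq; exists (F, c, fe).
pose b q := sol_form mu (G q).1.2 (G q).2 q.
have h0 q : M q -> 0 <= 2 * (mu - W q) ^+ 2 by move=> _; rewrite mulr_ge0// sqr_ge0.
have := @frame_stokes R Omega theta oO bO sb cM psh b (fun q => 2 * (mu - W q) ^+ 2) h0 _ p Mp.
move=> /(_ _)/eqP; rewrite mulf_eq0 pnatr_eq0 /= sqrf_eq0 subr_eq0 => H.
apply/esym/eqP/H => q Mq; have [F [c [fe g]]] := exists_gauge HW (sf q Mq) Mq.
have [aF hc sfe efe] := g.
exists F, c, (sol_form mu c fe); split=> //.
- exact: sol_form_form2 hc sfe.
- move=> x v w Vx Mx tv tw; have gx := HG x Mx; have [_ hx _ _] := gx.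
  exact: sol_form_gauge gx g (co_p hx) Vx Mx tv tw.
- move=> x Vx Mx; have [s0 s1] := sol F aF x Mx (co_dom hc Vx).
  by rewrite (dform_sol_form aF hc sfe Vx Mx HW efe s0 s1); field.
Qed.

End Curvature.

(** * The conjugate differential of u up to the boundary *)

Section Pluriharmonic.
Context {R : realType}.
Local Notation E := 'M[R]_2.
Implicit Types (p q v w : E) (g : E -> R).

Lemma closure_zero (S V : set E) (phi : E -> R) q : open V -> V q -> closure S q ->
  {for q, continuous phi} -> (forall x, V x -> S x -> phi x = 0) -> phi q = 0.
Proof.
move=> oV Vq cS cphi z; apply/eqP; rewrite -normr_le0 leNgt; apply/negP => n0.
have [r r0 Hr] := cont_ball cphi n0.
have [x [Sx [Vx bx]]] : (S `&` (V `&` ball q r)) !=set0.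
  by apply: cS; apply: filterI; [exact: (open_near oV Vq)|exact: nbhsx_ballx].
by have := Hr x bx; rewrite (z x Vx Sx) subr0 ltxx.
Qed.

Lemma ip_Jst (G v : E) : ip (Jst G) v = - ip G (Jst v).
Proof. by rewrite !ipE !mxE /=; ring. Qed.

(** The one-form v |-> - (J v) g, which is d^c g up to sign. *)
Definition dc g x : E := Jst (gradient g x).

Lemma smooth_dc V g : open V -> smooth_on V g -> smooth_mx V (dc g).
Proof.
move=> oV sg j k; under eq_fun do rewrite mxE.
case: (k == 0); last by exact: (smooth_gradient sg j 0).
exact: smoothN oV (smooth_gradient sg j 1).
Qed.

Lemma ip_dc V g x v : V x -> smooth_on V g -> ip (dc g x) v = - 'D_(Jst v) g x.
Proof. by move=> Vx sg; rewrite /dc ip_Jst -derive_gradient//; exact: smooth_diff sg Vx. Qed.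

Variables (Omega O : set E) (u : E -> R).
Hypothesis oO : open Omega.
Hypothesis openO : open O.
Hypothesis ph : pluriharmonic (O `&` closure Omega) u.

(** The function u is given on one side of M only. The values of an extension on
    that side determine its derivatives at the points of M. *)
Definition extends (V : set E) g : Prop :=
  [/\ open V, V `<=` O, smooth_on V g & forall x, V x -> closure Omega x -> g x = u x].

Lemma exists_extends q : O q -> closure Omega q -> exists V g, V q /\ extends V g.
Proof.
move=> Oq cq; have [su _] := ph.
have [V [g [[oV Vq] sg eg]]] := su q (conj Oq cq).
exists (V `&` O), g; split=> //; split.
- exact: openI.
- by move=> x [].
- exact: smooth_sub (@subIsetl _ _ _) sg.
- by move=> x [Vx Ox] cx; exact: eg.
Qed.

(** Derivatives at a boundary point are limits of derivatives inside Omega. *)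
Lemma extends_gradient V V' g g' q : extends V g -> extends V' g' -> V q -> V' q ->
  closure Omega q -> gradient g q = gradient g' q.
Proof.
move=> [oV _ sg eg] [oV' _ sg' eg'] Vq Vq' cq; apply/matrixP => j k; rewrite !mxE.
apply/eqP; rewrite -subr_eq0; apply/eqP.
set e := delta_mx j k.
have sd := smooth_der e (smooth_sub (@subIsetl _ V V') sg).
have sd' := smooth_der e (smooth_sub (@subIsetr _ V V') sg').
have oW := openI oV oV'.
have W q' : V q' -> V' q' -> (V `&` V') q' by [].
apply: (closure_zero (phi := fun x => 'D_e g x - 'D_e g' x) oW (W q Vq Vq') cq).
  exact: Ck_cont ((smooth_onP _ _).1 (smoothB oW sd sd') 0) (W q Vq Vq').
move=> x [Vx Vx'] Ox; apply/eqP; rewrite subr_eq0; apply/eqP.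
apply: (eq_on_derive e (openI oW oO)); first by [].
by move=> y [[Vy Vy'] Oy]; have cy := subset_closure Oy; rewrite eg// eg'.
Qed.

(** The equation d dbar u = 0 holds inside Omega; it passes to the boundary by
    continuity of the second derivatives. *)
Lemma extends_hessian V g q (j k : 'I_2) : extends V g -> V q -> closure Omega q ->
  'D_(delta_mx j 0) (fun x => 'D_(delta_mx k 0) g x) q
    + 'D_(delta_mx j 1) (fun x => 'D_(delta_mx k 1) g x) q = 0 /\
  'D_(delta_mx j 0) (fun x => 'D_(delta_mx k 1) g x) q
    - 'D_(delta_mx j 1) (fun x => 'D_(delta_mx k 0) g x) q = 0.
Proof.
move=> [oV VO sg eg] Vq cq.
have s2 v w : smooth_on V (fun x => 'D_v (fun y => 'D_w g y) x) := smooth_der v (smooth_der w sg).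
have oN : open (V `&` Omega) := openI oV oO.
have inside x : V x -> Omega x ->
   'D_(delta_mx j 0) (fun x => 'D_(delta_mx k 0) g x) x
    + 'D_(delta_mx j 1) (fun x => 'D_(delta_mx k 1) g x) x = 0 /\
  'D_(delta_mx j 0) (fun x => 'D_(delta_mx k 1) g x) x
    - 'D_(delta_mx j 1) (fun x => 'D_(delta_mx k 0) g x) x = 0.
  move=> Vx Ox; have [_ H] := ph.
  have ix : interior (O `&` closure Omega) x.
    rewrite /interior; apply: (filterS _ (open_near oN (conj Vx Ox))) => y [Vy Oy].
    by split; [exact: VO|exact: subset_closure].
  have dzb y : complex.Re (dzbar k (fun q => ((u q)%:C)%C) y) = 2^-1 * 'D_(delta_mx k 0) u y /\
      complex.Im (dzbar k (fun q => ((u q)%:C)%C) y) = 2^-1 * 'D_(delta_mx k 1) u y.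
    have cd v : cderive (fun q => ((u q)%:C)%C) y v = (('D_v u y)%:C)%C.
      by rewrite /cderive; congr (_ +i* _)%C; exact: dC.
    rewrite /dzbar !cd; move: ('D__ u y) ('D__ u y) => a b.
    have rC (s : R) : complex.Re (s%:C)%C = s by [].
    have iC (s : R) : complex.Im (s%:C)%C = 0 by [].
    by split; rewrite !(ReM, ImM, ReD, ImD, Rei, Imi, Re2V, Im2V, rC, iC); ring.
  have e1 v w : 'D_v (fun y => 2^-1 * 'D_w u y) x = 2^-1 * 'D_v (fun y => 'D_w g y) x.
    rewrite -[RHS]add0r -[X in X + _](mul0r ('D_w g x)) -(dC (2^-1) x v).
    rewrite -(dM v (diffC _ _) (smooth_diff (smooth_der w sg) Vx)).
    apply: (eq_on_derive v oN (conj Vx Ox)) => y [Vy Oy]; congr (_ * _).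
    apply: (eq_on_derive w oN (conj Vy Oy)) => z [Vz Oz].
    by rewrite eg//; exact: subset_closure.
  pose P a b := 'D_a (fun y => 'D_b g y) x.
  have cd v : cderive (dzbar k (fun q => ((u q)%:C)%C)) x v =
      ((2^-1 * P v (delta_mx k 0)) +i* (2^-1 * P v (delta_mx k 1)))%C.
    have pair (a b a' b' : R) : a = a' -> b = b' -> (a +i* b = a' +i* b')%C by move=> -> ->.
    apply: pair; rewrite /P -e1; apply: (eq_on_derive v oN (conj Vx Ox)) => y _.
      exact: (dzb y).1.
    exact: (dzb y).2.
  have h := H x ix j k; rewrite /dz !cd in h.
  move: h (congr1 (@complex.Re R) h) (congr1 (@complex.Im R) h) => _.
  rewrite -!/(P _ _); move: (P (delta_mx j 0) (delta_mx k 0)) (P (delta_mx j 0) (delta_mx k 1))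
    (P (delta_mx j 1) (delta_mx k 0)) (P (delta_mx j 1) (delta_mx k 1)) => a b c d.
  rewrite !(ReM, ImM, ReD, ImD, ReN, ImN, Rei, Imi, Re2V, Im2V, ReP, ImP).
  rewrite ?[complex.Re 0]/0 ?[complex.Im 0]/0 => h1 h2.
  split.
    by apply: (eq_by (congr1 ( *%R 4) h1)); field.
  by apply: (eq_by (congr1 ( *%R 4) h2)); field.
split.
  apply: (closure_zero (S := Omega) (phi := fun x => 'D_(delta_mx j 0) (fun x => 'D_(delta_mx k 0) g x) x
    + 'D_(delta_mx j 1) (fun x => 'D_(delta_mx k 1) g x) x) oV Vq cq).
    exact: Ck_cont ((smooth_onP _ _).1 (smoothD oV (s2 _ _) (s2 _ _)) 0) Vq.
  by move=> x Vx Ox; have [] := inside x Vx Ox.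
apply: (closure_zero (S := Omega) (phi := fun x => 'D_(delta_mx j 0) (fun x => 'D_(delta_mx k 1) g x) x
    - 'D_(delta_mx j 1) (fun x => 'D_(delta_mx k 0) g x) x) oV Vq cq).
  exact: Ck_cont ((smooth_onP _ _).1 (smoothB oV (s2 _ _) (s2 _ _)) 0) Vq.
by move=> x Vx Ox; have [] := inside x Vx Ox.
Qed.

(** By extends_hessian the Hessian of g is of opposite sign on (v, w) and on
    (J v, J w), which amounts to d d^c g = 0. *)
Lemma dc_closed V g q v w : extends V g -> V q -> closure Omega q -> d1 (dc g) q v w = 0.
Proof.
move=> ex Vq cq; have hh j k := extends_hessian j k ex Vq cq.
have [oV VO sg eg] := ex.
pose D a b := 'D_a (fun x => 'D_b g x) q.
have D1 a b : 'D_a (fun x => ip (dc g x) b) q = - D a (Jst b).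
  rewrite /D -(dN _ (smooth_diff (smooth_der (Jst b) sg) Vq)).
  by apply: (eq_on_derive a oV Vq) => x Vx; exact: ip_dc Vx sg.
have sym a b : D a b = D b a := smooth_comm a b oV Vq sg.
have lin a b : D a b = a 0 0 * D (delta_mx 0 0) b + a 0 1 * D (delta_mx 0 1) b
   + a 1 0 * D (delta_mx 1 0) b + a 1 1 * D (delta_mx 1 1) b.
  exact: (lin1_derive (smooth_diff (smooth_der b sg) Vq) a).
have hD j k : D (delta_mx j 0) (delta_mx k 0) = - D (delta_mx j 1) (delta_mx k 1) /\
    D (delta_mx j 0) (delta_mx k 1) = D (delta_mx j 1) (delta_mx k 0).
  have [h1 h2] := hh j k; split; apply/eqP.
    by rewrite -addr_eq0; apply/eqP; exact: h1.
  by rewrite -subr_eq0; apply/eqP; exact: h2.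
have exp a b : D a (Jst b) =
    a 0 0 * (- b 0 1 * D (delta_mx 0 0) (delta_mx 0 0) + b 0 0 * D (delta_mx 0 0) (delta_mx 0 1)
             - b 1 1 * D (delta_mx 0 0) (delta_mx 1 0) + b 1 0 * D (delta_mx 0 0) (delta_mx 1 1))
  + a 0 1 * (- b 0 1 * D (delta_mx 0 1) (delta_mx 0 0) + b 0 0 * D (delta_mx 0 1) (delta_mx 0 1)
             - b 1 1 * D (delta_mx 0 1) (delta_mx 1 0) + b 1 0 * D (delta_mx 0 1) (delta_mx 1 1))
  + a 1 0 * (- b 0 1 * D (delta_mx 1 0) (delta_mx 0 0) + b 0 0 * D (delta_mx 1 0) (delta_mx 0 1)
             - b 1 1 * D (delta_mx 1 0) (delta_mx 1 0) + b 1 0 * D (delta_mx 1 0) (delta_mx 1 1))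
  + a 1 1 * (- b 0 1 * D (delta_mx 1 1) (delta_mx 0 0) + b 0 0 * D (delta_mx 1 1) (delta_mx 0 1)
             - b 1 1 * D (delta_mx 1 1) (delta_mx 1 0) + b 1 0 * D (delta_mx 1 1) (delta_mx 1 1)).
  have e s : D (delta_mx s.1 s.2) (Jst b) = - b 0 1 * D (delta_mx s.1 s.2) (delta_mx 0 0)
     + b 0 0 * D (delta_mx s.1 s.2) (delta_mx 0 1) - b 1 1 * D (delta_mx s.1 s.2) (delta_mx 1 0)
     + b 1 0 * D (delta_mx s.1 s.2) (delta_mx 1 1).
    rewrite sym lin !mxE /= !(sym (delta_mx s.1 s.2)).
    move: (D (delta_mx 0 0) _) (D (delta_mx 0 1) _) (D (delta_mx 1 0) _) (D (delta_mx 1 1) _) => d0 d1' d2 d3.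
    by ring.
  by rewrite lin (e (0, 0)) (e (0, 1)) (e (1, 0)) (e (1, 1)).
rewrite /d1 !D1 !exp.
move: (hD 0 0) (hD 0 1) (hD 1 0) (hD 1 1).
rewrite !(sym (delta_mx 0 1) (delta_mx 0 0)) !(sym (delta_mx 1 _) (delta_mx 0 _)).
rewrite !(sym (delta_mx 1 1) (delta_mx 1 0)).
move: (D (delta_mx 0 0) (delta_mx 0 0)) (D (delta_mx 0 0) (delta_mx 0 1)) (D (delta_mx 0 0) (delta_mx 1 0))
  (D (delta_mx 0 0) (delta_mx 1 1)) (D (delta_mx 0 1) (delta_mx 0 1)) (D (delta_mx 0 1) (delta_mx 1 0))
  (D (delta_mx 0 1) (delta_mx 1 1)) (D (delta_mx 1 0) (delta_mx 1 0)) (D (delta_mx 1 0) (delta_mx 1 1))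
  (D (delta_mx 1 1) (delta_mx 1 1)) => h00 h01 h02 h03 h11 h12 h13 h22 h23 h33.
move=> [-> _] [-> ->] _ [-> _].
move: (v 0 0) (v 0 1) (v 1 0) (v 1 1) (w 0 0) (w 0 1) (w 1 0) (w 1 1) => *; ring.
Qed.

End Pluriharmonic.

(** * Vanishing of f_1 and of the torsion *)

Section DerivativeFormulas.
Context {R : realType}.
Local Notation E := 'M[R]_2.

Lemma d1_scale2 (k : R) V (a : E -> R) (al : E -> E) q v w : open V -> V q ->
  smooth_on V a -> smooth_mx V al ->
  d1 (fun x => (k * a x) *: al x) q v w =
  k * ('D_v a q * ip (al q) w - 'D_w a q * ip (al q) v + a q * d1 al q v w).
Proof.
move=> oV Vq sa sal; have da := smooth_diff sa Vq.
rewrite (d1Z _ _ oV Vq (smoothM oV (smoothC V k) sa) sal).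
rewrite (dM v (diffC k q) da) (dM w (diffC k q) da) !dC.
by move: ('D_v a q) ('D_w a q) => *; ring.
Qed.

Lemma derive_quadric (g t a b : E -> R) q v : differentiable g q -> differentiable t q ->
  differentiable a q -> differentiable b q ->
  'D_v (fun x => g x * t x + 2 * (a x ^+ 2 + b x ^+ 2)) q =
  'D_v g q * t q + g q * 'D_v t q + 4 * (a q * 'D_v a q + b q * 'D_v b q).
Proof.
move=> dg dt da db.
rewrite (dD v (diffM dg dt) (diffM (diffC 2 q) (diffD (diffM da da) (diffM db db)))).
rewrite (dM v (diffC 2 q) (diffD (diffM da da) (diffM db db))) (dD v (diffM da da) (diffM db db)).
rewrite (dM v da da) (dM v db db) (dM v dg dt) dC.
by move: ('D_v a q) ('D_v b q) ('D_v g q) ('D_v t q) => *; ring.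
Qed.

End DerivativeFormulas.

Section Conjugate.
Context {R : realType}.
Local Notation E := 'M[R]_2.
Implicit Types (p q v w : E).

(** The function |f_1|^2. *)
Definition levi (c : @chart R) (g : E -> R) x : R := dirder (cX c) g x ^+ 2 + dirder (cY c) g x ^+ 2.
Definition tau (c : @chart R) (g : E -> R) x : R := ip (dc g x) (cT c x).
(** Annihilated by X and Y when f_0 = 0, see Cfun_derive. *)
Definition Cfun (c : @chart R) (g : E -> R) x : R := g x * tau c g x + 2 * levi c g x.

Variables (Omega O : set E) (theta : E -> E) (u : E -> R).
Local Notation M := (boundary Omega).
Hypothesis oO : open Omega.
Hypothesis sb : smooth_boundary Omega.
Hypothesis psh : pseudohermitian M theta.
Hypothesis openO : open O.
Hypothesis ph : pluriharmonic (O `&` closure Omega) u.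

Definition ph_gauge p (F : @frame R) (c : @chart R) (g : E -> R) : Prop :=
  [/\ adapted_frame M theta F, chart_of M theta F p c, extends Omega O u (cV c) g
    & forall x, cV c x -> g x != 0].

Section InChart.
Variables (F : @frame R) (p0 : E) (c : @chart R) (g : E -> R).
Hypothesis aF : adapted_frame M theta F.
Hypothesis hc : chart_of M theta F p0 c.
Hypothesis ex : extends Omega O u (cV c) g.
Let oV := co_open hc.
Let sg : smooth_on (cV c) g. Proof. by case: ex. Qed.
Local Notation fX := (dirder (cX c) g).
Local Notation fY := (dirder (cY c) g).
Let sX : smooth_on (cV c) fX := smooth_dirder oV (co_sX hc) sg.
Let sY : smooth_on (cV c) fY := smooth_dirder oV (co_sY hc) sg.
Let sdc : smooth_mx (cV c) (dc g) := smooth_dc oV sg.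
Let stau : smooth_on (cV c) (tau c g) := smooth_ip2 oV sdc (co_sT hc).
Let cM q : M q -> closure Omega q. Proof. by case. Qed.

Lemma dc_XY q : cV c q -> M q -> ip (dc g q) (cX c q) = fY q /\ ip (dc g q) (cY c q) = - fX q.
Proof.
move=> Vq Mq; rewrite !(ip_dc _ Vq sg); have [-> ->] := ch_J aF hc Vq Mq.
by rewrite (dlinN _ (smooth_diff sg Vq)) opprK.
Qed.

Lemma smooth_Cfun : smooth_on (cV c) (Cfun c g).
Proof.
have s2 : smooth_on (cV c) (levi c g) := smoothD oV (smoothM oV sX sX) (smoothM oV sY sY).
exact: smoothD oV (smoothM oV sg stau) (smoothM oV (smoothC _ 2) s2).
Qed.

Let s2 : smooth_on (cV c) (fun=> 2) := smoothC (cV c) (2 : R).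
Let sm2 : smooth_on (cV c) (fun=> - 2) := smoothC (cV c) (- 2 : R).

Lemma dform_dc (k : E -> R) q : cV c q -> M q -> smooth_on (cV c) k ->
  dform (fun x v w => k x * wedge11 (dc g x) (cth c x) v w) q (cT c q) (cX c q) (cY c q)
  = - (fX q * 'D_(cX c q) k q + fY q * 'D_(cY c q) k q) + k q * tau c g q / 2.
Proof.
move=> Vq Mq sk; have [aX aY] := dc_XY Vq Mq.
have tX := ch_tanX aF hc Vq Mq; have tY := ch_tanY aF hc Vq Mq.
rewrite (dform_Z _ _ _ Vq sk (form2_wedge11 oV sdc (co_sth hc))).
rewrite (dform_wedge11 _ _ _ oV Vq sdc (co_sth hc)) /wedge12.
rewrite !(dc_closed oO ph _ _ ex Vq (cM Mq)).
have -> : d1 (cth c) q (cY c q) (cT c q) = 0.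
  by rewrite /d1 -opprB -/(d1 _ _ _ _) (ch_dthT aF hc Vq Mq tY) oppr0.
rewrite (ch_dthT aF hc Vq Mq tX) (ch_dthXY aF hc Vq Mq) /wedge11 aX aY.
rewrite (ch_thT aF hc Vq Mq) (ch_thX psh aF hc Vq Mq) (ch_thY psh aF hc Vq Mq) -/(tau c g q).
by move: ('D_(cT c q) k q) ('D_(cX c q) k q) ('D_(cY c q) k q) (fX q) (fY q) => *; field.
Qed.

Hypothesis f0 : forall q, cV c q -> M q -> dirder (cT c) g q = 0.

Let S2X := smooth_mxZ oV (smoothM oV sm2 sX) (co_sa1 hc).
Let S2Y := smooth_mxZ oV (smoothM oV s2 sY) (co_sa2 hc).

(** This is d df = 0, with df = 2 (Xf) a1 - 2 (Yf) a2 on M because f_0 = 0. *)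
Lemma grad_closed q v w : cV c q -> M q -> tangent M q v -> tangent M q w ->
  - 2 * ('D_v fX q * ip (ca1 c q) w - 'D_w fX q * ip (ca1 c q) v) - 2 * fX q * d1 (ca1 c) q v w
  + 2 * ('D_v fY q * ip (ca2 c q) w - 'D_w fY q * ip (ca2 c q) v) + 2 * fY q * d1 (ca2 c) q v w = 0.
Proof.
move=> Vq Mq tv tw.
have H x : cV c x -> cV c x -> M x -> forall s, tangent M x s ->
   ip (gradient g x + (- 2 * fX x) *: ca1 c x + (2 * fY x) *: ca2 c x) s = 0.
  move=> Vx _ Mx s ts; have dg := smooth_diff sg Vx.
  rewrite !ipDl !ipZl -(derive_gradient s dg) {1}(ch_span psh aF hc Vx Mx ts).
  rewrite !(dlinD _ _ dg) !(dlinZ _ _ dg) -(dirderE (cT c) g x) -(dirderE (cX c) g x) -(dirderE (cY c) g x).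
  by rewrite (f0 Vx Mx); move: (fX x) (fY x) => *; ring.
have sgr := smooth_gradient sg.
have := ch_pullback oO sb psh aF hc Vq Mq oV Vq (smooth_mxD oV (smooth_mxD oV sgr S2X) S2Y) H tv tw.
rewrite (d1D _ _ oV Vq (smooth_mxD oV sgr S2X) S2Y) (d1D _ _ oV Vq sgr S2X).
rewrite (d1_gradient _ _ oV Vq sg) (d1_scale2 _ _ _ oV Vq sX (co_sa1 hc)).
rewrite (d1_scale2 _ _ _ oV Vq sY (co_sa2 hc)) => <-.
move: (dirder (cX c) g) (dirder (cY c) g) => A B.
by move: ('D_v A q) ('D_w A q) ('D_v B q) ('D_w B q) => *; ring.
Qed.

Let S3T := smooth_mxZ oV (smoothM oV (smoothC (cV c) (-1 : R)) stau) (co_sth hc).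
Let S3X := smooth_mxZ oV (smoothM oV sm2 sY) (co_sa1 hc).
Let S3Y := smooth_mxZ oV (smoothM oV sm2 sX) (co_sa2 hc).

(** This is d d^c u = 0, with d^c u = tau theta + 2 (Yf) a1 + 2 (Xf) a2 on M. *)
Lemma dc_decomposed q v w : cV c q -> M q -> tangent M q v -> tangent M q w ->
  - ('D_v (tau c g) q * ip (cth c q) w - 'D_w (tau c g) q * ip (cth c q) v) - tau c g q * d1 (cth c) q v w
  - 2 * ('D_v fY q * ip (ca1 c q) w - 'D_w fY q * ip (ca1 c q) v) - 2 * fY q * d1 (ca1 c) q v w
  - 2 * ('D_v fX q * ip (ca2 c q) w - 'D_w fX q * ip (ca2 c q) v) - 2 * fX q * d1 (ca2 c) q v w = 0.
Proof.
move=> Vq Mq tv tw.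
have H x : cV c x -> cV c x -> M x -> forall s, tangent M x s ->
   ip (dc g x + (-1 * tau c g x) *: cth c x + (- 2 * fY x) *: ca1 c x + (- 2 * fX x) *: ca2 c x) s = 0.
  move=> Vx _ Mx s ts; have [eX eY] := dc_XY Vx Mx.
  rewrite !ipDl !ipZl {1}(ch_span psh aF hc Vx Mx ts) !ipDr !ipZr eX eY -/(tau c g x).
  by move: (fX x) (fY x) => *; ring.
have S1 := smooth_mxD oV sdc S3T; have S12 := smooth_mxD oV S1 S3X.
have := ch_pullback oO sb psh aF hc Vq Mq oV Vq (smooth_mxD oV S12 S3Y) H tv tw.
rewrite (d1D _ _ oV Vq S12 S3Y) (d1D _ _ oV Vq S1 S3X) (d1D _ _ oV Vq sdc S3T).
rewrite (dc_closed oO ph _ _ ex Vq (cM Mq)).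
rewrite (d1_scale2 _ _ _ oV Vq stau (co_sth hc)).
rewrite (d1_scale2 _ _ _ oV Vq sX (co_sa2 hc)) (d1_scale2 _ _ _ oV Vq sY (co_sa1 hc)) => <-.
move: (dirder (cX c) g) (dirder (cY c) g) (tau c g) => A B t.
by move: ('D_v A q) ('D_w A q) ('D_v B q) ('D_w B q) ('D_v t q) ('D_w t q) => *; ring.
Qed.

(** The closedness of df and d^c u gives the trace and the antisymmetric part of
    the second derivatives of f along X and Y, and the derivatives of tau; the
    soliton equation gives the traceless symmetric part. *)
Lemma Cfun_derive q : cV c q -> M q ->
  dirder (cX c) fX q - dirder (cY c) fY q
    + (ip (co2 c q) (cY c q) * fX q + ip (co2 c q) (cX c q) * fY q) + ct2 c q * g q = 0 ->
  dirder (cX c) fY q + dirder (cY c) fX q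
    - (ip (co2 c q) (cX c q) * fX q - ip (co2 c q) (cY c q) * fY q) + ct1 c q * g q = 0 ->
  dirder (cX c) (Cfun c g) q = 0 /\ dirder (cY c) (Cfun c g) q = 0.
Proof.
move=> Vq Mq sol1 sol2.
have tT := ch_tanT aF hc Vq Mq; have tX := ch_tanX aF hc Vq Mq; have tY := ch_tanY aF hc Vq Mq.
have [[aX aY bX bY] [aT bT]] := ch_a aF hc Vq Mq.
have [p1 p2] := ch_da_XY psh aF hc Vq Mq.
have [p3 p4] := ch_da_TX psh aF hc Vq Mq.
have [p5 p6] := ch_da_TY psh aF hc Vq Mq.
have qT := ch_thT aF hc Vq Mq; have qX := ch_thX psh aF hc Vq Mq; have qY := ch_thY psh aF hc Vq Mq.
have tTX := ch_dthT aF hc Vq Mq tX; have tTY := ch_dthT aF hc Vq Mq tY.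
have tXY := ch_dthXY aF hc Vq Mq.
have eXY := grad_closed Vq Mq tX tY; have eTX := grad_closed Vq Mq tT tX; have eTY := grad_closed Vq Mq tT tY.
have hXY := dc_decomposed Vq Mq tX tY; have hTX := dc_decomposed Vq Mq tT tX; have hTY := dc_decomposed Vq Mq tT tY.
rewrite aX aY bX bY p1 p2 in eXY; rewrite aX bX aT bT p3 p4 in eTX; rewrite aY bY aT bT p5 p6 in eTY.
rewrite qX qY aX aY bX bY p1 p2 tXY in hXY; rewrite qT qX aX bX aT bT p3 p4 tTX in hTX.
rewrite qT qY aY bY aT bT p5 p6 tTY in hTY.
have dX := smooth_diff sX Vq; have dY := smooth_diff sY Vq; have dt := smooth_diff stau Vq.
have dg := smooth_diff sg Vq.
have DC v := derive_quadric v dg dt dX dY.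
rewrite (dirderE _ (Cfun c g)) (dirderE (cY c) (Cfun c g)) !DC -(dirderE (cX c) g q) -(dirderE (cY c) g q).
rewrite (dirderE _ fX) (dirderE _ fY) in sol1; rewrite (dirderE _ fY) (dirderE _ fX) in sol2.
move: sol1 sol2 eXY eTX eTY hXY hTX hTY.
move: (dirder (cX c) g) (dirder (cY c) g) (tau c g) => A B t'.
move: ('D_(cX c q) A q) ('D_(cY c q) A q) ('D_(cT c q) A q) => XX YX TX.
move: ('D_(cX c q) B q) ('D_(cY c q) B q) ('D_(cT c q) B q) => XY YY TY.
move: ('D_(cX c q) t' q) ('D_(cY c q) t' q) ('D_(cT c q) t' q) => Xt Yt Tt.
move: (A q) (B q) (t' q) (g q) (ct1 c q) (ct2 c q) => a b t f t1 t2.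
move: (ip (co2 c q) (cX c q)) (ip (co2 c q) (cY c q)) (ip (co2 c q) (cT c q)) => x y z.
move=> s1 s2' eXY eTX eTY hXY hTX hTY.
have c1 (l1 l2 l3 l4 l5 l6 k1 k2 k3 : R) : l1 = 0 -> l2 = 0 -> l3 = 0 -> l4 = 0 -> l5 = 0 -> l6 = 0 ->
    k1 * (l1 + l2) + k2 * (l3 + l4) + k3 * (l5 + l6) = 0.
  by move=> -> -> -> -> -> ->; rewrite !addr0 !mulr0 !addr0.
have n (l : R) : l = 0 -> - l = 0 by move=> ->; rewrite oppr0.
split.
  by apply: (eq_by (c1 _ _ _ _ _ _ f (2 * a) (2 * b) hTX (n _ eTY) s1 hXY s2' (n _ eXY))); field.
by apply: (eq_by (c1 _ _ _ _ _ _ f (2 * a) (2 * b) hTY eTX s2' eXY (n _ s1) hXY)); field.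
Qed.

End InChart.

Hypothesis MO : M `<=` O.
Variable f : E -> R.
Hypothesis fu : forall x, M x -> f x = u x.
Hypothesis f_neq0 : forall x, M x -> f x != 0.

Lemma extends_f V g x : extends Omega O u V g -> V x -> M x -> g x = f x.
Proof. by move=> [_ _ _ eg] Vx Mx; rewrite eg// ?fu//; case: Mx. Qed.

Lemma exists_ph_gauge p (F : @frame R) : M p -> adapted_frame M theta F -> fr_dom F p ->
  exists c g, ph_gauge p F c g.
Proof.
move=> Mp aF Fp.
have [_ [sth _] _ _] := psh; have [c hc] := exists_chart sth aF Mp Fp.
have cp : closure Omega p by case: Mp.
have [V [g [Vp ex]]] := exists_extends openO ph (MO Mp) cp.
have [oV VO sg eg] := ex.
have gp : 0 < `|g p| by rewrite normr_gt0 (extends_f ex Vp Mp) f_neq0.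
have [r r0 Hr] := cont_ball (Ck_cont ((smooth_onP _ _).1 sg 0) Vp) gp.
pose N := interior (ball p r).
have sub x : (cV c `&` (V `&` N)) x -> V x by move=> [_ []].
have Np : N p by exact: nbhsx_ballx.
exists (shrink c (V `&` N)), g; split=> //.
- exact: chart_shrink (openI oV (@open_interior _ _)) (conj Vp Np) hc.
- split=> /=; first exact: openI (co_open hc) (openI oV (@open_interior _ _)).
  + by move=> x /sub /VO.
  + exact: smooth_sub sub sg.
  + by move=> x /sub; exact: eg.
- move=> x [_ [_ /interior_subset /Hr]]; apply: contraTneq => ->.
  by rewrite subr0 ltxx.
Qed.

Lemma ph_gauge_inv p p' F F' c c' g g' q :
  ph_gauge p F c g -> ph_gauge p' F' c' g' -> cV c q -> cV c' q -> M q ->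
  [/\ g' q = g q, dc g' q = dc g q, cth c' q = cth c q,
    tau c' g' q = tau c g q & levi c' g' q = levi c g q].
Proof.
move=> [aF hc ex _] [aF' hc' ex' _] Vq Vq' Mq.
have cq : closure Omega q by case: Mq.
have [_ _ sg _] := ex; have [_ _ sg' _] := ex'.
have dE : dc g' q = dc g q by rewrite /dc (extends_gradient oO ex' ex Vq' Vq cq).
split=> //.
- by rewrite (extends_f ex' Vq' Mq) (extends_f ex Vq Mq).
- exact: (fc_th hc hc' Vq Vq' Mq).
- by rewrite /tau dE (fc_T psh aF aF' hc hc' Vq Vq' Mq).
have Wq : (cV c `&` cV c') q by [].
have e x (Vx : cV c x) (Mx : M x) := extends_f ex Vx Mx.
have e' x (Vx : cV c' x) (Mx : M x) := extends_f ex' Vx Mx.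
rewrite /levi; have [-> ->] := fc_f psh aF aF' hc hc' sg e sg' e' Wq Mq.
move: (fc_norm psh aF aF' hc hc' Vq Vq' Mq).
move: (rotc c c' q) (rots c c' q) (dirder (cX c) g q) (dirder (cY c) g q) => A B a b n.
by transitivity ((A ^+ 2 + B ^+ 2) * (a ^+ 2 + b ^+ 2)); [ring|rewrite n mul1r].
Qed.

Hypothesis bO : bounded_set Omega.
Hypothesis cpt : compact M.
Hypothesis frames : forall p, M p -> exists2 F : @frame R, adapted_frame M theta F & fr_dom F p.
Hypothesis sol : forall F : @frame R, adapted_frame M theta F -> forall p, M p -> fr_dom F p ->
  cov_0 M F f p = 0 /\ cov_11 M F f p + 'i * A11 F p * ((f p)%:C)%C = 0.

Lemma gauge_f0 p F c g q : ph_gauge p F c g -> cV c q -> M q -> dirder (cT c) g q = 0.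
Proof.
move=> [aF hc ex _] Vq Mq; have [_ _ sg _] := ex.
have e x (Vx : cV c x) (Mx : M x) := extends_f ex Vx Mx.
by rewrite -(ch_cov0 aF hc Vq Mq sg e); have [] := sol aF Mq (co_dom hc Vq).
Qed.

Lemma gauge_Cfun p F c g q : ph_gauge p F c g -> cV c q -> M q ->
  dirder (cX c) (Cfun c g) q = 0 /\ dirder (cY c) (Cfun c g) q = 0.
Proof.
move=> hg Vq Mq; have [aF hc ex _] := hg; have [_ _ sg _] := ex.
have e x (Vx : cV c x) (Mx : M x) := extends_f ex Vx Mx.
have [_ s11] := sol aF Mq (co_dom hc Vq).
have [s1 s2] := ch_soliton aF hc Vq Mq sg e s11.
by apply: (Cfun_derive aF hc ex) => // x Vx Mx; exact: (gauge_f0 hg Vx Mx).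
Qed.

Lemma choose_gauge : exists G : E -> @frame R * @chart R * (E -> R),
  forall q, M q -> ph_gauge q (G q).1.1 (G q).1.2 (G q).2.
Proof.
have /choice[G HG] : forall q, exists G : @frame R * @chart R * (E -> R), M q -> ph_gauge q G.1.1 G.1.2 G.2.
  move=> q; have [Mq|nM] := pselect (M q); last first.
    by exists (Frame set0 (fun=> 0) (fun=> 0) (fun=> 0) (fun=> 0) (fun=> 0),
      Chart set0 (fun=> 0) (fun=> 0) (fun=> 0) (fun=> 0) (fun=> 0) (fun=> 0) (fun=> 0) (fun=> 0) (fun=> 0) (fun=> 0), fun=> 0).
  by have [F aF Fq] := frames Mq; have [c [g h]] := exists_ph_gauge Mq aF Fq; exists (F, c, g).
by exists G.
Qed.

(** Stokes' theorem for the form k d^c u /\ theta, where k and the density h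
    of its differential are given by formulas in the frames. *)
Lemma dc_stokes (k h : @chart R -> (E -> R) -> E -> R) :
  (forall p F c g p' F' c' g' q, ph_gauge p F c g -> ph_gauge p' F' c' g' ->
     cV c q -> cV c' q -> M q -> k c' g' q = k c g q /\ h c' g' q = h c g q) ->
  (forall c g q, 0 <= h c g q) ->
  (forall p F c g, ph_gauge p F c g -> smooth_on (cV c) (k c g)) ->
  (forall p F c g q, ph_gauge p F c g -> cV c q -> M q ->
     - (dirder (cX c) g q * dirder (cX c) (k c g) q + dirder (cY c) g q * dirder (cY c) (k c g) q)
     + k c g q * tau c g q / 2 = - (h c g q / 2)) ->
  forall p F c g q, ph_gauge p F c g -> cV c q -> M q -> h c g q = 0.
Proof.
move=> inv h_ge0 sk dk p F c g q hg Vq Mq; have [G HG] := choose_gauge.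
have invG x p' F' c' g' : ph_gauge p' F' c' g' -> cV c' x -> M x ->
    [/\ k (G x).1.2 (G x).2 x = k c' g' x, h (G x).1.2 (G x).2 x = h c' g' x,
       dc (G x).2 x = dc g' x & cth (G x).1.2 x = cth c' x].
  move=> h' Vx Mx; have gx := HG x Mx; have [_ hx _ _] := gx.
  have [e1 e2] := inv _ _ _ _ _ _ _ _ _ h' gx Vx (co_p hx) Mx.
  by have [_ e3 e4 _ _] := ph_gauge_inv h' gx Vx (co_p hx) Mx.
pose b x v w := k (G x).1.2 (G x).2 x * wedge11 (dc (G x).2 x) (cth (G x).1.2 x) v w.
have [_ <- _ _] := invG q _ _ _ _ hg Vq Mq.
apply: (@frame_stokes R Omega theta oO bO sb cpt psh b (fun x => h (G x).1.2 (G x).2 x)) => //.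
move=> p1 Mp1; have [F1 aF1 Fp1] := frames Mp1.
have [c1 [g1 hg1]] := exists_ph_gauge Mp1 aF1 Fp1.
have [_ hc1 ex1 _] := hg1; have [_ _ sg1 _] := ex1; have oV := co_open hc1.
have sk1 := sk _ _ _ _ hg1.
exists F1, c1, (fun x v w => k c1 g1 x * wedge11 (dc g1 x) (cth c1 x) v w); split=> //.
- exact: form2Z oV sk1 (form2_wedge11 oV (smooth_dc oV sg1) (co_sth hc1)).
- by move=> x v w Vx Mx tv tw; rewrite /b; have [-> _ -> ->] := invG x _ _ _ _ hg1 Vx Mx.
- move=> x Vx Mx; have [_ -> _ _] := invG x _ _ _ _ hg1 Vx Mx.
  by rewrite -(dk _ _ _ _ _ hg1 Vx Mx) (dform_dc aF1 hc1 ex1 Vx Mx sk1) !dirderE.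
Qed.

(** As X and Y annihilate C, the form - (C / f) d^c u /\ theta has the differential
    (C / f)^2 theta /\ d theta. *)
Lemma Cfun_eq0 p F c g q : ph_gauge p F c g -> cV c q -> M q -> Cfun c g q = 0.
Proof.
move=> hg Vq Mq.
have := @dc_stokes (fun c g x => - (Cfun c g x * (g x)^-1)) (fun c g x => (Cfun c g x * (g x)^-1) ^+ 2)
  _ (fun _ _ _ => sqr_ge0 _) _ _ _ _ _ _ _ hg Vq Mq.
have nz : g q != 0 by have [_ _ _ ->] := hg.
move=> H; apply/eqP; rewrite -(mulIr_eq0 _ (mulIf (invr_neq0 nz))) -sqrf_eq0; apply/eqP/H.
- move=> p1 F1 c1 g1 p2 F2 c2 g2 x h1 h2 V1 V2 Mx.
  by have [e1 _ _ e4 e5] := ph_gauge_inv h1 h2 V1 V2 Mx; rewrite /Cfun e1 e4 e5.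
- move=> p1 F1 c1 g1 [aF1 hc1 ex1 nz1]; have [oV _ sg1 _] := ex1.
  exact: smoothN oV (smoothM oV (smooth_Cfun hc1 ex1) (smoothV oV nz1 sg1)).
move=> p1 F1 c1 g1 x hg1 Vx Mx; have [aF1 hc1 ex1 nz1] := hg1; have [oV _ sg1 _] := ex1.
have [CX CY] := gauge_Cfun hg1 Vx Mx; rewrite !dirderE in CX CY.
have dC1 := smooth_diff (smooth_Cfun hc1 ex1) Vx; have dg1 := smooth_diff sg1 Vx.
have dV1 := smooth_diff (smoothV oV nz1 sg1) Vx.
have Dk y : 'D_y (fun x => - (Cfun c1 g1 x * (g1 x)^-1)) x =
    - ('D_y (Cfun c1 g1) x * (g1 x)^-1 + Cfun c1 g1 x * (- (g1 x) ^- 2 * 'D_y g1 x)).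
  by rewrite (dN y (diffM dC1 dV1)) (dM y dC1 dV1) (dV y dg1 (nz1 x Vx)).
rewrite (dirderE (cX c1) (fun x => - _)) (dirderE (cY c1) (fun x => - _)) !Dk CX CY.
rewrite -(dirderE (cX c1)) -(dirderE (cY c1)).
have CE : Cfun c1 g1 x = g1 x * tau c1 g1 x + 2 * (dirder (cX c1) g1 x ^+ 2 + dirder (cY c1) g1 x ^+ 2) by [].
have := nz1 x Vx; move: CE.
move: (Cfun c1 g1 x) (g1 x) (tau c1 g1 x) (dirder (cX c1) g1 x) (dirder (cY c1) g1 x).
move=> C r t a s e r0.
transitivity (- (C * (r * t + 2 * (a ^+ 2 + s ^+ 2)) / r ^+ 2 / 2)); first by field.
by rewrite -e; field.
Qed.

(** As C = 0, the form f d^c u /\ theta has the differential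
    4 |f_1|^2 theta /\ d theta. *)
Lemma levi_eq0 p F c g q : ph_gauge p F c g -> cV c q -> M q -> levi c g q = 0.
Proof.
move=> hg Vq Mq; apply/eqP; rewrite -(mulrI_eq0 _ (@mulfI R 4 _)) ?pnatr_eq0//; apply/eqP.
apply: (@dc_stokes (fun c g x => g x) (fun c g x => 4 * levi c g x) _ _ _ _ _ _ _ _ _ hg Vq Mq).
- move=> p1 F1 c1 g1 p2 F2 c2 g2 x h1 h2 V1 V2 Mx.
  by have [e1 _ _ _ e5] := ph_gauge_inv h1 h2 V1 V2 Mx; rewrite e1 e5.
- by move=> c1 g1 x; rewrite mulr_ge0// addr_ge0// sqr_ge0.
- by move=> p1 F1 c1 g1 [_ _ [_ _ sg _] _].
move=> p1 F1 c1 g1 x hg1 Vx Mx; have := Cfun_eq0 hg1 Vx Mx; rewrite /Cfun /levi.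
move: (g1 x) (tau c1 g1 x) (dirder (cX c1) g1 x) (dirder (cY c1) g1 x) => r t a s e.
by apply: (eq_by (congr1 ( *%R 2^-1) e)); field.
Qed.

(** Since f_1 = 0, the equation f_11 + i A_11 f = 0 reduces to A_11 f = 0. *)
Lemma torsion_eq0 F : adapted_frame M theta F -> forall p, M p -> fr_dom F p -> A11 F p = 0.
Proof.
move=> aF p Mp Fp; have [_ s11] := sol aF Mp Fp.
have [c [g hg]] := exists_ph_gauge Mp aF Fp.
have [_ hc ex nz] := hg; have [oV _ sg _] := ex; have Vp := co_p hc.
have e x (Vx : cV c x) (Mx : M x) := extends_f ex Vx Mx.
have z x : cV c x -> M x -> dirder (cX c) g x = 0 /\ dirder (cY c) g x = 0.
  move=> Vx Mx; have := levi_eq0 hg Vx Mx; rewrite /levi => /eqP.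
  by rewrite paddr_eq0 ?sqr_ge0// !sqrf_eq0 => /andP[/eqP -> /eqP ->].
have sX := smooth_dirder oV (co_sX hc) sg; have sY := smooth_dirder oV (co_sY hc) sg.
have DX v : tangent M p v -> 'D_v (dirder (cX c) g) p = 0.
  by move=> tv; apply: (tv _ _ (conj oV Vp) sX) => x Vx Mx; have [] := z x Vx Mx.
have DY v : tangent M p v -> 'D_v (dirder (cY c) g) p = 0.
  by move=> tv; apply: (tv _ _ (conj oV Vp) sY) => x Vx Mx; have [] := z x Vx Mx.
have tX := ch_tanX aF hc Vp Mp; have tY := ch_tanY aF hc Vp Mp.
have := ch_soliton aF hc Vp Mp sg e s11.
have XX : dirder (cX c) (dirder (cX c) g) p = 0 := DX _ tX.
have YX : dirder (cY c) (dirder (cX c) g) p = 0 := DX _ tY.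
have XY : dirder (cX c) (dirder (cY c) g) p = 0 := DY _ tX.
have YY : dirder (cY c) (dirder (cY c) g) p = 0 := DY _ tY.
have [-> ->] := z p Vp Mp; rewrite XX YX XY YY.
rewrite !mulr0 !(subr0, addr0, add0r) => -[/eqP + /eqP].
rewrite !mulf_eq0 (negbTE (nz p Vp)) !orbF => /eqP t2 /eqP t1.
have [] := co_t hc Vp Mp; rewrite t1 t2 /A11; case: (fr_tor F p) => a b /= <- <-.
by apply/eqP; rewrite eq_complex ReJ ImJ /= oppr0 !eqxx.
Qed.

End Conjugate.

Theorem corollary1p2 (R : realType)
    (Omega : set 'M[R]_2) (theta : 'M[R]_2 -> 'M[R]_2)
    (U : set 'M[R]_2) (u f : 'M[R]_2 -> R) (mu : R) :
  bounded_domain Omega ->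
  smooth_boundary Omega ->
  pseudohermitian (boundary Omega) theta ->
  (exists2 O : set 'M[R]_2, open O & U = O `&` closure Omega) ->
  simply_connected U ->
  boundary Omega `<=` U ->
  pluriharmonic U u ->
  (forall p, boundary Omega p -> f p = u p) ->
  closed_CR_Yamabe_soliton (boundary Omega) theta f mu ->
  (forall p, boundary Omega p -> f p != 0) ->
  [/\ closed_pseudohermitian (boundary Omega) theta,
      is_webster_curvature (boundary Omega) theta (fun=> mu)
    & vanishing_torsion (boundary Omega) theta].
Proof.
move=> [_ oO _ bO] sb psh [] O openO eU _ MU ph fu [cM [_ sf [W HW sol]]] f0.
have WE := soliton_curvature oO sb psh bO cM sf HW sol.
have frames p : boundary Omega p ->
    exists2 F : @frame R, adapted_frame (boundary Omega) theta F & fr_dom F p.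
  by move=> Mp; have [] := HW p Mp.
have MO : boundary Omega `<=` O by move=> x /MU; rewrite eU => -[].
rewrite eU in ph.
split; first by [].
- by move=> p Mp; rewrite -(WE p Mp); exact: HW.
move=> F aF p Mp Fp; apply: (torsion_eq0 oO sb psh openO ph MO fu f0 bO cM frames) => //.
move=> F' aF' q Mq Fq; have [e s11] := sol F' aF' q Mq Fq; split=> //.
move: e; rewrite (WE q Mq) => /eqP; rewrite -subr_eq0 addrAC subrr add0r.
by rewrite mulf_eq0 invr_eq0 pnatr_eq0 /= => /eqP.
Qed.
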